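(* Let $V:\mathbb{R}^d\to\mathbb{R}$ and $K:\mathbb{R}^d\to\mathbb{R}^d$ satisfy the following assumption: $V$ is strongly convex, so that $x\mapsto V(x)-\frac r2|x|^2$ is convex (with $r>0$); $\nabla V$ and $\nabla^2V$ have polynomial growth, i.e. $|\nabla V(x)|+|\nabla^2V(x)|\le C(1+|x|^{q})$ for some $q>0$; $K$ is bounded, Lipschitz on $\mathbb{R}^d$ with Lipschitz constant $L$, and has bounded second order derivatives; and $r>2L$. Let $X^i$ be the interacting particle system and $\tilde X^i$ the RBM-1 process with $N$ particles, batch size $p$ and time step $\tau$, coupled synchronously (same initial data, same Brownian motions), as defined in the context, and let $Z^i=\tilde X^i-X^i$. Then $$\sup_{t\ge 0}\|Z^1(t)\|\le C\sqrt{\frac{\tau}{p-1}+\tau^2},$$ where $C$ is independent of $N$, $p$ and $t$. Consequently, letting $\mu_N^{(1)}(t)$ be the first marginal of the interacting particle system (the law of $X^1(t)$) and $\tilde\mu_N^{(1)}(t)$ the first marginal of the RBM-1 process (the law of $\tilde X^1(t)$), $$\sup_{t\ge 0}W_2\big(\mu_N^{(1)}(t),\tilde\mu_N^{(1)}(t)\big)\le C\sqrt{\frac{\tau}{p-1}+\tau^2}\le C\sqrt{\tau}.$$ Here $C$ denotes a generic constant whose concrete value can change from one occurrence to the next.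
   Context: Setting. Let $p\ge 2$, $n\ge1$ be integers, $N=np$ and $\tau>0$; $t_m=m\tau$; $\sigma\ge0$ is a constant. On a probability space let $X_0^1,\dots,X_0^N$ be drawn independently from the same distribution $\nu$ on $\mathbb{R}^d$, let $B^1,\dots,B^N$ be independent standard $d$-dimensional Brownian motions, and for each $m\ge1$ let $\xi_{m-1}$ be a uniformly random division of $\{1,\dots,N\}$ into $n$ batches of size $p$; initial data, Brownian motions and all the divisions $\xi_0,\xi_1,\dots$ are mutually independent. Interacting particle system: for $i=1,\dots,N$, $$dX^i=-\nabla V(X^i)\,dt+\frac1{N-1}\sum_{j\ne i}K(X^i-X^j)\,dt+\sigma\,dB^i,\qquad X^i(0)=X^i_0.$$ RBM-1 process: $\tilde X^i$ is continuous in time, $\tilde X^i(0)=X_0^i$, and for $t\in[t_{m-1},t_m)$, with $\mathcal C$ the batch of the division $\xi_{m-1}$ containing $i$, $$d\tilde X^i=-\nabla V(\tilde X^i)\,dt+\frac1{p-1}\sum_{j\in\mathcal C,\,j\ne i}K(\tilde X^i-\tilde X^j)\,dt+\sigma\,dB^i.$$ (The same $X_0^i$ and $B^i$ are used for both systems: synchronous coupling.) Notation: $\|v\|=\sqrt{\mathbb{E}|v|^2}$ for a random vector $v$; $W_2(\mu,\mu')=\big(\inf_{\gamma\in\Pi(\mu,\mu')}\int_{\mathbb{R}^d\times\mathbb{R}^d}|x-y|^2d\gamma\big)^{1/2}$ is the Wasserstein-2 distance, $\Pi(\mu,\mu')$ being the set of joint distributions with marginals $\mu,\mu'$.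
   Formalization: The last inequality C√(τ/(p-1)+τ²) ≤ C√τ is stated only for τ ≤ 1, since it fails for large τ with constants independent of τ; the bound sup W₂ ≤ C√τ itself is proved for all τ > 0. *)

(* Defs.v *)
From HB Require Import structures.
From mathcomp Require Import all_boot all_order all_algebra.
From mathcomp Require Import all_classical all_reals all_analysis.

Set Implicit Arguments.
Unset Strict Implicit.
Unset Printing Implicit Defensive.

Import Order.TTheory GRing.Theory Num.Theory.
Import numFieldNormedType.Exports.

Local Open Scope classical_set_scope.
Local Open Scope ring_scope.

(* R^d is 'rV[R]_d, with its Borel sigma-algebra. *)
HB.instance Definition _ (R : realType) (m n : nat) :=
  @isMeasurable.Build (sigma_display (@open 'M[R]_(m, n))) 'M[R]_(m, n)
    (<<s @open 'M[R]_(m, n) >>) (@sigma_algebra0 _ setT _)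
    (@sigma_algebraC _ _) (@sigma_algebra_bigcup _ setT _).

(* The library norm on matrices is the sup norm; this is the Euclidean norm of
   a vector and the Frobenius norm of a matrix. *)
Definition enorm (R : realType) (m n : nat) (A : 'M[R]_(m, n)) : R :=
  Num.sqrt (\sum_(i < m) \sum_(j < n) A i j ^+ 2).

Definition partial (R : realType) (d : nat) (W : normedModType R)
    (j : 'I_d) (f : 'rV[R]_d -> W) (x : 'rV[R]_d) : W :=
  'D_(delta_mx 0 j) f x.

Definition grad (R : realType) (d : nat) (V : 'rV[R]_d -> R)
    (x : 'rV[R]_d) : 'rV[R]_d :=
  \row_(i < d) partial i V x.

Definition hessian (R : realType) (d : nat) (V : 'rV[R]_d -> R)
    (x : 'rV[R]_d) : 'M[R]_d :=
  \matrix_(i < d, j < d) partial j (partial i V) x.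

Record potential_assumption (R : realType) (d : nat) (V : 'rV[R]_d -> R)
    (r : R) : Prop := {
  r_gt0 : 0 < r;
  V_differentiable : forall x, differentiable V x;
  gradV_differentiable : forall x, differentiable (grad V) x;
  V_strongly_convex :
    convex_function [set: 'rV[R]_d] (fun x => V x - r / 2 * enorm x ^+ 2);
  V_polynomial_growth : exists C q : R, 0 < q /\
    forall x, enorm (grad V x) + enorm (hessian V x) <= C * (1 + enorm x `^ q)
}.

Record kernel_assumption (R : realType) (d : nat)
    (K : 'rV[R]_d -> 'rV[R]_d) (L : R) : Prop := {
  K_bounded : exists M : R, forall x, enorm (K x) <= M;
  K_lipschitz : forall x y, enorm (K x - K y) <= L * enorm (x - y);
  K_differentiable : forall x, differentiable K x;
  dK_differentiable : forall i x, differentiable (partial i K) x;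
  d2K_bounded : exists M : R, forall i j x,
    enorm (partial j (partial i K) x) <= M
}.

Definition mutually_independent (disp : measure_display)
    (T : measurableType disp) (R : realType) (P : probability T R)
    (I : eqType) (F : I -> set (set T)) : Prop :=
  forall (s : seq I) (A : I -> set T), uniq s ->
    (forall i, i \in s -> F i (A i)) ->
    P (\bigcap_(i in [set` s]) A i) = (\prod_(i <- s) P (A i))%E.

(* The sigma-algebra generated by the maps X i, i in D. *)
Definition sigma_of (disp disp' : measure_display) (T : measurableType disp)
    (T' : measurableType disp') (I : Type) (D : set I) (X : I -> T -> T') :
    set (set T) :=
  <<s \bigcup_(i in D) preimage_set_system setT (X i) measurable >>.

Definition increment (R : realType) (d : nat) (T : Type)
    (B : R -> T -> 'rV[R]_d) (s t : R) (k : 'I_d) (w : T) : R :=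
  (B t w - B s w) 0 k.

(* normal_prob takes the standard deviation.  Independence at index None/Some:
   the past up to time s and the d coordinates of the increment after s are
   mutually independent. *)
Record standard_brownian (R : realType) (d : nat) (disp : measure_display)
    (T : measurableType disp) (P : probability T R)
    (B : R -> {RV P >-> 'rV[R]_d}) : Prop := {
  brownian_start : {ae P, forall w, B 0 w = 0};
  brownian_continuous :
    {ae P, forall w, {within `[0, +oo[, continuous (fun t => B t w)}};
  brownian_gaussian : forall s t, 0 <= s -> s < t ->
    forall k (A : set R), measurable A ->
    P (increment B s t k @^-1` A) = normal_prob 0 (Num.sqrt (t - s)) A;
  brownian_independent : forall s t, 0 <= s -> s < t ->
    mutually_independent P (fun o : option 'I_d =>
      if o is Some k then sigma_of [set: unit] (fun=> increment B s t k)
      else sigma_of `[0, s] (fun u => B u : T -> 'rV[R]_d))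
}.

(* A division is the set of its batches. *)
Definition is_division (n p : nat) (D : {set {set 'I_(n * p)}}) : bool :=
  [&& finset.partition D [set: 'I_(n * p)]%SET, #|D| == n
    & [forall C in D, #|C| == p]].

Record uniform_division (R : realType) (n p : nat) (disp : measure_display)
    (T : measurableType disp) (P : probability T R)
    (xi : T -> {set {set 'I_(n * p)}}) : Prop := {
  division_measurable : forall D, measurable (xi @^-1` [set D]);
  division_uniform : forall D, is_division D ->
    P (xi @^-1` [set D]) = ((#|@is_division n p|%:R)^-1)%:E
}.

Definition data_sigma (R : realType) (d n p : nat) (disp : measure_display)
    (T : measurableType disp) (P : probability T R)
    (X0 : 'I_(n * p) -> {RV P >-> 'rV[R]_d})
    (B : 'I_(n * p) -> R -> {RV P >-> 'rV[R]_d})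
    (xi : nat -> T -> {set {set 'I_(n * p)}})
    (a : 'I_(n * p) + 'I_(n * p) + nat) : set (set T) :=
  match a with
  | inl (inl i) => sigma_of [set: unit] (fun=> X0 i : T -> 'rV[R]_d)
  | inl (inr i) => sigma_of `[0, +oo[ (fun t => B i t : T -> 'rV[R]_d)
  | inr m => preimage_set_system setT (xi m) setT
  end.

Record random_data (R : realType) (d n p : nat) (disp : measure_display)
    (T : measurableType disp) (P : probability T R)
    (nu : probability 'rV[R]_d R)
    (X0 : 'I_(n * p) -> {RV P >-> 'rV[R]_d})
    (B : 'I_(n * p) -> R -> {RV P >-> 'rV[R]_d})
    (xi : nat -> T -> {set {set 'I_(n * p)}}) : Prop := {
  data_initial : forall i (A : set 'rV[R]_d), measurable A ->
    distribution P (X0 i) A = nu A;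
  data_brownian : forall i, standard_brownian (B i);
  data_division : forall m, uniform_division P (xi m);
  data_independent : mutually_independent P (data_sigma X0 B xi)
}.

(* dx = b dt + sigma dbeta on the time set J with left end point a.  The noise
   is additive, so the integrated equation is an equation between paths. *)
Definition solves_sde (R : realType) (d : nat) (sigma a : R) (J : set R)
    (b x beta : R -> 'rV[R]_d) : Prop :=
  forall t, J t -> forall k : 'I_d,
    x t 0 k = x a 0 k
      + \int[lebesgue_measure]_(s in `[a, t]) b s 0 k
      + sigma * (beta t 0 k - beta a 0 k).

Definition ips_drift (R : realType) (d N : nat) (V : 'rV[R]_d -> R)
    (K : 'rV[R]_d -> 'rV[R]_d) (x : 'I_N -> 'rV[R]_d) (i : 'I_N) : 'rV[R]_d :=
  - grad V (x i) + (N.-1%:R)^-1 *: \sum_(j | j != i) K (x i - x j).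

Definition rbm_drift (R : realType) (d n p : nat) (V : 'rV[R]_d -> R)
    (K : 'rV[R]_d -> 'rV[R]_d) (D : {set {set 'I_(n * p)}})
    (x : 'I_(n * p) -> 'rV[R]_d) (i : 'I_(n * p)) : 'rV[R]_d :=
  - grad V (x i)
  + (p.-1%:R)^-1 *:
      \sum_(j in finset.pblock D i | j != i) K (x i - x j).

Definition is_ips (R : realType) (d N : nat) (disp : measure_display)
    (T : measurableType disp) (P : probability T R)
    (V : 'rV[R]_d -> R) (K : 'rV[R]_d -> 'rV[R]_d) (sigma : R)
    (X0 : 'I_N -> {RV P >-> 'rV[R]_d})
    (B X : 'I_N -> R -> {RV P >-> 'rV[R]_d}) : Prop :=
  {ae P, forall w, forall i,
    [/\ {within `[0, +oo[, continuous (fun t => X i t w)},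
        X i 0 w = X0 i w
      & solves_sde sigma 0 `[0, +oo[
          (fun s => ips_drift V K (fun j => X j s w) i)
          (fun t => X i t w) (fun t => B i t w)]}.

(* The steps are indexed from 0: xi m is used on [m tau, (m + 1) tau). *)
Definition is_rbm1 (R : realType) (d n p : nat) (disp : measure_display)
    (T : measurableType disp) (P : probability T R)
    (V : 'rV[R]_d -> R) (K : 'rV[R]_d -> 'rV[R]_d) (sigma tau : R)
    (X0 : 'I_(n * p) -> {RV P >-> 'rV[R]_d})
    (B : 'I_(n * p) -> R -> {RV P >-> 'rV[R]_d})
    (xi : nat -> T -> {set {set 'I_(n * p)}})
    (Y : 'I_(n * p) -> R -> {RV P >-> 'rV[R]_d}) : Prop :=
  {ae P, forall w, forall i,
    [/\ {within `[0, +oo[, continuous (fun t => Y i t w)},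
        Y i 0 w = X0 i w
      & forall m : nat,
        solves_sde sigma (m%:R * tau) `[m%:R * tau, m.+1%:R * tau[
          (fun s => rbm_drift V K (xi m w) (fun j => Y j s w) i)
          (fun t => Y i t w) (fun t => B i t w)]}.

Definition l2norm (R : realType) (d : nat) (disp : measure_display)
    (T : measurableType disp) (P : probability T R) (v : T -> 'rV[R]_d) :
    \bar R :=
  ((\int[P]_w (enorm (v w) ^+ 2)%:E) `^ 2^-1)%E.

Definition couplings (R : realType) (d : nat)
    (mu mu' : probability 'rV[R]_d R) :
    set (probability ('rV[R]_d * 'rV[R]_d)%type R) :=
  [set gamma | forall A : set 'rV[R]_d, measurable A ->
    gamma (A `*` setT) = mu A /\ gamma (setT `*` A) = mu' A].

Definition W2 (R : realType) (d : nat) (mu mu' : probability 'rV[R]_d R) :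
    \bar R :=
  (ereal_inf [set \int[gamma]_z (enorm (z.1 - z.2) ^+ 2)%:E
             | gamma in couplings mu mu'] `^ 2^-1)%E.

(* Main.v *)
(* [X] is driven by the initial data and the noises alone, so it is independent
   of every division.  With [Z = Y - X], split the gap between the batch and the
   full interaction, over step [m], into [chi], the batch error of the kernel
   evaluated along [X], and a remainder controlled by [L] and the values of [Z]
   in the batch.  Given everything but the division of step [m], [chi] has mean
   zero, and its second moment is at most [2 M ^ 2 / (p - 1)] (the negative
   correlations between the members of a batch only help).  At the start of the
   step [Z] is independent of that division too, so [E (Z . chi)] is of the order
   of the displacement of [Z] caused by the division during the step, i.e. of
   [tau * (E |chi| ^ 2 + ...)].  The contraction [2 r] of the gradient flow beats
   the [3 L] lost to the remainder, which yields a bound on [E |Z| ^ 2] that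
   propagates from step to step.

   Since the noise is additive and shared, only paths matter: the solutions are
   compared with their Euler schemes through the integrated equations, and no
   moment of [X] or [Y] is used.  The Euler schemes also provide the adaptedness
   of the solutions. *)

Require Import Defs.
From HB Require Import structures.
From mathcomp Require Import all_boot all_order all_algebra fingroup perm.
From mathcomp Require Import all_classical all_reals all_analysis.
From mathcomp Require Import measurable_realfun.
From mathcomp Require Import ring lra.

Set Implicit Arguments.
Unset Strict Implicit.
Unset Printing Implicit Defensive.

Import Order.TTheory GRing.Theory Num.Theory.
Import numFieldNormedType.Exports.

Local Open Scope classical_set_scope.
Local Open Scope ring_scope.

(** * Euclidean vectors and discrete recursions *)

Section Euclidean.
Variables (R : realType) (d : nat).
Implicit Types x y z : 'rV[R]_d.

(** The condition [2 * L < r] is read as [3 * L + L < 2 * r]: the remainder costs [3 * L] on the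
    squared error of the particle itself and [L] on the average of the squared errors in its batch.
    One particle does not control this average, so the bound is propagated for all particles at
    once, and the average is brought back to the start of the step, where the batch weights are
    independent of the errors and have means of sum 1. [grad V] need not be globally Lipschitz, so
    Gronwall's inequality cannot be applied to it. Monotonicity makes explicit schemes stable
    instead: the size of [grad V] on a ball enters at second order in the grid step, and this ball
    may depend on the sample point, as it serves pathwise limits. The mean squared error is never
    differentiated in time. Its increments are compared on finer and finer grids, with dominated
    convergence for the positive parts of the defects; boundedness of [K] provides the domination. A
    cruder invariant level, [(2 * M / r) ^+ 2], covers [tau > 1], where the rate is no longer of
    order [sqrt tau]. *)

Definition dotv x y : R := \sum_j x 0 j * y 0 j.

Lemma dotvC x y : dotv x y = dotv y x.
Proof. by apply: eq_bigr => j _; rewrite mulrC. Qed.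

Lemma dotvDl x y z : dotv (x + y) z = dotv x z + dotv y z.
Proof. by rewrite -big_split; apply: eq_bigr => j _; rewrite mxE mulrDl. Qed.

Lemma dotvZl a x y : dotv (a *: x) y = a * dotv x y.
Proof. by rewrite mulr_sumr; apply: eq_bigr => j _; rewrite mxE mulrA. Qed.

Lemma dotvNl x y : dotv (- x) y = - dotv x y.
Proof. by rewrite -scaleN1r dotvZl mulN1r. Qed.

Lemma dotvBl x y z : dotv (x - y) z = dotv x z - dotv y z.
Proof. by rewrite dotvDl dotvNl. Qed.

Lemma dotvDr x y z : dotv z (x + y) = dotv z x + dotv z y.
Proof. by rewrite dotvC dotvDl !(dotvC z). Qed.

Lemma dotvZr a x y : dotv x (a *: y) = a * dotv x y.
Proof. by rewrite dotvC dotvZl dotvC. Qed.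

Lemma dotvNr x y : dotv x (- y) = - dotv x y.
Proof. by rewrite dotvC dotvNl dotvC. Qed.

Lemma dotvBr x y z : dotv z (x - y) = dotv z x - dotv z y.
Proof. by rewrite dotvDr dotvNr. Qed.

Lemma dot0v x : dotv 0 x = 0.
Proof. by rewrite -(scale0r 0) dotvZl mul0r. Qed.

Lemma dotv0 x : dotv x 0 = 0. Proof. by rewrite dotvC dot0v. Qed.

Lemma dotv_suml (I : Type) (s : seq I) (Q : pred I) (F : I -> 'rV[R]_d) x :
  dotv (\sum_(i <- s | Q i) F i) x = \sum_(i <- s | Q i) dotv (F i) x.
Proof.
by elim/big_ind2 : _ => [|u a v b <- <-|//]; [rewrite dot0v|rewrite dotvDl].
Qed.

Lemma dotv_sumr (I : Type) (s : seq I) (Q : pred I) (F : I -> 'rV[R]_d) x :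
  dotv x (\sum_(i <- s | Q i) F i) = \sum_(i <- s | Q i) dotv x (F i).
Proof. by rewrite dotvC dotv_suml; under eq_bigr do rewrite dotvC. Qed.

Lemma enorm_ge0 (m n : nat) (A : 'M[R]_(m, n)) : 0 <= enorm A.
Proof. exact: sqrtr_ge0. Qed.

Lemma dotvv x : dotv x x = enorm x ^+ 2.
Proof.
rewrite sqr_sqrtr; last by apply: sumr_ge0 => i _; apply: sumr_ge0 => j _; exact: sqr_ge0.
by rewrite big_ord1; apply: eq_bigr => j _; rewrite expr2.
Qed.

Lemma enorm0 : enorm (0 : 'rV[R]_d) = 0.
Proof. by apply/eqP; rewrite -sqrf_eq0 -dotvv dot0v. Qed.

Lemma enorm_le x (a : R) : 0 <= a -> dotv x x <= a ^+ 2 -> enorm x <= a.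
Proof. by move=> a0; rewrite dotvv ler_sqr ?nnegrE ?enorm_ge0. Qed.

Lemma enorm_eq0 x : enorm x = 0 -> x = 0.
Proof.
move=> x0; have /eqP := dotvv x; rewrite x0 expr0n /= psumr_eq0; last first.
  by move=> j _; rewrite -expr2 sqr_ge0.
move=> /allP h; apply/rowP => j; rewrite mxE; apply/eqP.
by have := h j (mem_index_enum j); rewrite -expr2 sqrf_eq0.
Qed.

Lemma dotv_le x y : dotv x y <= enorm x * enorm y.
Proof.
have [x0|x0] := eqVneq (enorm x) 0.
  by rewrite (enorm_eq0 x0) dot0v enorm0 mul0r.
have [y0|y0] := eqVneq (enorm y) 0.
  by rewrite (enorm_eq0 y0) dotv0 enorm0 mulr0.
have xp : 0 < enorm x by rewrite lt_neqAle eq_sym x0 enorm_ge0.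
have yp : 0 < enorm y by rewrite lt_neqAle eq_sym y0 enorm_ge0.
set a := enorm x in xp *; set b := enorm y in yp *.
have : 0 <= dotv (b *: x - a *: y) (b *: x - a *: y).
  by rewrite dotvv sqr_ge0.
rewrite !(dotvBl, dotvBr, dotvZl, dotvZr) !dotvv -/a -/b (dotvC y) => h.
have : a * b * dotv x y <= a * b * (a * b) by nra.
by rewrite ler_pM2l ?mulr_gt0.
Qed.

Lemma enormZ a x : enorm (a *: x) = `|a| * enorm x.
Proof.
apply/eqP; rewrite -(@eqrXn2 _ 2) ?enorm_ge0 ?mulr_ge0 ?enorm_ge0//.
by rewrite -dotvv dotvZl dotvZr exprMn -dotvv (real_normK (num_real a)); apply/eqP; ring.
Qed.

Lemma enormN x : enorm (- x) = enorm x.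
Proof. by rewrite -scaleN1r enormZ normrN1 mul1r. Qed.

Lemma enormBC x y : enorm (x - y) = enorm (y - x).
Proof. by rewrite -enormN opprB. Qed.

Lemma enormD x y : enorm (x + y) <= enorm x + enorm y.
Proof.
apply: enorm_le; first by rewrite addr_ge0 ?enorm_ge0.
rewrite !(dotvDl, dotvDr) !dotvv (dotvC y).
by have := dotv_le x y; nra.
Qed.

Lemma enormB x y : enorm (x - y) <= enorm x + enorm y.
Proof. by rewrite (le_trans (enormD _ _))// enormN. Qed.

Lemma enorm_sum (I : Type) (s : seq I) (Q : pred I) (F : I -> 'rV[R]_d) :
  enorm (\sum_(i <- s | Q i) F i) <= \sum_(i <- s | Q i) enorm (F i).
Proof.
elim/big_ind2 : _ => [|u a v b ua vb|//]; first by rewrite enorm0.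
by rewrite (le_trans (enormD _ _))// lerD.
Qed.

Lemma dotv_norm_le x y : `|dotv x y| <= enorm x * enorm y.
Proof.
by rewrite ler_norml dotv_le andbT lerNl -dotvNl (le_trans (dotv_le _ _))// enormN.
Qed.

Lemma coord_le_enorm x j : `|x 0 j| <= enorm x.
Proof.
rewrite -(@ler_pXn2r _ 2) ?nnegrE ?enorm_ge0 ?normr_ge0//.
rewrite real_normK ?num_real// -dotvv /dotv (bigD1 j)//= expr2 lerDl.
by apply: sumr_ge0 => i _; rewrite -expr2 sqr_ge0.
Qed.

Lemma enorm_le_sum x : enorm x <= \sum_j `|x 0 j|.
Proof.
apply: enorm_le; first by apply: sumr_ge0 => j _; exact: normr_ge0.
rewrite /dotv expr2 mulr_suml; apply: ler_sum => j _.
rewrite (le_trans (ler_norm _))// normrM ler_wpM2l// (bigD1 j)//= lerDl.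
exact: sumr_ge0.
Qed.

End Euclidean.

Section RecursiveBounds.
Variable R : realType.
Implicit Types (lam y rho : R) (a c : nat -> R).

(* The quadratic error [y ^+ 2] committed at each step accumulates in the
   squares, hence only contributes [sqrt n * y] to [a n]. *)
Lemma quadratic_error_growth lam y rho (a c : nat -> R) (n : nat) :
  0 <= lam -> 0 <= y -> (forall k, 0 <= a k) -> (forall k, 0 <= c k) ->
  (forall k, (k < n)%N -> a k <= rho ->
     a k.+1 ^+ 2 <= ((1 + lam) * a k + c k) ^+ 2 + y ^+ 2) ->
  (1 + lam) ^+ n * (a 0%N + \sum_(k < n) c k + Num.sqrt n%:R * y) <= rho ->
  a n <= (1 + lam) ^+ n * (a 0%N + \sum_(k < n) c k + Num.sqrt n%:R * y).
Proof.
move=> lam0 y0 a0 c0 step hrho.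
pose b k := (1 + lam) ^+ k * (a 0%N + \sum_(i < k) c i + Num.sqrt k%:R * y).
have l1 : 1 <= 1 + lam by rewrite lerDl.
have s0 k : 0 <= \sum_(i < k) c i by apply: sumr_ge0.
have l0 : 0 <= 1 + lam by rewrite (le_trans ler01).
have b_ge0 k : 0 <= b k.
  by rewrite mulr_ge0 ?exprn_ge0// !addr_ge0// mulr_ge0// sqrtr_ge0.
have b_homo k : b k <= b k.+1.
  rewrite /b; apply: ler_pM.
  - by rewrite exprn_ge0//.
  - by rewrite !addr_ge0// mulr_ge0// sqrtr_ge0.
  - by rewrite exprS ler_peMl// exprn_ge0//.
  - rewrite big_ord_recr/=; apply: lerD; last first.
      by rewrite ler_wpM2r// ler_wsqrtr// ler_nat.
    by rewrite addrA lerDl.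
have b_le k : (k <= n)%N -> b k <= b n.
  by move=> kn; apply: (homo_leq (@lexx _ _) (@le_trans _ _)).
suff : forall k, (k <= n)%N -> a k <= b k by exact.
elim=> [|k IH] kn.
  by rewrite /b expr0 mul1r big_ord0 sqrtr0 mul0r !addr0.
have {}IH := IH (ltnW kn).
(* The one-step estimate is available only below [rho]; the bound being proved keeps [a k] there. *)
have ar : a k <= rho by rewrite (le_trans IH)// (le_trans (b_le _ (ltnW kn))).
rewrite -(@ler_pXn2r _ 2) ?nnegrE//.
apply: (le_trans (step _ kn ar)).
pose s := Num.sqrt k%:R : R; pose s' := Num.sqrt k.+1%:R : R.
have sE : s' ^+ 2 = s ^+ 2 + 1 by rewrite !sqr_sqrtr// -natr1.
have s_ge0 : 0 <= s by rewrite sqrtr_ge0.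
have s'_ge0 : 0 <= s' by rewrite sqrtr_ge0.
have ss' : s <= s' by rewrite ler_wsqrtr// ler_nat.
pose q := (1 + lam) ^+ k.+1.
have q1 : 1 <= q by rewrite exprn_ege1.
pose u := a 0%N + \sum_(i < k.+1) c i.
have u0 : 0 <= u by rewrite addr_ge0.
apply: (@le_trans _ _ ((q * (u + s * y)) ^+ 2 + y ^+ 2)).
  rewrite lerD2r lerXn2r ?nnegrE//.
  - by rewrite addr_ge0// mulr_ge0.
  - by rewrite mulr_ge0 ?exprn_ge0// addr_ge0// mulr_ge0.
  - rewrite /u big_ord_recr/= /q exprS.
    have : (1 + lam) * a k <= (1 + lam) * b k by rewrite ler_wpM2l//.
    rewrite /b -/s => h1.
    have h2 : c k <= (1 + lam) * (1 + lam) ^+ k * c k.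
      by rewrite ler_peMl// -exprS exprn_ege1.
    rewrite (le_trans (lerD h1 h2))//.
    by rewrite le_eqVlt; apply/orP; left; apply/eqP; ring.
rewrite /b big_ord_recr/= addrA.
rewrite [in leRHS](_ : a 0%N + _ + _ = u); last by rewrite /u big_ord_recr addrA.
rewrite -/s' -/q !exprMn.
have q2 : 1 <= q ^+ 2 by rewrite exprn_ege1.
apply: (@le_trans _ _ (q ^+ 2 * ((u + s * y) ^+ 2 + y ^+ 2))).
  by rewrite mulrDr lerD2l ler_peMl// sqr_ge0.
rewrite ler_wpM2l ?sqr_ge0//.
(* As [s' ^+ 2 = s ^+ 2 + 1], passing from [s] to [s'] absorbs [y ^+ 2] and leaves the nonnegative
   cross term [2 * u * y * (s' - s)]. *)
have := mulr_ge0 (mulr_ge0 u0 y0) (_ : 0 <= s' - s).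
rewrite subr_ge0 => /(_ ss').
have -> : (u + s' * y) ^+ 2 = (u + s * y) ^+ 2 + y ^+ 2 + u * y * (s' - s) *+ 2.
  by rewrite !sqrrD !exprMn sE; ring.
by move=> h; rewrite lerDl mulrn_wge0.
Qed.

(** The excess [v k - S] is multiplied by [1 - a], which lies between 0 and 1, so the defects [e k]
    at most add up. In the application their sum vanishes as the grid is refined, which makes the
    level [S] invariant. *)
Lemma contraction_invariant (a S : R) (v e : nat -> R) (n : nat) :
  0 <= a <= 1 -> (forall k, 0 <= e k) -> v 0%N <= S ->
  (forall k, (k < n)%N -> v k.+1 <= v k - a * (v k - S) + e k) ->
  v n <= S + \sum_(k < n) e k.
Proof.
move=> /andP[a0 a1] e0 v0 step.
suff : forall k, (k <= n)%N -> v k <= S + \sum_(i < k) e i by exact.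
elim=> [|k IH] kn; first by rewrite big_ord0 addr0.
have {}IH := IH (ltnW kn).
apply: (le_trans (step _ kn)); rewrite big_ord_recr/= addrA lerD2r.
have s0 : 0 <= \sum_(i < k) e i by apply: sumr_ge0.
set s := \sum_(i < k) e i in IH s0 *.
have : (1 - a) * (v k - S) <= (1 - a) * s.
  by apply: ler_wpM2l; [rewrite subr_ge0|rewrite lerBlDl].
by nra.
Qed.

End RecursiveBounds.

(** * Strongly convex potentials *)

Section Potential.
Variables (R : realType) (d : nat) (V : 'rV[R]_d -> R) (r : R).
Hypothesis hV : potential_assumption V r.

Lemma derive_grad (x v : 'rV[R]_d) : 'D_v V x = dotv (grad V x) v.
Proof.
rewrite deriveE; last exact: (V_differentiable hV).
rewrite {1}(row_sum_delta v) linear_sum; apply: eq_bigr => j _.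
rewrite linearZ [in RHS]mxE /partial (deriveE _ (V_differentiable hV x)).
by rewrite [RHS]mulrC.
Qed.

Lemma strongly_convex_first_order (x y : 'rV[R]_d) :
  dotv (grad V x) (y - x) <= V y - V x - r / 2 * enorm (y - x) ^+ 2.
Proof.
set v := y - x; have yE : y = v + x by rewrite subrK.
clearbody v; rewrite -derive_grad.
have /cvg_ex[l /[dup] hl /(@cvg_lim _ (@norm_hausdorff _ _))] :=
  @diff_derivable _ _ _ V x v (V_differentiable hV x).
rewrite -[lim _]/('D_v V x) => ->.
apply/ler_addgt0Pr => e e0.
have r0 := r_gt0 hV.
set c := r / 2 * enorm v ^+ 2.
have c0 : 0 <= c by rewrite mulr_ge0 ?sqr_ge0// divr_ge0// ltW.
have := hl; move/cvgrPdist_lt => /(_ (e / 2)).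
rewrite divr_gt0// => /(_ isT) [del/= del0 hdel].
(* Three demands on [h]: the difference quotient is within [e / 2] of its limit, [h] is a legitimate
   convexity weight, and the loss [h * c] in the strong convexity term is at most [e / 2]. *)
pose h := Num.min (Num.min (del / 2) (1 / 2)) (e / 2 / (c + 1)).
have h0 : 0 < h by rewrite !lt_min !divr_gt0//= ltr_wpDl.
have hd : h < del.
  by rewrite (le_lt_trans (_ : _ <= del / 2))// ?ge_min ?lexx//; lra.
have h1 : h <= 1 / 2 by rewrite ge_min ge_min lexx orbT.
have hc : h * c <= e / 2.
  have : h <= e / 2 / (c + 1) by rewrite ge_min lexx orbT.
  by rewrite ler_pdivlMr ?ltr_wpDl//; nra.
have /= := hdel h; rewrite sub0r normrN gtr0_norm// => /(_ hd).
rewrite gt_eqF// => /(_ isT).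
rewrite ltr_norml => /andP[_ hlt].
have ht : Itv.spec (@Itv.num_sem R) (Itv.Real `[0%Z, 1%Z]) h.
  by rewrite /= /Itv.num_sem/= num_real/= in_itv/= ltW//=; lra.
pose t : {i01 R} := Itv.mk ht.
have hh : V (h *: y + (1 - h) *: x) - r / 2 * enorm (h *: y + (1 - h) *: x) ^+ 2
    <= h * (V y - r / 2 * enorm y ^+ 2) + (1 - h) * (V x - r / 2 * enorm x ^+ 2).
  exact: (V_strongly_convex hV t (mem_set Logic.I) (mem_set Logic.I)).
have hE : h *: y + (1 - h) *: x = h *: v + x.
  by rewrite yE scalerDr scalerBl scale1r -addrA; congr (_ + _); rewrite addrC subrK.
move: hh; rewrite hE -!dotvv.
rewrite yE.
rewrite !(dotvDl, dotvDr, dotvZl, dotvZr) (dotvC x v) => hh.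
move: hlt; rewrite {1}/GRing.scale/= => hlt.
have {}hlt : l - h^-1 * (V (h *: v + x) - V x) < e / 2 by [].
set q := V (h *: v + x) in hh hlt.
have hq : h^-1 * (q - V x) <= V (v + x) - V x - (1 - h) * c.
  rewrite mulrC ler_pdivrMr// /c -dotvv; nra.
by nra.
Qed.

Lemma grad_strongly_monotone (x y : 'rV[R]_d) :
  r * enorm (x - y) ^+ 2 <= dotv (grad V x - grad V y) (x - y).
Proof.
have := strongly_convex_first_order x y; have := strongly_convex_first_order y x.
rewrite -!dotvv !(dotvBl, dotvBr) !(dotvC y x) => h1 h2.
by lra.
Qed.

Lemma grad_locally_bounded (rho : R) : exists B : R, 0 <= B /\
  forall x, enorm x <= rho -> enorm (grad V x) <= B.
Proof.
have [C [q [q0 hC]]] := V_polynomial_growth hV.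
exists (`|C| * (1 + `|rho| `^ q)); split.
  by rewrite mulr_ge0// addr_ge0// powR_ge0.
move=> x xr; have : enorm (grad V x) <= C * (1 + enorm x `^ q).
  by rewrite (le_trans _ (hC x))// lerDl enorm_ge0.
move=> /le_trans; apply.
apply: (@le_trans _ _ (`|C| * (1 + enorm x `^ q))).
  by rewrite ler_wpM2r ?ler_norm// addr_ge0// powR_ge0.
rewrite ler_wpM2l// lerD2l ge0_ler_powR ?nnegrE ?enorm_ge0 ?(ltW q0)//.
by rewrite (le_trans xr)// ler_norm.
Qed.

Lemma grad_continuous : continuous (grad V).
Proof. by move=> x; apply/differentiable_continuous/(gradV_differentiable hV). Qed.

End Potential.

(** * Paths solving the integrated equation *)

Section PathRegularity.
Variable R : realType.
Implicit Types (s t : R).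

(** Freezing a path at its value in [a] for all earlier times makes it continuous on the whole line,
    so that one-sided continuity at the left end point needs no separate treatment. *)
Lemma within_continuous_max (U : topologicalType) (f : R -> U) (a : R) :
  {within `[a, +oo[, continuous f} -> continuous (fun s => f (Num.max a s)).
Proof.
move=> /subspace_continuousP cf s.
have /cf : `[a, +oo[%classic (Num.max a s) by rewrite /= in_itv/= le_max lexx.
move=> cfs W /cfs; rewrite /within/= => hW.
have cm : {for s, continuous (fun u : R => Num.max a u)}.
  by apply: continuous_max; [exact: cst_continuous|exact: cvg_id].
have h : nbhs s (fun u => Num.max a u \in `[a, +oo[ -> W (f (Num.max a u))) := cm _ hW.
change (nbhs s (fun u => W (f (Num.max a u)))).
by apply: filterS h => u; apply; rewrite in_itv/= le_max lexx.
Qed.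

(** Heine's theorem, with [s'] free to leave the segment. Compactness is used as near-covering along
    [0^'+], which produces a common radius without extracting a finite subcover. *)
Lemma segment_uniform_continuity (U : normedModType R) (f : R -> U) (t0 t1 e : R) :
  continuous f -> 0 < e ->
  exists2 del : R, 0 < del &
    forall s s', t0 <= s <= t1 -> `|s' - s| <= del -> `|f s' - f s| <= e.
Proof.
move=> cf e0.
have := @segment_compact R t0 t1.
move=> /compact_near_coveringP/near_covering_withinP.
move=> /(_ R (0^'+) (fun del s => forall s', `|s' - s| <= del -> `|f s' - f s| <= e)).
move=> /(_ _) hc.
have : \forall del \near 0^'+,
    `[t0, t1] `<=` (fun s => forall s', `|s' - s| <= del -> `|f s' - f s| <= e).
  apply: hc => s _.
  have /cvgrPdist_lt/(_ (e / 2)) := cf s; rewrite divr_gt0// => /(_ isT).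
  move=> [rho/= rho0 hrho].
  exists (ball s (rho / 2), [set del | del < rho / 2]).
    split => /=; first by apply: nbhsx_ballx; rewrite divr_gt0.
    by apply: nbhs_right_lt; rewrite divr_gt0.
  move=> [u del] /= [su dlt] _ s' hs'.
  rewrite /ball/= in su.
  have h1 : `|f s - f u| < e / 2.
    by apply: hrho => /=; rewrite (lt_trans su)//; lra.
  have h2 : `|f s - f s'| < e / 2.
    apply: hrho => /=; rewrite (_ : s - s' = (s - u) - (s' - u)); last by ring.
    by rewrite (le_lt_trans (ler_normB _ _))//; lra.
  rewrite (_ : f s' - f u = (f s - f u) - (f s - f s')); last first.
    by rewrite opprB [RHS]addrC subrKA.
  by rewrite (le_trans (ler_normB _ _))//; lra.
move=> hdel.
have [del [hd del0]] : exists del : R, (`[t0, t1] `<=`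
   (fun s => forall s', `|s' - s| <= del -> `|f s' - f s| <= e)) /\ 0 < del.
  have : \forall del \near (0 : R)^'+, 0 < del by exact: nbhs_right_gt.
  by move=> /(filterI hdel)/filter_ex.
exists del => // s s' st; apply: hd.
by rewrite /= in_itv.
Qed.

Lemma Rintegral_increment (f : R -> R) (a s s' c e : R) :
  continuous f -> a <= s -> s <= s' ->
  (forall u, s <= u <= s' -> `|f u - c| <= e) ->
  `| \int[lebesgue_measure]_(u in `[a, s']) f u
     - \int[lebesgue_measure]_(u in `[a, s]) f u - (s' - s) * c| <= e * (s' - s).
Proof.
move=> cf as_ ss' hf.
have int_f b b' : (@lebesgue_measure R).-integrable `[b, b'] (EFin \o f).
  apply: continuous_compact_integrable; first exact: segment_compact.
  by apply: continuous_subspaceT.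
rewrite Rintegral_itvB; [|exact: int_f|by rewrite bnd_simp|by rewrite bnd_simp].
have sub : `]s, s'] `<=` `[s, s'].
  by move=> u /=; rewrite !in_itv/= => /andP[/ltW -> ->].
have int_f' : (@lebesgue_measure R).-integrable `]s, s'] (EFin \o f).
  by apply: integrableS (int_f s s') => //; exact: sub.
have int_c (q : R) : (@lebesgue_measure R).-integrable `]s, s'] (EFin \o cst q).
  have : (@lebesgue_measure R).-integrable `[s, s'] (EFin \o cst q).
    apply: continuous_compact_integrable; first exact: segment_compact.
    by apply: continuous_subspaceT => u; exact: cst_continuous.
  by apply: integrableS => //; exact: sub.
have cE (q : R) : \int[lebesgue_measure]_(u in `]s, s']) q = q * (s' - s).
  rewrite Rintegral_cst//= lebesgue_measure_itv/= lte_fin.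
  by move: ss'; rewrite le_eqVlt => /predU1P[->|->//]; rewrite ltxx subrr.
have up : \int[lebesgue_measure]_(u in `]s, s']) f u <= (c + e) * (s' - s).
  rewrite -cE; apply: le_Rintegral => //; first exact: int_c.
  move=> u /=; rewrite in_itv/= => /andP[/ltW su us'].
  by have := hf u; rewrite su us' => /(_ isT); rewrite ler_distlC => /andP[]; lra.
have lo : (c - e) * (s' - s) <= \int[lebesgue_measure]_(u in `]s, s']) f u.
  rewrite -cE; apply: le_Rintegral => //; first exact: int_c.
  move=> u /=; rewrite in_itv/= => /andP[/ltW su us'].
  by have := hf u; rewrite su us' => /(_ isT); rewrite ler_distlC => /andP[]; lra.
move: up lo; move: (Rintegral _ _ _) => I up lo.
by rewrite ler_distl; clear -up lo; apply/andP; split; lra.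
Qed.

Variable d : nat.
Implicit Types x b beta : R -> 'rV[R]_d.

(* The integrated equation on [t0, t1], as the first order expansion it
   implies uniformly in the base point. *)
Definition uniform_increments (sigma t0 t1 : R) b x beta : Prop :=
  forall eta : R, 0 < eta -> exists2 del : R, 0 < del &
    forall s s', t0 <= s -> s <= s' -> s' <= t1 -> s' - s <= del ->
    enorm (x s' - x s - (s' - s) *: b s - sigma *: (beta s' - beta s))
      <= eta * (s' - s).

Lemma solves_sde_increments (sigma t0 t1 : R) b x beta :
  continuous b -> continuous x -> continuous beta ->
  solves_sde sigma t0 `[t0, t1[ b x beta ->
  uniform_increments sigma t0 t1 b x beta.
Proof.
move=> cb cx cbeta sol eta eta0.
(* The Euclidean norm is bounded by the sum of the [d] coordinates; [d.+1] keeps the quotient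
   meaningful in dimension 0. *)
pose e := eta / d.+1%:R.
have e0 : 0 < e by rewrite divr_gt0.
have [del del0 hdel] := segment_uniform_continuity t0 t1 cb e0.
have coord (f : R -> 'rV[R]_d) (k : 'I_d) : continuous f -> continuous (fun s => f s 0 k).
  move=> cf s; apply: (@continuous_comp _ _ _ f (fun v : 'rV[R]_d => v 0 k) s (cf s)).
  exact: coord_continuous.
exists del => // s s' t0s ss' s't1 hs.
pose F (k : 'I_d) (u : R) :=
  (x u - x s - (u - s) *: b s - sigma *: (beta u - beta s)) 0 k.
have FE k u : F k u = x u 0 k - x s 0 k - (u - s) * b s 0 k
    - sigma * (beta u 0 k - beta s 0 k) by rewrite /F !mxE.
have main k u : s <= u -> u < t1 -> u - s <= del -> `|F k u| <= e * (u - s).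
  move=> su ut us.
  have solu : x u 0 k = x t0 0 k + \int[lebesgue_measure]_(v in `[t0, u]) b v 0 k
      + sigma * (beta u 0 k - beta t0 0 k).
    by apply: sol; rewrite /= in_itv/= (le_trans t0s su).
  have sols : x s 0 k = x t0 0 k + \int[lebesgue_measure]_(v in `[t0, s]) b v 0 k
      + sigma * (beta s 0 k - beta t0 0 k).
    by apply: sol; rewrite /= in_itv/= t0s (le_lt_trans su ut).
  have := @Rintegral_increment (fun v => b v 0 k) t0 s u (b s 0 k) e
    (coord _ k cb) t0s su.
  have -> : F k u = \int[lebesgue_measure]_(v in `[t0, u]) b v 0 k
      - \int[lebesgue_measure]_(v in `[t0, s]) b v 0 k - (u - s) * b s 0 k.
    by rewrite FE solu sols; ring.
  apply => v /andP[sv vu].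
  rewrite (le_trans _ (hdel s v _ _))//.
  - have -> : b v 0 k - b s 0 k = (b v - b s) 0 k by rewrite !mxE.
    rewrite [leRHS]mx_normrE.
    by apply: (le_bigmax _ (fun ij => `|(b v - b s) ij.1 ij.2|) (0, k)).
  - by rewrite t0s (le_trans sv)// (le_trans vu)// ltW.
  - by rewrite ger0_norm ?subr_ge0// (le_trans _ us)// lerD2r.
(* The equation is known on a half-open interval only. At [s' = t1] the estimate follows by letting
   the right end point increase to [t1]. *)
have {}main k : `|F k s'| <= e * (s' - s).
  move: s't1; rewrite le_eqVlt => /predU1P[s't1|/main]; last exact.
  have [<-|neq] := eqVneq s s'.
    by rewrite FE !subrr !mul0r !mulr0 !subr0 normr0.
  have slt : s < s' by rewrite lt_neqAle neq.
  have cF : continuous (fun u => e * (u - s) - `|F k u|).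
    move=> u; apply: cvgB.
      by apply: cvgM; [exact: cvg_cst|apply: cvgB; [exact: cvg_id|exact: cvg_cst]].
    apply: cvg_norm; rewrite (funext (FE k)).
    apply: cvgB.
      apply: cvgB; last first.
        by apply: cvgM; [apply: cvgB; [exact: cvg_id|exact: cvg_cst]|exact: cvg_cst].
      by apply: cvgB; [exact: coord|exact: cvg_cst].
    apply: cvgM; first exact: cvg_cst.
    by apply: cvgB; [exact: coord|exact: cvg_cst].
  rewrite -subr_ge0.
  have cF' : e * (u - s) - `|F k u| @[u --> s'^'-] --> e * (s' - s) - `|F k s'|.
    by apply: cvg_at_left_filter; exact: cF.
  apply: (cvgr_to_ge cF').
  near=> u.
  rewrite subr_ge0; apply: main.
  - by rewrite ltW//; near: u; exact: nbhs_left_gt.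
  - by rewrite -s't1; near: u; exact: nbhs_left_lt.
  - by rewrite (le_trans _ hs)// lerD2r ltW//; near: u; exact: nbhs_left_lt.
rewrite (le_trans (enorm_le_sum _))//.
rewrite (le_trans (ler_sum _ (fun k _ => main k)))// sumr_const card_ord.
rewrite -mulr_natl mulrA ler_wpM2r ?subr_ge0//.
rewrite /e mulrCA ler_piMr ?(ltW eta0)// ler_pdivrMr// mul1r ler_nat.
exact: leqnSn.
Unshelve. all: by end_near.
Qed.

End PathRegularity.

(** * Stability of the explicit Euler scheme *)

Section Shadowing.
Variables (R : realType) (d : nat) (V : 'rV[R]_d -> R) (r : R).
Hypothesis hV : potential_assumption V r.

(** In the expanded square, strong monotonicity contracts at rate [2 * r] to first order in [h]. The
    bound [B] on the drift differences comes with [h ^+ 2] only, and such terms have a vanishing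
    total over a fine grid. *)
Lemma drift_step (e dV g : 'rV[R]_d) (h B : R) :
  0 <= h -> r * enorm e ^+ 2 <= dotv dV e -> enorm dV + enorm g <= B ->
  enorm (e - h *: dV + h *: g) ^+ 2
    <= (1 - 2 * r * h) * enorm e ^+ 2 + 2 * h * dotv e g + (h * B) ^+ 2.
Proof.
move=> h0 mono hB.
have -> : e - h *: dV + h *: g = e - h *: (dV - g).
  by rewrite scalerBr opprB addrA addrAC.
have hg : enorm (dV - g) ^+ 2 <= B ^+ 2.
  rewrite lerXn2r ?nnegrE ?enorm_ge0//.
    by rewrite (le_trans _ hB)// addr_ge0 ?enorm_ge0.
  by rewrite (le_trans (enormB _ _)).
rewrite -[enorm (e - _) ^+ 2]dotvv !(dotvBl, dotvBr, dotvZl, dotvZr) !dotvv.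
rewrite (dotvC dV e) (dotvC g e) in mono *.
have {}hg : h ^+ 2 * enorm (dV - g) ^+ 2 <= h ^+ 2 * B ^+ 2 by rewrite ler_wpM2l ?sqr_ge0.
move: hg; rewrite -[enorm (dV - g) ^+ 2]dotvv !(dotvBl, dotvBr) !dotvv (dotvC g dV) => hg.
have := ler_wpM2l h0 mono.
by rewrite exprMn; lra.
Qed.

Variables (I : finType) (sigma t0 t1 : R).
Variables (y beta fy : I -> R -> 'rV[R]_d) (rho lam Gam A0 t : R).
Hypothesis hy : forall i, uniform_increments sigma t0 t1
  (fun s => - grad V (y i s) + fy i s) (y i) (beta i).
Hypothesis y_bounded : forall i s, t0 <= s <= t1 -> enorm (y i s) <= rho.
Hypotheses (lam0 : 0 <= lam) (Gam0 : 0 <= Gam) (A00 : 0 <= A0).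
Hypothesis tt : t0 <= t <= t1.

Definition grid (n k : nat) : R := t0 + k%:R * ((t - t0) / n%:R).

Lemma grid0 n : grid n 0 = t0.
Proof. by rewrite /grid mul0r addr0. Qed.

Lemma gridn n : (0 < n)%N -> grid n n = t.
Proof.
by move=> n0; rewrite /grid mulrCA divff ?pnatr_eq0 -?lt0n// mulr1 addrC subrK.
Qed.

Lemma gridS n k : grid n k.+1 = grid n k + (t - t0) / n%:R.
Proof. by rewrite /grid -natr1 mulrDl mul1r addrA. Qed.

Lemma grid_step_ge0 n : 0 <= (t - t0) / n%:R.
Proof. by rewrite divr_ge0// subr_ge0; case/andP: tt. Qed.

Lemma grid_itv n k : (k <= n)%N -> t0 <= grid n k <= t.
Proof.
move=> kn; rewrite lerDl mulr_ge0 ?grid_step_ge0//=.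
(* For [n = 0] the inverse is 0 by convention and the grid stays at [t0]. *)
case: n kn => [|n] kn.
  by rewrite /grid invr0 !mulr0 addr0; case/andP: tt.
rewrite -[leRHS](@gridn n.+1)// lerD2l ler_wpM2r ?grid_step_ge0//.
by rewrite ler_nat.
Qed.

Lemma grid_fine (del : R) : 0 < del ->
  \forall n \near \oo, (0 < n)%N /\ (t - t0) / n%:R <= del.
Proof.
move=> del0; near=> n.
have n0 : (0 < n)%N by near: n; exact: nbhs_infty_gt.
split => //; rewrite ler_pdivrMr ?ltr0n// -ler_pdivrMl// mulrC.
by near: n; exact: nbhs_infty_ger.
Unshelve. all: by end_near. Qed.

(* Monotonicity of [grad V] makes the explicit scheme stable: only the size of
   [grad V] on a ball enters, and only at order [1 / n]. *)
Lemma shadowing (eps : R) : 0 < eps -> \forall n \near \oo,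
  forall (w phi : nat -> I -> 'rV[R]_d) (gam : nat -> R),
  (forall k, 0 <= gam k <= Gam) ->
  (forall i, enorm (y i t0 - w 0%N i) <= A0) ->
  (forall k i, (k < n)%N ->
     w k.+1 i = w k i - ((t - t0) / n%:R) *: grad V (w k i)
       + ((t - t0) / n%:R) *: phi k i
       + sigma *: (beta i (grid n k.+1) - beta i (grid n k))) ->
  (forall k i u, (k < n)%N -> (forall j, enorm (y j (grid n k) - w k j) <= u) ->
     enorm (fy i (grid n k) - phi k i) <= lam * u + gam k) ->
  forall i, enorm (y i t - w n i)
    <= expR (lam * (t - t0))
       * (A0 + (t - t0) / n%:R * (\sum_(k < n) gam k) + eps).
Proof.
move=> eps0.
have T0 : 0 <= t - t0 by rewrite subr_ge0; case/andP: tt.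
set T := t - t0 in T0 *.
(* This is the target bound with every [gam k] raised to [Gam]. It confines the scheme to the ball
   of radius [rho + rho1], on which [B] bounds the gradient. *)
pose rho1 := expR (lam * T) * (A0 + T * Gam + eps).
have rho1_ge0 : 0 <= rho1.
  by rewrite mulr_ge0 ?expR_ge0// !addr_ge0 ?mulr_ge0// ltW.
have [B [B0 hB]] := grad_locally_bounded hV (rho + rho1).
(* Half of [eps] pays for the errors of the first order expansions, at most [T * eta] in total; the
   other half pays for the quadratic errors, through [hsq]. *)
pose eta := eps / 2 / (T + 1).
have eta0 : 0 < eta by rewrite !divr_gt0// ltr_wpDl.
pose B' := 2 * B + (lam * rho1 + Gam + eta).
have B'0 : 0 <= B'.
  have eta_ge0 := ltW eta0.
  by rewrite addr_ge0//; [rewrite mulr_ge0|rewrite !addr_ge0// mulr_ge0].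
have [del del0 hdel] : exists2 del : R, 0 < del & forall i s s',
    t0 <= s -> s <= s' -> s' <= t1 -> s' - s <= del ->
    enorm (y i s' - y i s - (s' - s) *: (- grad V (y i s) + fy i s)
      - sigma *: (beta i s' - beta i s)) <= eta * (s' - s).
  (* One radius is selected for each index so that a minimum can be taken; starting the minimum at 1
     covers an empty index type. *)
  pose D i := xget (0 : R) [set del | 0 < del /\ forall s s',
    t0 <= s -> s <= s' -> s' <= t1 -> s' - s <= del ->
    enorm (y i s' - y i s - (s' - s) *: (- grad V (y i s) + fy i s)
      - sigma *: (beta i s' - beta i s)) <= eta * (s' - s)].
  have hD i : 0 < D i /\ forall s s',
    t0 <= s -> s <= s' -> s' <= t1 -> s' - s <= D i ->
    enorm (y i s' - y i s - (s' - s) *: (- grad V (y i s) + fy i s)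
      - sigma *: (beta i s' - beta i s)) <= eta * (s' - s).
    rewrite /D; case: xgetP => [del _ //|/=].
    by have [del del0 hdel] := hy i eta0 => /(_ del) [].
  exists (\big[Num.min/1]_i D i).
    by apply/bigmin_gtP; split => // i _; exact: (hD i).1.
  move=> i s s' ts ss' s't sd; apply: (hD i).2 => //.
  by rewrite (le_trans sd)//; exact: bigmin_le_cond.
near=> n => w phi gam hgam hw0 hw hphi.
have n_ge1 : 1 <= n%:R :> R by near: n; exact: nbhs_infty_ger.
have n0 : (0 < n)%N by rewrite -(@ler_nat R).
have n0' : 0 < n%:R :> R by rewrite ltr0n.
pose h := T / n%:R.
have h0 : 0 <= h by rewrite divr_ge0.
have hdel_n : h <= del.
  rewrite ler_pdivrMr// -ler_pdivrMl// mulrC.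
  by near: n; exact: nbhs_infty_ger.
have hsq : Num.sqrt n%:R * (h * B') <= eps / 2.
  have /ler_wsqrtr : (2 * T * B' / eps) ^+ 2 <= n%:R by near: n; exact: nbhs_infty_ger.
  rewrite sqrtr_sqr ger0_norm; last by rewrite divr_ge0 ?mulr_ge0// ltW.
  have sn : n%:R = Num.sqrt n%:R ^+ 2 :> R by rewrite sqr_sqrtr.
  have s0 : 0 < Num.sqrt n%:R :> R by rewrite sqrtr_gt0.
  rewrite /h {3}sn.
  rewrite (_ : Num.sqrt n%:R * _ = T * B' / Num.sqrt n%:R); last by field; rewrite gt_eqF.
  by rewrite ler_pdivrMr// ler_pdivrMr// => ?; lra.
pose a k := \big[Num.max/0]_i enorm (y i (grid n k) - w k i).
have a_ge k i : enorm (y i (grid n k) - w k i) <= a k by exact: le_bigmax_cond.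
have a0 k : 0 <= a k by exact: bigmax_ge_id.
have hh : (1 + lam * h) ^+ n <= expR (lam * T).
  have -> : expR (lam * T) = expR (lam * h) ^+ n.
    by rewrite -expRM_natl /h; congr expR; field; rewrite gt_eqF.
  by rewrite lerXn2r ?nnegrE ?expR_ge0 ?expR_ge1Dx// addr_ge0// mulr_ge0.
have lh0 : 0 <= lam * h by rewrite mulr_ge0.
have step k : (k < n)%N -> a k <= rho1 ->
    a k.+1 ^+ 2 <= ((1 + lam * h) * a k + h * (gam k + eta)) ^+ 2 + (h * B') ^+ 2.
  move=> kn ak.
  have /andP[g0 gG] := hgam k.
  set bd := (X in _ <= X).
  have bd0 : 0 <= bd by rewrite addr_ge0 ?sqr_ge0.
  rewrite -(sqr_sqrtr bd0) lerXn2r ?nnegrE ?sqrtr_ge0//.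
  apply: bigmax_le => [|i _]; first exact: sqrtr_ge0.
  rewrite -(@ler_pXn2r _ 2) ?nnegrE ?enorm_ge0 ?sqrtr_ge0// (sqr_sqrtr bd0) /bd {bd bd0}.
  set s := grid n k; set s' := grid n k.+1.
  have /andP[s_ge s_le] : t0 <= s <= t by rewrite grid_itv// ltnW.
  have /andP[s'_ge s'_le] : t0 <= s' <= t by rewrite grid_itv.
  have tt1 : t <= t1 by case/andP: tt.
  have ss' : s' - s = h by rewrite /s' gridS addrC addKr.
  pose err := y i s' - y i s - (s' - s) *: (- grad V (y i s) + fy i s)
      - sigma *: (beta i s' - beta i s).
  have herr : enorm err <= eta * h.
    rewrite -[in leRHS]ss'; apply: hdel => //.
    - by rewrite -subr_ge0 ss'.
    - by rewrite (le_trans s'_le).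
    - by rewrite ss'.
  set e := y i s - w k i.
  pose g := fy i s - phi k i + h^-1 *: err.
  have [h_eq0|h_neq0] := eqVneq h 0.
    have errE : err = 0.
      apply: enorm_eq0; apply/eqP; rewrite eq_le enorm_ge0 andbT.
      by rewrite (le_trans herr)// h_eq0 mulr0.
    have sE : s' = s by apply/eqP; rewrite -subr_eq0 ss' h_eq0.
    rewrite hw// -/h -/s -/s' sE h_eq0 !scale0r subrr scaler0 subr0 !addr0.
    rewrite !mul0r !mulr0 !addr0 expr0n/= addr0 mul1r.
    by rewrite lerXn2r ?nnegrE ?enorm_ge0//; exact: a_ge.
  have hp : 0 < h by rewrite lt_neqAle eq_sym h_neq0.
  have eE : y i s' - w k.+1 i = e - h *: (grad V (y i s) - grad V (w k i)) + h *: g.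
    have -> : y i s' = y i s + h *: (- grad V (y i s) + fy i s)
        + sigma *: (beta i s' - beta i s) + err.
      rewrite /err ss'; apply/rowP => j; rewrite !mxE; ring.
    rewrite hw// -/h -/s -/s' /e /g.
    by apply/rowP => j; rewrite !mxE; field.
  have hg : enorm g <= lam * a k + gam k + eta.
    rewrite (le_trans (enormD _ _))// lerD//; first exact: hphi.
    rewrite enormZ ger0_norm ?invr_ge0// mulrC ler_pdivrMr//.
  rewrite eE.
  have ys : enorm (y i s) <= rho.
    by apply: y_bounded; rewrite s_ge (le_trans s_le).
  have es : enorm e <= a k by exact: a_ge.
  have ws : enorm (w k i) <= rho + rho1.
    have -> : w k i = y i s - e by rewrite /e opprB addrC subrK.
    by rewrite (le_trans (enormB _ _))// lerD// (le_trans es).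
  have dV_le : enorm (grad V (y i s) - grad V (w k i)) + enorm g <= B'.
    rewrite lerD//.
      rewrite (le_trans (enormB _ _))// mulr_natl mulr2n lerD// hB//.
      by rewrite (le_trans ys)// lerDl.
    by rewrite (le_trans hg)// lerD2r lerD// ler_wpM2l.
  have mono := grad_strongly_monotone hV (y i s) (w k i).
  apply: (le_trans (drift_step h0 mono dV_le)).
  rewrite lerD2r.
  have e_ge0 : 0 <= enorm e by exact: enorm_ge0.
  have g_ge0 : 0 <= enorm g by exact: enorm_ge0.
  apply: (@le_trans _ _ ((enorm e + h * enorm g) ^+ 2)).
    apply: (@le_trans _ _ ((1 - 2 * r * h) * enorm e ^+ 2
        + 2 * h * (enorm e * enorm g))).
      by rewrite lerD2l ler_wpM2l ?mulr_ge0// dotv_le.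
    rewrite -subr_ge0.
    rewrite (_ : _ - _ = 2 * (r * h * enorm e ^+ 2) + (h * enorm g) ^+ 2); last by ring.
    by rewrite addr_ge0 ?sqr_ge0// !mulr_ge0 ?sqr_ge0// ltW// (r_gt0 hV).
  have l1 : 0 <= enorm e + h * enorm g by rewrite addr_ge0// mulr_ge0.
  have l2 : enorm e + h * enorm g <= (1 + lam * h) * a k + h * (gam k + eta).
    have -> : (1 + lam * h) * a k + h * (gam k + eta)
      = a k + h * (lam * a k + gam k + eta) by ring.
    by rewrite lerD// ler_wpM2l.
  by rewrite lerXn2r ?nnegrE// (le_trans l1).
have hfin : (1 + lam * h) ^+ n * (a 0%N + \sum_(k < n) h * (gam k + eta)
    + Num.sqrt n%:R * (h * B'))
    <= expR (lam * T) * (A0 + h * (\sum_(k < n) gam k) + eps).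
  have a00 : a 0%N <= A0.
    by apply: bigmax_le => // i _; rewrite grid0.
  have sum_ge0 : 0 <= \sum_(k < n) h * (gam k + eta).
    apply: sumr_ge0 => k _; rewrite mulr_ge0// addr_ge0 ?(ltW eta0)//.
    by have /andP[] := hgam k.
  apply: ler_pM => //.
  - by rewrite exprn_ge0// addr_ge0.
  - by rewrite !addr_ge0// !mulr_ge0// sqrtr_ge0.
  rewrite -mulr_sumr big_split/= sumr_const card_ord mulrDr -[eta *+ n]mulr_natl.
  have -> : h * (n%:R * eta) = T * eta by rewrite /h mulrA divfK ?gt_eqF.
  have : T * eta <= eps / 2.
    rewrite /eta mulrA ler_pdivrMr ?ltr_wpDl//; nra.
  by lra.
have main := @quadratic_error_growth R (lam * h) (h * B') rho1 a
  (fun k => h * (gam k + eta)) n lh0 (mulr_ge0 h0 B'0) a0.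
move=> i; rewrite -[in y i t](gridn n0) (le_trans (a_ge n i))// (le_trans _ hfin)//.
apply: main => //.
  move=> k; have /andP[? _] := hgam k.
  by rewrite mulr_ge0// addr_ge0// ltW.
rewrite (le_trans hfin)// /rho1 ler_wpM2l ?expR_ge0// lerD2r lerD2l.
have -> : T * Gam = h * (n%:R * Gam) by rewrite /h mulrA divfK ?gt_eqF.
rewrite ler_wpM2l// mulr_natl.
have -> : Gam *+ n = \sum_(k < n) Gam by rewrite sumr_const card_ord.
by apply: ler_sum => k _; have /andP[] := hgam k.
Unshelve. all: by end_near.
Qed.

(** [F] is the drift apart from [- grad V]. It receives the step index and the whole configuration,
    so that it can be either an interaction evaluated along the scheme or a prescribed path; [db] is
    the noise increment, already scaled. *)
Fixpoint euler (h : R) (F : nat -> (I -> 'rV[R]_d) -> I -> 'rV[R]_d)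
    (db : nat -> I -> 'rV[R]_d) (w0 : I -> 'rV[R]_d) (k : nat) : I -> 'rV[R]_d :=
  if k is k'.+1 then
    fun i => let w := euler h F db w0 k' in
      w i - h *: grad V (w i) + h *: F k' w i + db k' i
  else w0.

End Shadowing.

(** * Paths driven by the same noise *)

Section CoupledPaths.
Variables (R : realType) (d : nat) (V : 'rV[R]_d -> R) (r : R).
Hypothesis hV : potential_assumption V r.

Lemma uniform_increments_sub (sigma t0 t1 t0' t1' : R) (b x beta : R -> 'rV[R]_d) :
  t0 <= t0' -> t1' <= t1 ->
  uniform_increments sigma t0 t1 b x beta -> uniform_increments sigma t0' t1' b x beta.
Proof.
move=> h0 h1 hx eta eta0; have [del del0 hdel] := hx _ eta0; exists del => //.
by move=> s s' s0 ss s1; apply: hdel => //; [exact: le_trans s0|exact: le_trans h1].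
Qed.

(** The drift [f] is prescribed rather than evaluated along the scheme, so [shadowing] applies with
    [lam = 0] and yields no exponential factor. Later [f] is the full interaction along [X], which
    makes the scheme blind to the current division. *)
Lemma frozen_euler (sigma t0 t1 rho G t eps : R) (y beta fy f : R -> 'rV[R]_d) :
  uniform_increments sigma t0 t1 (fun s => - grad V (y s) + fy s) y beta ->
  (forall s, t0 <= s <= t1 -> enorm (y s) <= rho) ->
  (forall s, t0 <= s <= t1 -> enorm (fy s - f s) <= G) ->
  t0 <= t <= t1 -> 0 < eps ->
  \forall n \near \oo,
    enorm (y t - euler V ((t - t0) / n%:R)
       (fun k _ (_ : unit) => f (grid t0 t n k))
       (fun k _ => sigma *: (beta (grid t0 t n k.+1) - beta (grid t0 t n k)))
       (fun=> y t0) n tt)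
    <= (t - t0) / n%:R * (\sum_(k < n) enorm (fy (grid t0 t n k) - f (grid t0 t n k))) + eps.
Proof.
move=> hy y_bd f_bd ttt eps0.
have G0 : 0 <= G by apply: le_trans (f_bd t ttt); exact: enorm_ge0.
have H := @shadowing R d V r hV unit sigma t0 t1 (fun=> y) (fun=> beta) (fun=> fy) rho
  0 G 0 t (fun=> hy) (fun=> y_bd) (lexx _) G0 (lexx _) ttt eps eps0.
apply: filterS H => n H.
(* [shadowing] wants a bound on [gam] at every index, while [fy - f] is controlled on the time
   interval only; hence the value 0 past the grid. *)
pose gam k := if (k < n)%N then enorm (fy (grid t0 t n k) - f (grid t0 t n k)) else 0.
have gE : \sum_(k < n) gam k = \sum_(k < n) enorm (fy (grid t0 t n k) - f (grid t0 t n k)).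
  by apply: eq_bigr => k _; rewrite /gam ltn_ord.
have grid_in k : (k < n)%N -> t0 <= grid t0 t n k <= t1.
  move=> kn; have /andP[-> h] := grid_itv ttt (ltnW kn).
  by rewrite (le_trans h)//; case/andP: ttt.
move: (H (fun k i => euler V ((t - t0) / n%:R)
       (fun k _ (_ : unit) => f (grid t0 t n k))
       (fun k _ => sigma *: (beta (grid t0 t n k.+1) - beta (grid t0 t n k)))
       (fun=> y t0) k i)
  (fun k _ => f (grid t0 t n k)) gam).
rewrite gE mul0r expR0 mul1r add0r; apply => //.
- move=> k; rewrite /gam; case: ifPn => kn; last by rewrite lexx.
  by rewrite enorm_ge0 f_bd// grid_in.
- by move=> i; rewrite subrr enorm0.
- by move=> k i u kn _; rewrite mul0r add0r /gam kn.
Qed.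

Section Pair.
Variables (sigma t0 t1 rho G : R) (x y beta fx fy : R -> 'rV[R]_d).
Hypothesis hx : uniform_increments sigma t0 t1 (fun s => - grad V (x s) + fx s) x beta.
Hypothesis hy : uniform_increments sigma t0 t1 (fun s => - grad V (y s) + fy s) y beta.
Hypothesis x_bounded : forall s, t0 <= s <= t1 -> enorm (x s) <= rho.
Hypothesis y_bounded : forall s, t0 <= s <= t1 -> enorm (y s) <= rho.
Hypothesis f_bounded : forall s, t0 <= s <= t1 -> enorm (fy s - fx s) <= G.

(** Sampled on a grid, [x] is itself an explicit scheme once [phi] is solved from the recursion, so
    [shadowing] with [lam = 0] compares [y] with [x]. By monotonicity the gradients do not increase
    the distance; only the gap between the interactions does. *)
Lemma coupled_distance t : t0 <= t <= t1 ->
  enorm (y t - x t) <= enorm (y t0 - x t0) + G * (t - t0).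
Proof.
move=> /[dup] ttt /andP[]; rewrite le_eqVlt => /predU1P[<- _|t0t tt1].
  by rewrite subrr mulr0 addr0.
have G0 : 0 <= G by apply: le_trans (f_bounded ttt); exact: enorm_ge0.
have T0 : 0 < t - t0 by rewrite subr_gt0.
apply/ler_addgt0Pr => eps eps0.
pose e := eps / 2 / (t - t0 + 1).
have e0 : 0 < e by rewrite !divr_gt0// ltr_wpDl// ltW.
have [del del0 hdel] := hx e0.
have G0' : 0 <= G + e by rewrite addr_ge0// ltW.
have eps2 : 0 < eps / 2 by rewrite divr_gt0.
have H := @shadowing R d V r hV unit sigma t0 t1 (fun=> y) (fun=> beta) (fun=> fy) rho
  0 (G + e) (enorm (y t0 - x t0)) t (fun=> hy) (fun=> y_bounded) (lexx _) G0'
  (enorm_ge0 _) ttt (eps / 2) eps2.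
have [n [[n0 hn] hnH]] := filter_ex (filterI (grid_fine t0 t del0) H).
pose h := (t - t0) / n%:R.
have h0 : 0 < h by rewrite divr_gt0// ltr0n.
have hE : h * n%:R = t - t0 by rewrite /h divfK// pnatr_eq0 -lt0n.
pose w k (_ : unit) := x (grid t0 t n k).
pose phi k (_ : unit) := h^-1 *: (x (grid t0 t n k.+1) - x (grid t0 t n k)
  - sigma *: (beta (grid t0 t n k.+1) - beta (grid t0 t n k))) + grad V (x (grid t0 t n k)).
have := hnH w phi (fun=> G + e).
rewrite mul0r expR0 mul1r sumr_const card_ord -[(G + e) *+ n]mulr_natl mulrA -/h hE /w gridn//.
move=> main.
apply: le_trans (main _ _ _ _ tt) _.
- by move=> _; rewrite G0' lexx.
- by move=> _; rewrite grid0.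
- move=> k i kn; rewrite /phi scalerDr scalerA mulfV ?gt_eqF// scale1r.
  by apply/rowP => j; rewrite !mxE; ring.
- move=> k i u kn _; rewrite mul0r add0r.
  set s := grid t0 t n k; set s' := grid t0 t n k.+1.
  have /andP[s0 st] : t0 <= s <= t by exact/(grid_itv ttt)/ltnW.
  have /andP[s'0 s't] : t0 <= s' <= t by exact/(grid_itv ttt).
  have ss : s' - s = h by rewrite /s' gridS addrC addKr.
  rewrite (_ : fy s - phi k i = (fy s - fx s)
    - h^-1 *: (x s' - x s - (s' - s) *: (- grad V (x s) + fx s)
               - sigma *: (beta s' - beta s))); last first.
    by rewrite /phi -/s -/s' ss; apply/rowP => j; rewrite !mxE; field; rewrite gt_eqF.
  rewrite (le_trans (enormB _ _))// lerD//.
    by apply: f_bounded; rewrite s0 (le_trans st).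
  rewrite enormZ ger0_norm ?invr_ge0 ?(ltW h0)// mulrC ler_pdivrMr// -[in leRHS]ss.
  apply: hdel => //; rewrite ?ss//.
  - by rewrite -subr_ge0 ss ltW.
  - by rewrite (le_trans s't).
- have Te : (t - t0) * e <= eps / 2.
    by rewrite /e mulrA ler_pdivrMr ?ltr_wpDl ?(ltW T0)// mulrC ler_wpM2l ?(ltW eps2)// lerDl.
  rewrite mulrDr [_ * G]mulrC -!addrA !lerD2l.
  by rewrite [leRHS]splitr lerD2r.
Qed.

(** The noise is additive and shared, hence cancels in [y - x]: the square of the distance has a
    first order expansion without an Ito correction. *)
Lemma energy_step t (eps : R) : t0 <= t <= t1 -> 0 < eps ->
  \forall n \near \oo, forall k, (k < n)%N ->
  let s := grid t0 t n k in
  enorm (y (grid t0 t n k.+1) - x (grid t0 t n k.+1)) ^+ 2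
  <= enorm (y s - x s) ^+ 2 + (t - t0) / n%:R *
     (2 * dotv (y s - x s) (fy s - fx s) - 2 * r * enorm (y s - x s) ^+ 2 + eps).
Proof.
move=> ttt eps0.
have G0 : 0 <= G by apply: le_trans (f_bounded ttt); exact: enorm_ge0.
have rho0 : 0 <= rho by apply: le_trans (x_bounded ttt); exact: enorm_ge0.
(* With 16, the cross term [2 * (2 * rho) * (2 * e)] is at most [eps / 2]; the other half of [eps]
   pays for [h * B' ^+ 2], through the last term in the minimum below. *)
pose e := eps / (16 * (rho + 1)).
have e0 : 0 < e by rewrite !divr_gt0// mulr_gt0// ltr_wpDl.
have e16 : 16 * rho * e <= eps.
  rewrite /e mulrA ler_pdivrMr; last by rewrite mulr_gt0// ltr_wpDl.
  by have := mulr_ge0 rho0 (ltW eps0); nra.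
have [delx delx0 hdelx] := hx e0.
have [dely dely0 hdely] := hy e0.
have [B [B0 hB]] := grad_locally_bounded hV rho.
pose B' := B + B + (G + (e + e)).
have B'0 : 0 <= B' by rewrite !addr_ge0// ltW.
have del0 : 0 < Num.min (Num.min delx dely) (eps / (2 * (B' ^+ 2 + 1))).
  by rewrite !lt_min delx0 dely0/= divr_gt0// mulr_gt0// ltr_wpDl// sqr_ge0.
near=> n => k kn; set s := grid t0 t n k.
have [n0] : (0 < n)%N /\ (t - t0) / n%:R <= Num.min (Num.min delx dely) (eps / (2 * (B' ^+ 2 + 1))).
  by near: n; exact: grid_fine.
set h := (t - t0) / n%:R.
rewrite !le_min => /andP[/andP[hx' hy'] hB'].
have h_ge0 : 0 <= h by exact: (grid_step_ge0 ttt).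
set s' := grid t0 t n k.+1.
have /andP[s0 st] : t0 <= s <= t by exact/(grid_itv ttt)/ltnW.
have /andP[s'0 s't] : t0 <= s' <= t by exact/(grid_itv ttt).
have /andP[_ tt1] := ttt.
have ss : s' - s = h by rewrite /s' gridS addrC addKr.
have [h_eq0|h_neq0] := eqVneq h 0.
  have -> : s' = s by apply/eqP; rewrite -subr_eq0 ss h_eq0.
  by rewrite h_eq0 mul0r addr0.
have h0 : 0 < h by rewrite lt_neqAle eq_sym h_neq0.
pose errx := h^-1 *: (x s' - x s - (s' - s) *: (- grad V (x s) + fx s)
  - sigma *: (beta s' - beta s)).
pose erry := h^-1 *: (y s' - y s - (s' - s) *: (- grad V (y s) + fy s)
  - sigma *: (beta s' - beta s)).
have errx_le : enorm errx <= e.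
  rewrite enormZ ger0_norm ?invr_ge0// mulrC ler_pdivrMr// -[in leRHS]ss.
  by apply: hdelx => //; rewrite ?ss//; [rewrite -subr_ge0 ss|rewrite (le_trans s't)].
have erry_le : enorm erry <= e.
  rewrite enormZ ger0_norm ?invr_ge0// mulrC ler_pdivrMr// -[in leRHS]ss.
  by apply: hdely => //; rewrite ?ss//; [rewrite -subr_ge0 ss|rewrite (le_trans s't)].
have err_le : enorm (erry - errx) <= e + e.
  by apply: (le_trans (enormB _ _)); exact: (lerD erry_le errx_le).
pose g := fy s - fx s + (erry - errx).
have s_in : t0 <= s <= t1 by rewrite s0 (le_trans st).
have -> : y s' - x s' = y s - x s - h *: (grad V (y s) - grad V (x s)) + h *: g.
  by rewrite /g /erry /errx ss; apply/rowP => j; rewrite !mxE; field.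
have dV_le : enorm (grad V (y s) - grad V (x s)) + enorm g <= B'.
  rewrite lerD//.
    by rewrite (le_trans (enormB _ _))// lerD// hB// (x_bounded, y_bounded).
  by rewrite (le_trans (enormD _ _))// lerD// f_bounded.
have := drift_step h_ge0 (grad_strongly_monotone hV (y s) (x s)) dV_le.
move=> /le_trans; apply.
have dg : dotv (y s - x s) g <= dotv (y s - x s) (fy s - fx s) + 4 * rho * e.
  rewrite /g dotvDr lerD2l (le_trans (dotv_le _ _))//.
  have -> : 4 * rho * e = (rho + rho) * (e + e) by ring.
  apply: ler_pM; rewrite ?enorm_ge0//.
  by rewrite (le_trans (enormB _ _))// lerD// (x_bounded, y_bounded).
have hBB : h * B' ^+ 2 <= eps / 2.
  rewrite ler_pdivlMr//.
  move: hB'; rewrite ler_pdivlMr ?mulr_gt0 ?ltr_wpDl ?sqr_ge0//.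
  apply: le_trans; rewrite -mulrA ler_wpM2l// mulrC ler_wpM2l//.
  by rewrite lerDl.
have : h * dotv (y s - x s) g <= h * (dotv (y s - x s) (fy s - fx s) + 4 * rho * e).
  by rewrite ler_wpM2l.
have : h * (h * B' ^+ 2) <= h * (eps / 2) by rewrite ler_wpM2l.
have : h * (16 * rho * e) <= h * eps by rewrite ler_wpM2l.
rewrite exprMn.
move: (dotv _ g) (dotv _ (fy s - fx s)) (enorm (y s - x s)) (B' ^+ 2) => *; lra.
Unshelve. all: by end_near.
Qed.

End Pair.

(** The weights have sum at most 1, so the interaction is [2 * L]-Lipschitz for the maximum over the
    particles, and [shadowing] applies with [lam = 2 * L] and no further defect. This writes a
    solution as a limit of explicit functions of its starting point, the weights and the noise. *)
Lemma euler_interacting_cvg (I : finType) (kap : I -> I -> R) (K : 'rV[R]_d -> 'rV[R]_d)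
    (L sigma t0 t1 rho t : R) (y beta : I -> R -> 'rV[R]_d) (i : I) (j : 'I_d) :
  0 <= L -> (forall u v, enorm (K u - K v) <= L * enorm (u - v)) ->
  (forall i j, 0 <= kap i j) -> (forall i, \sum_j kap i j <= 1) ->
  (forall i, uniform_increments sigma t0 t1
    (fun s => - grad V (y i s) + \sum_j kap i j *: K (y i s - y j s)) (y i) (beta i)) ->
  (forall i s, t0 <= s <= t1 -> enorm (y i s) <= rho) ->
  t0 <= t <= t1 ->
  euler V ((t - t0) / n%:R)
       (fun _ w i => \sum_j kap i j *: K (w i - w j))
       (fun k i => sigma *: (beta i (grid t0 t n k.+1) - beta i (grid t0 t n k)))
       (fun i => y i t0) n i 0 j @[n --> \oo] --> y i t 0 j.
Proof.
move=> L0 KL kap0 kap1 hy y_bd ttt.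
apply/cvgrPdist_le => eps eps0.
have L20 : 0 <= 2 * L by rewrite mulr_ge0.
have eps1 : 0 < eps / expR (2 * L * (t - t0)) by rewrite divr_gt0// expR_gt0.
have H := @shadowing R d V r hV I sigma t0 t1 y beta _ rho (2 * L) 0 0 t hy y_bd
  L20 (lexx _) (lexx _) ttt _ eps1.
apply: filterS H => n H.
rewrite [X in `|X|](_ : _ = (y i t - euler V ((t - t0) / n%:R)
       (fun _ w i => \sum_j kap i j *: K (w i - w j))
       (fun k i => sigma *: (beta i (grid t0 t n k.+1) - beta i (grid t0 t n k)))
       (fun i => y i t0) n i) 0 j); last by rewrite !mxE.
rewrite (le_trans (coord_le_enorm _ _))//.
have -> : eps = expR (2 * L * (t - t0)) * (0 + (t - t0) / n%:R * (\sum_(k < n) 0)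
   + eps / expR (2 * L * (t - t0))).
  by rewrite big1// mulr0 !add0r mulrC divfK// gt_eqF// expR_gt0.
set w := euler _ _ _ _ _.
apply: (H w (fun k i => \sum_j kap i j *: K (w k i - w k j)) (fun=> 0)) => //.
- by move=> k; rewrite lexx.
- by move=> i'; rewrite subrr enorm0.
move=> k i' u kn hu; rewrite addr0 -sumrB.
rewrite (le_trans (enorm_sum _ _ _))//.
apply: (@le_trans _ _ (\sum_j0 kap i' j0 * (2 * L * u))).
  apply: ler_sum => j' _; rewrite -scalerBr enormZ ger0_norm// ler_wpM2l//.
  rewrite (le_trans (KL _ _))// [2 * L]mulrC -mulrA ler_wpM2l//.
  set a := y i' _; set b := y j' _.
  have -> : a - b - (w k i' - w k j') = (a - w k i') - (b - w k j').
    by apply/rowP => c; rewrite !mxE; ring.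
  by rewrite mulr_natl mulr2n (le_trans (enormB _ _))// lerD// hu.
rewrite -mulr_suml ler_piMl// mulr_ge0//.
by rewrite (le_trans _ (hu i'))// enorm_ge0.
Qed.

End CoupledPaths.

(** * Measurability of random vectors *)

Section VectorMeasurability.
Variables (R : realType) (m : nat) (disp : measure_display).
Variables (T : measurableType disp) (D : set T).
Implicit Types (f g : T -> 'rV[R]_m) (a : T -> R).

Lemma measurable_rV_continuous (phi : 'rV[R]_m -> R) f :
  continuous phi -> measurable_fun D f -> measurable_fun D (fun w => phi (f w)).
Proof.
move=> cphi mf mD; apply: (measurability _ (RGenOpens.measurableE R)) => //.
move=> _ [_ [a [b ->] <-]].
rewrite -[X in D `&` X]/(f @^-1` (phi @^-1` `]a, b[)).
apply: (mf mD); apply: sub_sigma_algebra.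
by apply: open_comp => [x _|]; [exact: cphi|exact: interval_open].
Qed.

Lemma measurable_coord f j : measurable_fun D f -> measurable_fun D (fun w => f w 0 j).
Proof. exact: (@measurable_rV_continuous (fun v => v 0 j) f (@coord_continuous _ _ _ 0 j)). Qed.

(** Boxes with rational centre and radius form a countable base of the topology. The Borel
    sigma-algebra being generated by all open sets, countability is what reduces measurability to
    the coordinates. *)
Let box (q : 'rV[rat]_m * rat) : set 'rV[R]_m :=
  [set x | forall j, `|x 0 j - ratr (q.1 0 j)| < ratr q.2].

Let open_bigcup_box (U : set 'rV[R]_m) : open U ->
  U = \bigcup_q (if pselect (box q `<=` U) then box q else set0).
Proof.
move=> oU; apply/seteqP; split => [x Ux|x [q _]]; last first.
  by case: pselect => // qU; exact: qU.
have /nbhs_ballP[e/= e0 xe] : nbhs x U by exact: open_nbhs_nbhs.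
have [eps /andP[eps0 epse]] : exists q : rat, 0 < (ratr q : R) < e / 2.
  have [q] := @rat_in_itvoo R 0 (e / 2) (divr_gt0 e0 (ltr0Sn _ _)).
  by rewrite in_itv/=; exists q.
have hq j : exists q : rat, `|x 0 j - ratr q| < ratr eps.
  have [|q] := @rat_in_itvoo R (x 0 j - ratr eps) (x 0 j); first by rewrite gtrBl.
  rewrite in_itv/= => /andP[q1 q2]; exists q.
  by rewrite gtr0_norm ?subr_gt0// ltrBlDr -ltrBlDl.
pose c : 'rV[rat]_m := \row_j sval (cid (hq j)).
exists (c, eps) => //.
case: pselect => /= [_ j|]; first by rewrite /c mxE; exact: (svalP (cid (hq j))).
case=> y hy; apply: xe; split => // i j; rewrite ord1.
have := hy j; rewrite /c /= mxE => h1; have h2 := svalP (cid (hq j)).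
rewrite /ball/= (_ : x 0 j - y 0 j = (x 0 j - ratr (sval (cid (hq j))))
  - (y 0 j - ratr (sval (cid (hq j))))); last by ring.
by rewrite (le_lt_trans (ler_normB _ _))// (lt_trans (ltrD h2 h1))//; lra.
Qed.

Lemma measurable_rV f :
  (forall j, measurable_fun D (fun w => f w 0 j)) -> measurable_fun D f.
Proof.
move=> mf mD.
apply: (measurability (@open 'rV[R]_m)) => // _ [U oU <-].
rewrite (open_bigcup_box oU) preimage_bigcup setI_bigcupr.
apply: countable_bigcupT_measurable; first exact: countableP.
move=> q; case: pselect => bU; last by rewrite preimage_set0 setI0.
have -> : D `&` f @^-1` box q = D `&`
    \bigcap_(j in [set: 'I_m])
      (D `&` (fun w => f w 0 j) @^-1` [set u : R | `|u - ratr (q.1 0 j)| < ratr q.2]).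
  apply/seteqP; split => w /=.
    by move=> [Dw hw]; split => // j _; split => //; exact: hw.
  by move=> [Dw hw]; split => // j; have [] := hw j Logic.I.
apply: measurableI => //; apply: fin_bigcap_measurable; first exact: finite_finset.
move=> j _; apply: (mf j mD).
rewrite (_ : [set u | _] = `]ratr (q.1 0 j) - ratr q.2, ratr (q.1 0 j) + ratr q.2[%classic).
  exact: measurable_itv.
by apply/seteqP; split => u /=; rewrite in_itv/= ltr_distl.
Qed.

Lemma measurable_addv f g : measurable_fun D f -> measurable_fun D g ->
  measurable_fun D (fun w => f w + g w).
Proof.
move=> mf mg; apply: measurable_rV => j; under eq_fun do rewrite mxE.
by apply: measurable_funD; exact: measurable_coord.
Qed.

Lemma measurable_scalev a f : measurable_fun D a -> measurable_fun D f ->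
  measurable_fun D (fun w => a w *: f w).
Proof.
move=> ma mf; apply: measurable_rV => j; under eq_fun do rewrite mxE.
by apply: measurable_funM => //; exact: measurable_coord.
Qed.

Lemma measurable_oppv f : measurable_fun D f -> measurable_fun D (fun w => - f w).
Proof.
move=> mf; under eq_fun do rewrite -scaleN1r.
by apply: measurable_scalev => //; exact: measurable_cst.
Qed.

Lemma measurable_subv f g : measurable_fun D f -> measurable_fun D g ->
  measurable_fun D (fun w => f w - g w).
Proof. by move=> mf mg; apply: measurable_addv => //; exact: measurable_oppv. Qed.

Lemma measurable_sumv (I : Type) (s : seq I) (F : I -> T -> 'rV[R]_m) :
  (forall i, measurable_fun D (F i)) ->
  measurable_fun D (fun w => \sum_(i <- s) F i w).
Proof.
move=> mF; apply: measurable_rV => j; under eq_fun do rewrite summxE.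
by apply: measurable_sum => i; exact: measurable_coord.
Qed.

Lemma measurable_dotv f g : measurable_fun D f -> measurable_fun D g ->
  measurable_fun D (fun w => dotv (f w) (g w)).
Proof.
move=> mf mg; apply: measurable_sum => j.
by apply: measurable_funM; exact: measurable_coord.
Qed.

Lemma enormE (x : 'rV[R]_m) : enorm x = Num.sqrt (dotv x x).
Proof. by rewrite dotvv sqrtr_sqr ger0_norm ?enorm_ge0. Qed.

Lemma measurable_enorm f : measurable_fun D f -> measurable_fun D (fun w => enorm (f w)).
Proof.
move=> mf; under eq_fun do rewrite enormE.
apply: (measurableT_comp (f := @Num.sqrt R)); last exact: measurable_dotv.
by apply: continuous_measurable_fun; exact: sqrt_continuous.
Qed.

Lemma measurable_continuousv (phi : 'rV[R]_m -> 'rV[R]_m) f :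
  continuous phi -> measurable_fun D f -> measurable_fun D (fun w => phi (f w)).
Proof.
move=> cphi mf; apply: measurable_rV => j.
apply: (measurable_rV_continuous (phi := fun x => phi x 0 j)) => // x.
apply: (@continuous_comp _ _ _ phi (fun v : 'rV[R]_m => v 0 j)); first exact: cphi.
exact: coord_continuous.
Qed.

Lemma measurable_rV_cvg (F : nat -> T -> 'rV[R]_m) f :
  (forall n, measurable_fun D (F n)) ->
  (forall w j, D w -> F n w 0 j @[n --> \oo] --> f w 0 j) -> measurable_fun D f.
Proof.
move=> mF hF; apply: measurable_rV => j.
apply: (measurable_fun_cvg (h := fun n w => F n w 0 j)) => [n|w Dw].
  exact: measurable_coord.
exact: hF.
Qed.

(** The measurable structure on the sample space is arbitrary, so that the sigma-algebra of the past
    can be put there. *)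
Lemma measurable_euler (V : 'rV[R]_m -> R) (I : finType) (h : R)
    (F : T -> nat -> (I -> 'rV[R]_m) -> I -> 'rV[R]_m) (db : T -> nat -> I -> 'rV[R]_m)
    (w0 : T -> I -> 'rV[R]_m) :
  continuous (grad V) ->
  (forall k (w : T -> I -> 'rV[R]_m), (forall i, measurable_fun D (fun o => w o i)) ->
     forall i, measurable_fun D (fun o => F o k (w o) i)) ->
  (forall k i, measurable_fun D (fun o => db o k i)) ->
  (forall i, measurable_fun D (fun o => w0 o i)) ->
  forall k i, measurable_fun D (fun o => euler V h (F o) (db o) (w0 o) k i).
Proof.
move=> cV mF mdb mw0; elim=> [|k IH] i //=.
apply: measurable_addv => //; apply: measurable_addv; last first.
  by apply: measurable_scalev; [exact: measurable_cst|exact: mF].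
apply: measurable_subv => //; apply: measurable_scalev; first exact: measurable_cst.
exact: measurable_continuousv.
Qed.

End VectorMeasurability.

(** * Uniform divisions into batches *)

Section Divisions.
Variables (n p : nat).
Hypothesis p_gt0 : (0 < p)%N.
Local Notation N := (n * p)%N.
Implicit Types (D : {set {set 'I_N}}) (i j k : 'I_N) (s : {perm 'I_N}).

(** Indices with the same quotient by [p] are grouped. Existence makes the number of divisions
    invertible, so that the uniform mean is a genuine average. *)
Lemma exists_division : exists D, @is_division n p D.
Proof.
pose blk (q : 'I_n) := [set y : 'I_N | (y %/ p == q)%N]%SET.
have lt_np (q : 'I_n) (r : 'I_p) : (q * p + r < N)%N.
  by rewrite (@leq_trans (q.+1 * p))// ?leq_mul2r ?ltn_ord ?orbT// mulSn addnC ltn_add2r.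
pose g q (r : 'I_p) := Ordinal (lt_np q r).
have blkE q : blk q = (g q @: [set: 'I_p])%SET.
  apply/setP => y; rewrite inE; apply/eqP/imsetP => [yq|[r _ ->]]; last first.
    by rewrite /= divnMDl// divn_small ?addn0.
  exists (Ordinal (ltn_pmod y p_gt0)) => //; apply: val_inj => /=.
  by rewrite -yq -divn_eq.
have card_blk q : #|blk q| = p.
  rewrite blkE card_imset ?cardsT ?card_ord// => r r' /(congr1 val)/= /eqP.
  by rewrite eqn_add2l => /eqP/val_inj.
have [||tI injb] := @trivIimset _ _ (mem [set: 'I_n]%SET) blk.
- move=> q q' _ _ qq'; apply/pred0P => y /=; rewrite !inE.
  by apply: contraNF qq' => /andP[/eqP h /eqP h']; apply/eqP/val_inj; rewrite /= -h -h'.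
- apply/negP => /imsetP[q _ q0]; have := card_blk q; rewrite -q0 cards0 => p0.
  by move: p_gt0; rewrite -p0.
exists (blk @: [set: 'I_n])%SET; apply/and3P; split.
- apply/and3P; split => //.
  + rewrite finset.eqEsubset finset.subsetT/=; apply/fintype.subsetP => y _; rewrite cover_imset.
    have yn : (y %/ p < n)%N by rewrite ltn_divLR.
    by apply/finset.bigcupP; exists (Ordinal yn); rewrite // inE.
  + apply/negP => /imsetP[q _ q0]; have := card_blk q; rewrite -q0 cards0 => p0.
    by move: p_gt0; rewrite -p0.
- by rewrite card_in_imset// cardsT card_ord.
- by apply/forall_inP => _ /imsetP[q _ ->]; rewrite card_blk.
Qed.

Lemma card_division_gt0 : (0 < #|@is_division n p|)%N.
Proof. by have [D hD] := exists_division; apply/card_gt0P; exists D. Qed.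

Lemma division_trivIset D : is_division D -> finset.trivIset D.
Proof. by case/and3P => /and3P[]. Qed.

Lemma division_cover D i : is_division D -> i \in finset.cover D.
Proof. by case/and3P => /and3P[/eqP -> _ _] _ _; rewrite inE. Qed.

Lemma mem_division_pblock D i : is_division D -> i \in finset.pblock D i.
Proof. by move=> hD; rewrite mem_pblock division_cover. Qed.

Lemma card_division_pblock D i : is_division D -> #|finset.pblock D i| = p.
Proof.
move=> hD; case/and3P: (hD) => _ _ /forall_inP/(_ _ (pblock_mem (division_cover i hD))).
by move/eqP.
Qed.

(** Relabelling the particles acts on the divisions and preserves the uniform mean. This symmetry
    replaces any count of divisions below. *)
Definition perm_division s D : {set {set 'I_N}} := [set s @: (C : {set _}) | C in D]%SET.

Lemma perm_division_inj s : injective (perm_division s).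
Proof. by apply/imset_inj/imset_inj/perm_inj. Qed.

Lemma perm_divisionP s D : is_division D -> is_division (perm_division s D).
Proof.
move=> hD; case/and3P: (hD) => /and3P[/eqP cD /finset.trivIsetP tD D0] /eqP cardD /forall_inP sz.
have inj : injective (fun C : {set 'I_N} => s @: C)%SET by apply/imset_inj/perm_inj.
apply/and3P; split; [apply/and3P; split| |].
- rewrite finset.eqEsubset finset.subsetT/=; apply/fintype.subsetP => y _; rewrite cover_imset.
  have : (s^-1)%g y \in finset.cover D by rewrite cD inE.
  move=> /finset.bigcupP[C CD yC]; apply/finset.bigcupP; exists C => //.
  by apply/imsetP; exists ((s^-1)%g y); rewrite // permKV.
- apply/finset.trivIsetP => _ _ /imsetP[A AD ->] /imsetP[B BD ->] AB.
  rewrite imset_disjoint; first by apply: tD => //; apply: contraNneq AB => ->.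
  exact: perm_inj.
- apply: contra D0 => /imsetP[C CD /esym/eqP]; rewrite imset_eq0 => /eqP C0.
  by rewrite -C0.
- by rewrite card_imset// cardD.
- by apply/forall_inP => _ /imsetP[C CD ->]; rewrite card_imset ?sz//; exact: perm_inj.
Qed.

Lemma pblock_perm_division s D i : is_division D ->
  finset.pblock (perm_division s D) (s i) = (s @: finset.pblock D i)%SET.
Proof.
move=> hD; apply: def_pblock.
- exact/division_trivIset/perm_divisionP.
- by apply/imset_f/pblock_mem/division_cover.
- by apply/imset_f/mem_division_pblock.
Qed.

Variable R : realType.

Definition division_mean (phi : {set {set 'I_N}} -> R) : R :=
  (#|@is_division n p|%:R)^-1 * \sum_(D | is_division D) phi D.

Lemma eq_division_mean phi psi :
  (forall D, is_division D -> phi D = psi D) -> division_mean phi = division_mean psi.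
Proof. by move=> h; congr (_ * _); apply: eq_bigr. Qed.

Lemma division_mean_cst c : division_mean (fun=> c) = c.
Proof.
rewrite /division_mean sumr_const -[c *+ _]mulr_natl mulKf// pnatr_eq0 -lt0n.
exact: card_division_gt0.
Qed.

Lemma division_mean_sum (I : Type) (r : seq I) (Q : pred I) F :
  division_mean (fun D => \sum_(k <- r | Q k) F k D)
  = \sum_(k <- r | Q k) division_mean (F k).
Proof. by rewrite /division_mean exchange_big/= mulr_sumr. Qed.

Lemma division_meanZ c phi : division_mean (fun D => c * phi D) = c * division_mean phi.
Proof. by rewrite /division_mean -mulr_sumr mulrCA. Qed.

Lemma division_meanB phi psi :
  division_mean (fun D => phi D - psi D) = division_mean phi - division_mean psi.
Proof. by rewrite /division_mean sumrB mulrBr. Qed.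

Lemma division_mean_ge0 phi : (forall D, is_division D -> 0 <= phi D) ->
  0 <= division_mean phi.
Proof. by move=> h; rewrite mulr_ge0// sumr_ge0. Qed.

Lemma division_mean_perm s phi :
  division_mean (fun D => phi (perm_division s D)) = division_mean phi.
Proof.
congr (_ * _); rewrite [RHS](reindex_inj (@perm_division_inj s)).
apply: eq_bigl => D; apply/idP/idP; first exact: perm_divisionP.
move=> h; have := perm_divisionP (s^-1)%g h; congr is_division.
apply/setP => C; rewrite /perm_division -imset_comp (eq_imset (g := id)) ?imset_id//.
move=> B /=; rewrite -imset_comp (eq_imset (g := id)) ?imset_id// => x /=.
by rewrite permK.
Qed.

(** Normalised in this way, the weights are nonnegative with sum 1 for batch and full interaction
    alike, so both interactions are weighted averages of the kernel and share the same estimates. *)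
Definition batch_weight (D : {set {set 'I_N}}) i j : R :=
  ((j \in finset.pblock D i) && (j != i))%:R / p.-1%:R.

Definition full_weight i j : R := (j != i)%:R / N.-1%:R.

Lemma batch_weight_ge0 D i j : 0 <= batch_weight D i j.
Proof. by rewrite divr_ge0. Qed.

Lemma full_weight_ge0 i j : 0 <= full_weight i j.
Proof. by rewrite divr_ge0. Qed.

Lemma batch_weight_perm s D i j : is_division D -> s i = i ->
  batch_weight (perm_division s D) i (s j) = batch_weight D i j.
Proof.
move=> hD si; rewrite /batch_weight.
have -> : (s j != i) = (j != i) by rewrite -{1}si (inj_eq perm_inj).
by rewrite -{1}si pblock_perm_division// mem_imset//; exact: perm_inj.
Qed.

Hypothesis p_gt1 : (1 < p)%N.
Hypothesis n_gt0 : (0 < n)%N.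

Lemma sum_batch_weight D i : is_division D -> \sum_j batch_weight D i j = 1.
Proof.
move=> hD; rewrite -mulr_suml -natr_sum.
have -> : (\sum_j (j \in finset.pblock D i) && (j != i) = p.-1)%N.
  transitivity (#|finset.pblock D i|.-1); last by rewrite card_division_pblock.
  rewrite (cardsD1 i) mem_division_pblock//= -sum1_card [RHS]big_mkcond/=.
  by apply: eq_bigr => j _; rewrite !inE andbC; case: ifP.
by rewrite divff// pnatr_eq0 -lt0n -subn1 subn_gt0.
Qed.

Lemma N_pred_gt0 : (0 < N.-1)%N.
Proof. by rewrite -subn1 subn_gt0 (leq_trans p_gt1)// leq_pmull. Qed.

Lemma card_others i : (\sum_j (j != i) = N.-1)%N.
Proof.
transitivity (#|'I_N|.-1); last by rewrite card_ord.
rewrite (cardD1 i)/= -sum1_card [RHS]big_mkcond/=.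
by apply: eq_bigr => j _; rewrite !inE andbT; case: ifP.
Qed.

Lemma sum_full_weight i : \sum_j full_weight i j = 1.
Proof.
rewrite -mulr_suml -natr_sum card_others divff// pnatr_eq0 -lt0n; exact: N_pred_gt0.
Qed.

(** Transpositions fixing [i] show that all [j != i] have the same mean weight; the weights have sum
    1, which determines this common value. *)
Lemma mean_batch_weight i j : division_mean (fun D => batch_weight D i j) = full_weight i j.
Proof.
pose q k := division_mean (fun D => batch_weight D i k).
have qii : q i = 0.
  rewrite -[RHS](division_mean_cst 0); apply: eq_division_mean => D _.
  by rewrite /batch_weight eqxx andbF mul0r.
have [->|ji] := eqVneq j i; first by rewrite -/(q i) qii /full_weight eqxx mul0r.
have qE k : q k = (k != i)%:R * q j.
  have [->|ki] := eqVneq k i; first by rewrite qii mul0r.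
  rewrite mul1r /q -(division_mean_perm (tperm k j)); apply: eq_division_mean => D hD.
  by rewrite -{2}(tpermR k j) batch_weight_perm// tpermD.
have : \sum_k q k = 1.
  rewrite -division_mean_sum -[RHS]division_mean_cst; apply: eq_division_mean => D hD.
  exact: sum_batch_weight.
rewrite (eq_bigr _ (fun k _ => qE k)) -mulr_suml -natr_sum card_others => h.
rewrite -/(q j) /full_weight ji.
have N0 : N.-1%:R != 0 :> R by rewrite pnatr_eq0 -lt0n N_pred_gt0.
by apply: (mulfI N0); rewrite h mul1r divff.
Qed.

Definition batch_cov i j k : R := division_mean (fun D =>
  (batch_weight D i j - full_weight i j) * (batch_weight D i k - full_weight i k)).

Lemma batch_cov_center i j : batch_cov i j i = 0.
Proof.
rewrite -[RHS](division_mean_cst 0); apply: eq_division_mean => D _.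
by rewrite /batch_weight /full_weight eqxx andbF !mul0r subrr mulr0.
Qed.

Lemma batch_cov_ge0 i j : 0 <= batch_cov i j j.
Proof. by apply: division_mean_ge0 => D _; rewrite -expr2 sqr_ge0. Qed.

(** The weight takes only the values 0 and [1 / (p - 1)], so its square is the weight divided by
    [p - 1], and the mean is already known. *)
Lemma batch_var_le i j : batch_cov i j j <= full_weight i j / p.-1%:R.
Proof.
set f := full_weight i j.
have -> : batch_cov i j j = f / p.-1%:R - f ^+ 2.
  transitivity (division_mean (fun D =>
      (p.-1%:R)^-1 * batch_weight D i j - (2 * f * batch_weight D i j - f ^+ 2))).
    apply: eq_division_mean => D _; rewrite -/f.
    have -> : (p.-1%:R)^-1 * batch_weight D i j = batch_weight D i j ^+ 2.
      by rewrite /batch_weight; case: (_ && _); rewrite ?mul0r ?mulr0 ?expr0n ?mul1r// expr2.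
    by ring.
  rewrite !division_meanB division_mean_cst !division_meanZ mean_batch_weight -/f.
  by ring.
by rewrite gerBl sqr_ge0.
Qed.

Lemma sum_batch_cov i j : \sum_k batch_cov i j k = 0.
Proof.
rewrite -division_mean_sum -[RHS](division_mean_cst 0).
apply: eq_division_mean => D hD.
by rewrite -mulr_sumr sumrB sum_batch_weight// sum_full_weight subrr mulr0.
Qed.

Lemma batch_cov_swap i j k k' : k != i -> k != j -> k' != i -> k' != j ->
  batch_cov i j k = batch_cov i j k'.
Proof.
move=> ki kj k'i k'j; rewrite -[LHS](division_mean_perm (tperm k k')).
apply: eq_division_mean => D hD.
have -> : full_weight i k = full_weight i k' by rewrite /full_weight ki k'i.
have := @batch_weight_perm (tperm k k') D i k' hD; rewrite tpermR tpermD// => -> //.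
by have := @batch_weight_perm (tperm k k') D i j hD; rewrite !tpermD// => ->.
Qed.

(** The weights have constant sum, so each row of covariances adds up to 0. By symmetry the entries
    with [k != i] and [k != j] are equal, hence of one sign, and their absolute values add up to the
    variance; this gives the factor 2 without computing any covariance. *)
Lemma sum_norm_batch_cov i j :
  \sum_k `|batch_cov i j k| <= 2 * (full_weight i j / p.-1%:R).
Proof.
have [c hc] : exists c, forall k, k != j -> batch_cov i j k = (k != i)%:R * c.
  (* If no index differs from both [i] and [j], then [k != j] leaves only [k = i], where the
     covariance vanishes. *)
  have [k0 /andP[k0i k0j]|none] := pickP (fun k => (k != i) && (k != j)).
    exists (batch_cov i j k0) => k kj.
    have [->|ki] := eqVneq k i; first by rewrite batch_cov_center mul0r.
    by rewrite mul1r; exact: batch_cov_swap.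
  exists 0 => k kj; rewrite mulr0.
  have [->|ki] := eqVneq k i; first exact: batch_cov_center.
  by have := none k; rewrite ki kj.
have off : \sum_(k | k != j) `|batch_cov i j k| = `|\sum_(k | k != j) batch_cov i j k|.
  rewrite (eq_bigr (fun k => (k != i)%:R * `|c|)); last first.
    by move=> k kj; rewrite hc// normrM normr_nat.
  rewrite [in RHS](eq_bigr _ hc) -!mulr_suml normrM; congr (_ * _).
  by rewrite ger0_norm// sumr_ge0.
have := sum_batch_cov i j; rewrite (bigD1 j)//= => /eqP; rewrite addrC addr_eq0 => /eqP h.
rewrite (bigD1 j)//= off h normrN ger0_norm ?batch_cov_ge0//.
by rewrite mulr_natl mulr2n lerD// batch_var_le.
Qed.

Lemma sum2_norm_batch_cov i :
  \sum_j \sum_k `|batch_cov i j k| <= 2 / p.-1%:R.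
Proof.
rewrite (le_trans (ler_sum _ (fun j _ => sum_norm_batch_cov i j)))//.
by rewrite -mulr_sumr -mulr_suml sum_full_weight mul1r.
Qed.

End Divisions.

(** * Expectation and independence *)

Section Expectation.
Variables (R : realType) (disp : measure_display) (T : measurableType disp).
Variables (P : probability T R) (W : set T).
Hypothesis mW : measurable W.
Hypothesis PW : P W = 1%E.
Implicit Types f g : T -> R.

Definition bounded_rv f : Prop :=
  measurable_fun W f /\ exists c : R, forall w, W w -> `|f w| <= c.

(** The integral is restricted to a set [W] of full measure on which the equations will hold at
    every point, so that almost sure properties can be used pointwise and bounds are needed on [W]
    only. *)
Definition mean f : R := \int[P]_(w in W) f w.

Lemma bounded_rv_integrable f : bounded_rv f -> P.-integrable W (EFin \o f).
Proof.
move=> [mf [c hc]]; apply: measurable_bounded_integrable => //.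
  by rewrite ltey_eq fin_num_measure.
by exists c; split; rewrite ?num_real// => x cx w Ww; exact: le_trans (hc _ Ww) (ltW cx).
Qed.

Lemma bounded_rv_cst c : bounded_rv (fun=> c).
Proof. by split; [exact: measurable_cst|exists `|c|]. Qed.

Lemma bounded_rvD f g : bounded_rv f -> bounded_rv g -> bounded_rv (fun w => f w + g w).
Proof.
move=> [mf [a ha]] [mg [b hb]]; split; first exact: measurable_funD.
by exists (a + b) => w Ww; rewrite (le_trans (ler_normD _ _))// lerD ?ha ?hb.
Qed.

Lemma bounded_rvM f g : bounded_rv f -> bounded_rv g -> bounded_rv (fun w => f w * g w).
Proof.
move=> [mf [a ha]] [mg [b hb]]; split; first exact: measurable_funM.
by exists (a * b) => w Ww; rewrite normrM ler_pM ?ha ?hb.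
Qed.

Lemma bounded_rvZ c f : bounded_rv f -> bounded_rv (fun w => c * f w).
Proof. by move=> hf; apply: bounded_rvM => //; exact: bounded_rv_cst. Qed.

Lemma bounded_rvB f g : bounded_rv f -> bounded_rv g -> bounded_rv (fun w => f w - g w).
Proof.
move=> hf hg; apply: bounded_rvD => //; under eq_fun do rewrite -mulN1r.
exact: bounded_rvZ.
Qed.

Lemma bounded_rv_sum (I : Type) (s : seq I) (F : I -> T -> R) :
  (forall i, bounded_rv (F i)) -> bounded_rv (fun w => \sum_(i <- s) F i w).
Proof.
move=> hF; elim: s => [|i s IH].
  by under eq_fun do rewrite big_nil; exact: bounded_rv_cst.
by under eq_fun do rewrite big_cons; exact: bounded_rvD.
Qed.

Lemma eq_mean f g : (forall w, W w -> f w = g w) -> mean f = mean g.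
Proof. by move=> fg; apply: eq_Rintegral => w /set_mem; exact: fg. Qed.

Lemma mean_cst c : mean (fun=> c) = c.
Proof. by rewrite /mean Rintegral_cst// [X in _ * X](congr1 fine PW) mulr1. Qed.

Lemma meanD f g : bounded_rv f -> bounded_rv g ->
  mean (fun w => f w + g w) = mean f + mean g.
Proof. by move=> hf hg; apply: RintegralD => //; exact: bounded_rv_integrable. Qed.

Lemma meanZ c f : bounded_rv f -> mean (fun w => c * f w) = c * mean f.
Proof. by move=> hf; apply: RintegralZl => //; exact: bounded_rv_integrable. Qed.

Lemma meanB f g : bounded_rv f -> bounded_rv g ->
  mean (fun w => f w - g w) = mean f - mean g.
Proof. by move=> hf hg; apply: RintegralB => //; exact: bounded_rv_integrable. Qed.

Lemma mean_sum (I : Type) (s : seq I) (F : I -> T -> R) :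
  (forall i, bounded_rv (F i)) ->
  mean (fun w => \sum_(i <- s) F i w) = \sum_(i <- s) mean (F i).
Proof.
move=> hF; elim: s => [|i s IH].
  by rewrite big_nil -[RHS]mean_cst; apply: eq_mean => w _; rewrite big_nil.
rewrite big_cons -IH -meanD//; last exact: bounded_rv_sum.
by apply: eq_mean => w _; rewrite big_cons.
Qed.

Lemma le_mean f g : bounded_rv f -> bounded_rv g ->
  (forall w, W w -> f w <= g w) -> mean f <= mean g.
Proof. by move=> hf hg; apply: le_Rintegral => //; exact: bounded_rv_integrable. Qed.

Lemma mean_ge0 f : (forall w, W w -> 0 <= f w) -> 0 <= mean f.
Proof. exact: Rintegral_ge0. Qed.

Lemma mean_le_cst f c : bounded_rv f -> (forall w, W w -> f w <= c) -> mean f <= c.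
Proof.
move=> hf hc; rewrite -[leRHS](mean_cst c); apply: le_mean => //; exact: bounded_rv_cst.
Qed.

Lemma norm_mean_le f c : bounded_rv f -> (forall w, W w -> `|f w| <= c) -> `|mean f| <= c.
Proof.
move=> hf hc; rewrite ler_norml; apply/andP; split; last first.
  by apply: mean_le_cst => // w /hc; rewrite ler_norml => /andP[].
rewrite -[leLHS](mean_cst (- c)); apply: le_mean => //; first exact: bounded_rv_cst.
by move=> w /hc; rewrite ler_norml => /andP[].
Qed.

Lemma mean_bounded_cvg0 (F : nat -> T -> R) (c : R) :
  (forall n, measurable_fun W (F n)) -> (forall n w, W w -> `|F n w| <= c) ->
  (forall w, W w -> F n w @[n --> \oo] --> 0) ->
  mean (F n) @[n --> \oo] --> 0.
Proof.
move=> mF bF cF.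
have h := @dominated_cvg _ T R P W mW (fun n w => (F n w)%:E) (fun=> 0%E) (fun=> c%:E).
have : (\int[P]_(w in W) (F n w)%:E)%E @[n --> \oo] --> (\int[P]_(w in W) (0%E : \bar R))%E.
  apply: h => //.
  - by move=> n; apply/measurable_EFinP.
  - by move=> w Ww; apply: cvg_EFin; [exact: nearW|exact: cF].
  - by apply: (bounded_rv_integrable (bounded_rv_cst c)).
rewrite integral0 => /fine_cvgP[_]; exact.
Qed.

Lemma mean_indic (A : set T) : measurable A -> mean (fun w => \1_A w) = fine (P (A `&` W)).
Proof. by move=> mA; rewrite /mean /Rintegral integral_indic. Qed.

Lemma bounded_rv_indic (A : set T) : measurable A -> bounded_rv (fun w => \1_A w).
Proof.
move=> mA; split; first exact: measurable_indic.
by exists 1 => w _; rewrite indicE normr_nat lern1 leq_b1.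
Qed.

Lemma probability_setI_full (D : set T) : measurable D -> P (D `&` W) = P D.
Proof.
move=> mD; apply/eqP; rewrite eq_le; apply/andP; split.
  by apply: le_measure; rewrite ?inE//; exact: measurableI.
have : P (D `\` W) = 0%E.
  have mDW : measurable (D `\` W) by exact: measurableD.
  have mWC : measurable (~` W) by exact: measurableC.
  have PC : P (~` W) = 0%E by rewrite probability_setC// PW subee.
  apply/eqP; rewrite eq_le measure_ge0 andbT -PC.
  by apply: le_measure; rewrite ?inE// => w [].
move=> hD; rewrite -{1}(setUIDK D W).
apply: (le_trans (measureU2 _ _ _)); [exact: measurableI|exact: measurableD|].
by rewrite -[leRHS]adde0; apply: leeD => //; rewrite le_eqVlt; apply/orP; left; exact/eqP.
Qed.

(* Layer cake approximation of [x] in [[-c, c]] by [K] thresholds. *)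
Lemma threshold_approx (c x : R) (K : nat) : 0 < c -> (0 < K)%N -> `|x| <= c ->
  let h := 2 * c / K%:R in
  `|x - (- c + h * \sum_(k < K) (- c + k.+1%:R * h <= x)%R%:R)| <= h.
Proof.
move=> c0 K0 xc; set h := 2 * c / K%:R; rewrite /=.
have K0' : 0 < K%:R :> R by rewrite ltr0n.
have h0 : 0 < h by rewrite divr_gt0// mulr_gt0.
have Kh : K%:R * h = 2 * c by rewrite /h mulrCA divff ?mulr1// gt_eqF.
move: xc; rewrite ler_norml => /andP[cx xc].
pose y := (x + c) / h.
have y0 : 0 <= y by rewrite divr_ge0 ?(ltW h0)//; lra.
have yK : y <= K%:R by rewrite ler_pdivrMr// Kh; lra.
have yh : y * h = x + c by rewrite /y divfK// gt_eqF.
have -> : \sum_(k < K) (- c + k.+1%:R * h <= x)%R%:R = (Num.truncn y)%:R :> R.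
  rewrite -natr_sum; congr (_%:R).
  transitivity (\sum_(k < K) (k < Num.truncn y))%N.
    apply: eq_bigr => k _; congr (nat_of_bool _).
    by rewrite [RHS](truncn_ge_nat _ y0) ler_pdivlMr// addrC lerBlDr.
  have tK : (Num.truncn y <= K)%N.
    by rewrite -(ler_nat R) (le_trans _ yK)// truncn_le.
  rewrite -(big_mkord xpredT (fun k => (k < Num.truncn y)%N : nat)).
  rewrite (@big_cat_nat _ _ _ (Num.truncn y))//= [X in (_ + X)%N]big1_seq ?addn0; last first.
    by move=> k /=; rewrite mem_index_iota => /andP[h1 _]; rewrite ltnNge h1.
  rewrite (eq_big_nat _ _ (F2 := fun=> 1%N)); last by move=> k /andP[_ ->].
  by rewrite sum_nat_const_nat subn0 muln1.
have /andP[t1 t2] := truncn_itv y0.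
set t := (Num.truncn y)%:R in t1 t2 *.
have : t * h <= x + c by rewrite -yh ler_wpM2r// ltW.
have : x + c <= t * h + h.
  by rewrite -yh -[X in _ <= _ + X]mul1r -mulrDl ler_wpM2r ?(ltW h0)// natr1 ltW.
by move=> h1 h2; rewrite ler_norml; apply/andP; split; lra.
Qed.

(* [G] plays the role of the past: a generating pi-system independent of [A]. *)
Lemma mean_independent (G : set (set T)) (A : set T) f (c : R) :
  setI_closed G -> G setT -> G `<=` measurable ->
  (forall B, G B -> P (B `&` A) = (P B * P A)%E) ->
  measurable A -> <<s G >> W ->
  measurable_fun (W : set (g_sigma_algebraType G)) (f : g_sigma_algebraType G -> R) ->
  (forall w, W w -> `|f w| <= c) ->
  mean (fun w => f w * \1_A w) = fine (P A) * mean f.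
Proof.
move=> GI GT Gm hind mA sW mf fc.
have c0 : 0 <= `|c| + 1 by rewrite addr_ge0.
have sG_m : <<s G >> `<=` measurable by apply: smallest_sub => //; exact: sigma_algebra_measurable.
have indep B : <<s G >> B -> P (B `&` A) = (P B * P A)%E.
  move=> sB.
  (* [P] restricted to [A] and [P] scaled by [P A] are finite measures that agree on the pi-system
     [G], hence on the sigma-algebra it generates. *)
  pose m1 := mrestr P mA.
  pose a : {nonneg R} := NngNum (fine_ge0 (measure_ge0 P A)).
  pose m2 := mscale a P.
  have m2E C : m2 C = (P C * P A)%E.
    rewrite muleC /m2 /mscale/=; congr (_ * _)%E.
    by apply: fineK; exact: fin_num_measure.
  rewrite -m2E -[LHS]/(m1 B).
  apply: (@g_sigma_algebra_measure_unique _ R T G Gm (fun=> setT) (fun=> GT)) => //.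
  - by rewrite bigcup_const.
  - by move=> C GC; exact: etrans (hind _ GC) (esym (m2E C)).
  - move=> k; rewrite (le_lt_trans (probability_le1 P _)) ?ltry//.
    exact: measurableI.
have mf' : measurable_fun W f by move=> mW' Y mY; apply: sG_m; exact: mf.
have bf : bounded_rv f by split => //; exists c.
have bA : bounded_rv (fun w => \1_A w) by exact: bounded_rv_indic.
pose C := `|c| + 1.
have C0 : 0 < C by rewrite ltr_wpDl.
have fC w : W w -> `|f w| <= C.
  by move=> /fc /le_trans; apply; rewrite (le_trans (ler_norm _))// lerDl.
set pA := fine (P A).
(* The factor 2 counts the approximation of [f] by [phi], of size [2 * C / K], once in each of the
   two means. *)
suff main : forall K, (0 < K)%N -> `|mean (fun w => f w * \1_A w) - pA * mean f|
    <= 2 * (2 * C / K%:R).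
  apply/eqP; rewrite -subr_eq0 -normr_eq0 eq_le normr_ge0 andbT.
  apply/ler_addgt0Pr => e e0; rewrite add0r.
  have [K [K0 hK]] := filter_ex (filterI (nbhs_infty_gt 0) (nbhs_infty_ger (4 * C / e))).
  apply: (le_trans (main K K0)); rewrite mulrA ler_pdivrMr ?ltr0n//.
  by move: hK; rewrite ler_pdivrMr// => hK; lra.
move=> K K0; set h := 2 * C / K%:R.
have h0 : 0 < h by rewrite divr_gt0 ?mulr_gt0 ?ltr0n.
pose B k := W `&` f @^-1` [set x | - C + k.+1%:R * h <= x].
have sB k : <<s G >> (B k).
  apply: (mf sW [set x | - C + k.+1%:R * h <= x]).
  rewrite (_ : [set x | _] = `[- C + k.+1%:R * h, +oo[%classic); first exact: measurable_itv.
  by apply/seteqP; split => x /=; rewrite in_itv/= andbT.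
have mB k : measurable (B k) by exact: sG_m.
pose phi w := - C + h * \sum_(k < K) \1_(B k) w.
have bsum : bounded_rv (fun w => \sum_(k < K) \1_(B k) w).
  by apply: bounded_rv_sum => k; exact: bounded_rv_indic.
have bphi : bounded_rv phi.
  by apply: bounded_rvD; [exact: bounded_rv_cst|exact: bounded_rvZ].
have phi_close w : W w -> `|f w - phi w| <= h.
  move=> Ww; rewrite /phi.
  have -> : \sum_(k < K) \1_(B k) w = \sum_(k < K) (- C + k.+1%:R * h <= f w)%R%:R :> R.
    apply: eq_bigr => k _; rewrite indicE; congr (nat_of_bool _)%:R.
    by apply/idP/idP => [/set_mem[]|?]; [|exact: mem_set].
  exact: threshold_approx (fC w Ww).
have phiA : mean (fun w => phi w * \1_A w) = pA * mean phi.
  transitivity (mean (fun w => - C * \1_A w + h * \sum_(k < K) \1_(B k `&` A) w)).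
    apply: eq_mean => w _; rewrite /phi mulrDl -mulrA; congr (_ + _ * _).
    by rewrite mulr_suml; apply: eq_bigr => k _; rewrite indicI.
  have mBA k : measurable (B k `&` A) by exact: measurableI.
  rewrite meanD; last 2 first.
  - exact: bounded_rvZ.
  - by apply: bounded_rvZ; apply: bounded_rv_sum => k; exact: bounded_rv_indic.
  rewrite !meanZ//; last by apply: bounded_rv_sum => k; exact: bounded_rv_indic.
  rewrite mean_sum; last by move=> k; exact: bounded_rv_indic.
  rewrite /phi meanD; [|exact: bounded_rv_cst|exact: bounded_rvZ].
  rewrite mean_cst meanZ// mean_sum; last by move=> k; exact: bounded_rv_indic.
  rewrite mulrDr mean_indic// probability_setI_full// -/pA [_ * pA]mulrC; congr (_ + _).
  rewrite mulrCA; congr (_ * _); rewrite mulr_sumr; apply: eq_bigr => k _.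
  rewrite !mean_indic// !probability_setI_full// indep// fineM ?fin_num_measure//.
  by rewrite mulrC.
have -> : mean (fun w => f w * \1_A w) - pA * mean f =
    mean (fun w => (f w - phi w) * \1_A w) - pA * mean (fun w => f w - phi w).
  have -> : mean (fun w => (f w - phi w) * \1_A w) =
      mean (fun w => f w * \1_A w) - mean (fun w => phi w * \1_A w).
    rewrite -meanB; [|exact: bounded_rvM|exact: bounded_rvM].
    by apply: eq_mean => w _; rewrite mulrBl.
  by rewrite phiA meanB//; ring.
have bd : bounded_rv (fun w => f w - phi w) by exact: bounded_rvB.
rewrite (le_trans (ler_normB _ _))// mulr_natl mulr2n lerD//.
  apply: norm_mean_le; first exact: bounded_rvM.
  move=> w Ww; rewrite normrM -[leRHS]mulr1; apply: ler_pM => //; first exact: phi_close.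
  by rewrite indicE normr_nat lern1 leq_b1.
have pA01 : 0 <= pA <= 1.
  rewrite fine_ge0//= -lee_fin fineK ?fin_num_measure//; exact: probability_le1.
rewrite normrM -[leRHS]mul1r; apply: ler_pM => //.
  by rewrite ger0_norm; case/andP: pA01.
exact: norm_mean_le.
Qed.

End Expectation.

(** * Paths of the two particle systems *)

Section InteractingPaths.
Variables (R : realType) (d : nat) (V : 'rV[R]_d -> R) (r : R).
Variable K : 'rV[R]_d -> 'rV[R]_d.
Hypothesis hV : potential_assumption V r.
Hypothesis cK : continuous K.

Lemma continuous_addv (f g : R -> 'rV[R]_d) : continuous f -> continuous g ->
  continuous (fun s => f s + g s).
Proof. by move=> cf cg s; apply: cvgD; [exact: cf|exact: cg]. Qed.

Lemma continuous_sumv (I : Type) (q : seq I) (F : I -> R -> 'rV[R]_d) :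
  (forall i, continuous (F i)) -> continuous (fun s => \sum_(i <- q) F i s).
Proof.
move=> cF; elim: q => [|i q IH].
  by under eq_fun do rewrite big_nil; move=> s; exact: cvg_cst.
by under eq_fun do rewrite big_cons; exact: continuous_addv.
Qed.

Lemma sde_uniform_increments (I : finType) (kap : I -> I -> R) (sigma t0 t1 : R)
    (x beta : I -> R -> 'rV[R]_d) (i : I) :
  0 <= t0 ->
  (forall i, {within `[0, +oo[, continuous (x i)}) ->
  (forall i, {within `[0, +oo[, continuous (beta i)}) ->
  solves_sde sigma t0 `[t0, t1[
    (fun s => - grad V (x i s) + \sum_j kap i j *: K (x i s - x j s)) (x i) (beta i) ->
  uniform_increments sigma t0 t1
    (fun s => - grad V (x i s) + \sum_j kap i j *: K (x i s - x j s)) (x i) (beta i).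
Proof.
move=> t00 cx cbeta sol.
(* The paths are extended to negative times by their value at 0 to become globally continuous; since
   [0 <= t0], nothing changes on [[t0, t1]]. *)
pose xt j (s : R) := x j (Num.max 0 s).
pose bt j (s : R) := beta j (Num.max 0 s).
have maxE (s : R) : 0 <= s -> Num.max 0 s = s by move=> ?; rewrite max_r.
have xE j s : 0 <= s -> xt j s = x j s by move=> s0; rewrite /xt maxE.
have bE j s : 0 <= s -> bt j s = beta j s by move=> s0; rewrite /bt maxE.
have cxt j : continuous (xt j) by exact: within_continuous_max.
have cbt j : continuous (bt j) by exact: within_continuous_max.
have cdr : continuous (fun s => - grad V (xt i s) + \sum_j kap i j *: K (xt i s - xt j s)).
  apply: continuous_addv.
    move=> s; apply: cvgN.
    by apply: (@continuous_comp _ _ _ (xt i) (grad V)); [exact: cxt|exact: (grad_continuous hV)].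
  apply: continuous_sumv => j s; apply: cvgZr.
  apply: (@continuous_comp _ _ _ (fun s => xt i s - xt j s) K); last exact: cK.
  by apply: cvgB; exact: cxt.
have := solves_sde_increments cdr (cxt i) (cbt i).
move=> /(_ sigma t0 t1) H eta eta0.
have [|del del0 hdel] := H _ eta eta0.
  move=> t /= /[dup] tt; rewrite in_itv/= => /andP[t0t tt1] k.
  have t_ge0 : 0 <= t by exact: le_trans t0t.
  rewrite (xE i t t_ge0) (xE i t0 t00) (bE i t t_ge0) (bE i t0 t00).
  have drE s : 0 <= s -> - grad V (xt i s) + \sum_j kap i j *: K (xt i s - xt j s) =
      - grad V (x i s) + \sum_j kap i j *: K (x i s - x j s).
    move=> s_ge0; rewrite (xE i s s_ge0); congr (_ + _).
    by apply: eq_bigr => j _; rewrite (xE j s s_ge0).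
  have IE : \int[lebesgue_measure]_(s in `[t0, t])
      (- grad V (xt i s) + \sum_j kap i j *: K (xt i s - xt j s)) 0 k =
    \int[lebesgue_measure]_(s in `[t0, t])
      (- grad V (x i s) + \sum_j kap i j *: K (x i s - x j s)) 0 k.
    apply: eq_Rintegral => s /set_mem/=; rewrite in_itv/= => /andP[t0s _].
    by rewrite drE//; exact: le_trans t0s.
  rewrite IE; exact: sol.
exists del; first exact: del0.
move=> s s' t0s ss' s't1 sdel.
have s_ge0 : 0 <= s by exact: le_trans t0s.
have s'_ge0 : 0 <= s' by exact: le_trans ss'.
have := hdel s s' t0s ss' s't1 sdel.
rewrite (xE i s s_ge0) (xE i s' s'_ge0) (bE i s s_ge0) (bE i s' s'_ge0).
by under eq_bigr do rewrite (xE _ s s_ge0).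
Qed.

(** The radius depends on the path, hence on the sample point. It enters no expectation: it only
    provides the ball on which [grad V] is bounded in pathwise limits. *)
Lemma path_bounded (I : finType) (x : I -> R -> 'rV[R]_d) (t1 : R) :
  (forall i, {within `[0, +oo[, continuous (x i)}) ->
  exists rho : R, forall i s, 0 <= s <= t1 -> enorm (x i s) <= rho.
Proof.
move=> cx.
have H i : exists rho : R, forall s, 0 <= s <= t1 -> enorm (x i s) <= rho.
  have cxt : continuous (fun s : R => x i (Num.max 0 s)) by exact: within_continuous_max.
  have cj (j : 'I_d) : continuous (fun s : R => x i (Num.max 0 s) 0 j).
    move=> s; apply: (@continuous_comp _ _ _ (fun s : R => x i (Num.max 0 s))
      (fun v : 'rV[R]_d => v 0 j)); first exact: cxt.
    exact: coord_continuous.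
  have Hj (j : 'I_d) : exists rho : R, forall s, 0 <= s <= t1 -> `|x i s 0 j| <= rho.
    have [t10|t10] := leP 0 t1; last first.
      by exists 0 => s /andP[s0 s1]; have := le_trans s0 s1; rewrite leNgt t10.
    have [|c _ hc] := @EVT_max R (fun s : R => `|x i (Num.max 0 s) 0 j|) 0 t1 t10.
      by apply: continuous_subspaceT => s; apply: cvg_norm; exact: cj.
    exists `|x i (Num.max 0 c) 0 j| => s /andP[s0 s1].
    by have := hc s; rewrite in_itv/= s0 s1 max_r//; apply.
  exists (\sum_j sval (cid (Hj j))) => s hs.
  rewrite (le_trans (enorm_le_sum _))//; apply: ler_sum => j _.
  exact: (svalP (cid (Hj j))).
exists (\big[Num.max/0]_i sval (cid (H i))) => i s hs.
by rewrite (le_trans (svalP (cid (H i)) s hs))//; exact: le_bigmax_cond.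
Qed.

Lemma ips_driftE n p (x : 'I_(n * p) -> 'rV[R]_d) i :
  ips_drift V K x i = - grad V (x i) + \sum_j full_weight R i j *: K (x i - x j).
Proof.
congr (_ + _); rewrite scaler_sumr [LHS]big_mkcond/=; apply: eq_bigr => j _.
by rewrite /full_weight; case: ifP => _; rewrite ?mul0r ?scale0r ?mul1r.
Qed.

Lemma rbm_driftE n p (D : {set {set 'I_(n * p)}}) (x : 'I_(n * p) -> 'rV[R]_d) i :
  rbm_drift V K D x i = - grad V (x i) + \sum_j batch_weight R D i j *: K (x i - x j).
Proof.
congr (_ + _); rewrite scaler_sumr [LHS]big_mkcond/=; apply: eq_bigr => j _.
by rewrite /batch_weight; case: ifP => _; rewrite ?mul0r ?scale0r ?mul1r.
Qed.

End InteractingPaths.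

(** * Independence from the division of one step *)

Section Past.
Variables (R : realType) (d n p : nat) (disp : measure_display).
Variables (T : measurableType disp) (P : probability T R).
Variables (nu : probability 'rV[R]_d R).
Local Notation N := (n * p)%N.
Variables (X0 : 'I_N -> {RV P >-> 'rV[R]_d}) (B : 'I_N -> R -> {RV P >-> 'rV[R]_d}).
Variable xi : nat -> T -> {set {set 'I_N}}.
Hypothesis hdata : random_data nu X0 B xi.
Hypothesis p_gt0 : (0 < p)%N.
Variable W : set T.
Hypothesis mW : measurable W.
Hypothesis PW : P W = 1%E.

Local Notation data := (data_sigma X0 B xi).

Lemma measurable_division (E : set {set {set 'I_N}}) m : measurable (xi m @^-1` E).
Proof.
have -> : xi m @^-1` E = \bigcup_(D in E) (xi m @^-1` [set D]).
  by apply/seteqP; split => w /=; [exists (xi m w)|move=> [D ED /= ->]].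
apply: fin_bigcup_measurable; first exact: finite_finset.
by move=> D _; exact: (division_measurable (data_division hdata m)).
Qed.

Lemma data_sigmaT a : data a setT.
Proof.
case: a => [[i|i]|m] /=.
- exact: (@measurableT _ (g_sigma_algebraType _)).
- exact: (@measurableT _ (g_sigma_algebraType _)).
- by exists setT => //; rewrite setTI.
Qed.

Lemma data_sigmaI a : setI_closed (data a).
Proof.
case: a => [[i|i]|m] /=.
- exact: (@measurableI _ (g_sigma_algebraType _)).
- exact: (@measurableI _ (g_sigma_algebraType _)).
- move=> _ _ [E _ <-] [F _ <-]; exists (E `&` F) => //.
  by rewrite preimage_setI !setTI.
Qed.

Lemma data_sigma_measurable a : data a `<=` measurable.
Proof.
have sub (I : Type) (Q : set I) (F : I -> {RV P >-> 'rV[R]_d}) :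
    sigma_of Q (fun i => F i : T -> 'rV[R]_d) `<=` measurable.
  apply: smallest_sub; first exact: sigma_algebra_measurable.
  move=> A [i _ [C mC <-]]; exact: measurable_funPT.
case: a => [[i|i]|m] /=; [exact: sub|exact: sub|].
by move=> _ [E _ <-]; rewrite setTI; exact: measurable_division.
Qed.

(* All the data except the division of step [m], together with the set [W]
   of full measure on which the equations hold. *)
Definition past (m : nat) : set (set T) :=
  [set A | exists (s : seq ('I_N + 'I_N + nat)) (F : 'I_N + 'I_N + nat -> set T),
    [/\ uniq s, forall a, a \in s -> a != inr m /\ data a (F a)
      & A = \bigcap_(a in [set` s]) F a \/ A = (\bigcap_(a in [set` s]) F a) `&` W]].

Lemma past_setI m : setI_closed (past m).
Proof.
move=> A1 A2 [s1 [F1 [u1 h1 e1]]] [s2 [F2 [u2 h2 e2]]].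
pose F a := (if a \in s1 then F1 a else setT) `&` (if a \in s2 then F2 a else setT).
have FE : \bigcap_(a in [set` undup (s1 ++ s2)]) F a =
    (\bigcap_(a in [set` s1]) F1 a) `&` (\bigcap_(a in [set` s2]) F2 a).
  apply/seteqP; split => w /=.
    move=> hw; split => a /= ha.
      have := hw a; rewrite /= mem_undup mem_cat ha => /(_ isT) [].
      by rewrite ha.
    have := hw a; rewrite /= mem_undup mem_cat ha orbT => /(_ isT) [_].
    by rewrite ha.
  move=> [hw1 hw2] a _; split; case: ifPn => // ha; [exact: hw1|exact: hw2].
exists (undup (s1 ++ s2)), F; split; first exact: undup_uniq.
  move=> a; rewrite mem_undup mem_cat => ha; split.
    by case/orP: ha => [/h1 h|/h2 h]; exact: h.1.
  apply: data_sigmaI.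
    by case: ifPn => [/h1 h|_]; [exact: h.2|exact: data_sigmaT].
  by case: ifPn => [/h2 h|_]; [exact: h.2|exact: data_sigmaT].
rewrite FE; case: e1 e2 => -> [] ->; first by left.
- by right; rewrite setIA.
- by right; rewrite setIAC.
- by right; rewrite setIACA setIid.
Qed.

Lemma past_setT m : past m setT.
Proof.
exists [::], (fun=> setT); split => //; left.
by apply/seteqP; split.
Qed.

Lemma past_W m : past m W.
Proof.
exists [::], (fun=> setT); split => //; right.
by rewrite (_ : \bigcap_(a in _) _ = setT) ?setTI//; apply/seteqP; split.
Qed.

Lemma past_data m a A : a != inr m -> data a A -> past m A.
Proof.
move=> am hA; exists [:: a], (fun=> A); split => //.
  by move=> b; rewrite inE => /eqP ->.
left; apply/seteqP; split => w /=; first by move=> Aw b _.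
by move/(_ a); apply; rewrite /= inE.
Qed.

Lemma past_bigcap_measurable m (s : seq ('I_N + 'I_N + nat)) F :
  (forall a, a \in s -> a != inr m /\ data a (F a)) ->
  measurable (\bigcap_(a in [set` s]) F a).
Proof.
move=> h; apply: fin_bigcap_measurable; first exact: finite_seq.
by move=> a /= /h[_]; exact: data_sigma_measurable.
Qed.

Lemma past_measurable m : past m `<=` measurable.
Proof.
move=> A [s [F [us h e]]]; have mF := past_bigcap_measurable h.
by case: e => ->//; exact: measurableI.
Qed.

(** The division of step [m] is added as one more index to the independent family; intersecting with
    [W] changes no probability. *)
Lemma past_independent m (D : {set {set 'I_N}}) A : past m A ->
  P (A `&` xi m @^-1` [set D]) = (P A * P (xi m @^-1` [set D]))%E.
Proof.
move=> [s [F [us h e]]].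
have mF := past_bigcap_measurable h.
have mD := measurable_division [set D] m.
have main : P ((\bigcap_(a in [set` s]) F a) `&` xi m @^-1` [set D]) =
    (P (\bigcap_(a in [set` s]) F a) * P (xi m @^-1` [set D]))%E.
  rewrite (data_independent hdata us (fun a ha => (h a ha).2)).
  pose F' a := if a == inr m then xi m @^-1` [set D] else F a.
  have sm : inr m \notin s by apply/negP => /h[]; rewrite eqxx.
  have -> : (\bigcap_(a in [set` s]) F a) `&` xi m @^-1` [set D] =
      \bigcap_(a in [set` inr m :: s]) F' a.
    apply/seteqP; split => w /=.
      move=> [hw hD] a /=; rewrite inE /F'; case: eqP => // _ /= ha; exact: hw.
    move=> hw; split.
      move=> a /= ha; have := hw a; rewrite /= inE ha orbT => /(_ isT).
      by rewrite /F' (negbTE (h a ha).1).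
    by have := hw (inr m); rewrite /= inE eqxx /F' eqxx => /(_ isT).
  rewrite (data_independent hdata (s := inr m :: s) (A := F')); last 2 first.
  - by rewrite /= sm us.
  - move=> a; rewrite inE /F'; case: eqP => [->|_] /= ha; last by case: (h a ha).
    by exists [set D] => //; rewrite setTI.
  rewrite big_cons /F' eqxx muleC; congr (_ * _)%E.
  rewrite big_seq_cond [RHS]big_seq_cond; apply: eq_bigr => a /andP[ha _].
  by rewrite (negbTE (h a ha).1).
case: e => -> //.
rewrite setIAC !(probability_setI_full mW PW)//.
exact: measurableI.
Qed.

(** This is not a filtration: the noise at all times and the later divisions belong to [past m] too.
    Being [adapted m] means not depending on the division of step [m]. *)
Local Notation S m := (g_sigma_algebraType (past m)).
Local Notation adapted m f := (@measurable_fun _ _ (S m) _ W f).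

Lemma past_measurable_fun m (disp' : measure_display) (U : measurableType disp')
    (f : T -> U) :
  (forall A, measurable A -> past m (f @^-1` A)) -> adapted m f.
Proof.
move=> h _ A mA.
have sW : <<s past m >> W by apply: sub_sigma_algebra; exact: past_W.
have sA : <<s past m >> (f @^-1` A) by apply: sub_sigma_algebra; exact: h.
exact: (@measurableI _ (S m) _ _ sW sA).
Qed.

Lemma past_initial m i : adapted m (X0 i).
Proof.
apply: past_measurable_fun => A mA; apply: (@past_data m (inl (inl i))) => //=.
by apply: sub_sigma_algebra; exists tt => //; exists A => //; rewrite setTI.
Qed.

Lemma past_noise m i t : 0 <= t -> adapted m (B i t).
Proof.
move=> t0; apply: past_measurable_fun => A mA.
apply: (@past_data m (inl (inr i))) => //=.
apply: sub_sigma_algebra; exists t; first by rewrite /= in_itv/= t0.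
by exists A => //; rewrite setTI.
Qed.

Lemma past_division m m' (disp' : measure_display) (U : measurableType disp')
    (phi : {set {set 'I_N}} -> U) :
  m' != m -> adapted m (fun w => phi (xi m' w)).
Proof.
move=> mm'; apply: past_measurable_fun => A mA.
apply: (@past_data m (inr m')) => //=.
by exists (phi @^-1` A) => //; rewrite setTI.
Qed.

Lemma past_sigma_measurable m : <<s past m >> `<=` measurable.
Proof. by apply: smallest_sub; [exact: sigma_algebra_measurable|exact: past_measurable]. Qed.

Lemma adapted_measurable m (disp' : measure_display) (U : measurableType disp')
    (f : T -> U) :
  adapted m f -> measurable_fun W f.
Proof.
move=> mf _ A mA; apply: (@past_sigma_measurable m); apply: mf => //.
by apply: sub_sigma_algebra; exact: past_W.
Qed.

(** The probabilities prescribed for the individual divisions already add up to 1, so [xi m] is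
    almost surely a division. *)
Lemma division_full m : P (xi m @^-1` [set D | is_division D]) = 1%E.
Proof.
have nd0 := card_division_gt0 n p_gt0.
set q := enum (@is_division n p).
have -> : xi m @^-1` [set D | is_division D] =
    \bigcup_(D in [set` q]) (xi m @^-1` [set D]).
  apply/seteqP; split => w /=.
    by move=> hw; exists (xi m w) => //=; rewrite mem_enum.
  by move=> [D /=]; rewrite mem_enum => hD ->.
rewrite measure_fin_bigcup//; last 2 first.
- by move=> D D' _ _ [w [/= <- <-]].
- by move=> D _; exact: measurable_division.
rewrite -fsbig_seq ?enum_uniq//=.
rewrite (eq_big_seq (fun=> ((#|@is_division n p|%:R)^-1 : R)%:E)); last first.
  by move=> D; rewrite mem_enum => hD; exact: (division_uniform (data_division hdata m)).
rewrite sumEFin big_const_seq count_predT iter_addr addr0 -cardE -[_ *+ _]mulr_natr.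
by rewrite mulVf// pnatr_eq0 -lt0n.
Qed.

(** [past m.+1] leaves out another division, so it contains the one of step [m]. *)
Lemma measurable_of_division m (disp' : measure_display) (U : measurableType disp')
    (phi : {set {set 'I_N}} -> U) : measurable_fun W (fun w => phi (xi m w)).
Proof. by apply: (@adapted_measurable m.+1); apply: past_division; rewrite neq_ltn ltnSn. Qed.

Hypothesis W_division : forall w m, W w -> is_division (xi m w).

(** This is Fubini's theorem for the division of step [m] and the rest: [phi (xi m w)] is decomposed
    over the finitely many values of [xi m], and each indicator factors out by independence. *)
Lemma mean_division m (f : T -> R) (phi : {set {set 'I_N}} -> R) :
  adapted m f -> (exists c : R, forall w, W w -> `|f w| <= c) ->
  mean P W (fun w => f w * phi (xi m w)) = mean P W f * division_mean phi.
Proof.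
move=> mf [c fc].
have bf : bounded_rv W f by split; [exact: adapted_measurable mf|exists c].
have mD D : measurable (xi m @^-1` [set D]) by exact: measurable_division.
transitivity (mean P W (fun w =>
    \sum_(D | is_division D) phi D * (f w * \1_(xi m @^-1` [set D]) w))).
  apply: eq_mean => w Ww; rewrite (bigD1 (xi m w)) ?W_division//= big1 ?addr0.
    by rewrite indicE mem_set//= mulr1 mulrC.
  move=> D /andP[_ Dxi]; rewrite indicE memNset ?mulr0//=.
  by move=> h; rewrite h eqxx in Dxi.
have bI D : bounded_rv W (fun w => f w * \1_(xi m @^-1` [set D]) w).
  by apply: bounded_rvM => //; exact: bounded_rv_indic.
under eq_mean do rewrite -big_filter.
rewrite mean_sum//; last by move=> D; exact: (bounded_rvZ _ (bI D)).
rewrite big_filter /division_mean mulrCA mulr_sumr mulr_sumr; apply: eq_bigr => D hD.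
rewrite meanZ//.
rewrite (@mean_independent _ _ _ _ _ mW PW (past m) _ f c)//.
- rewrite (division_uniform (data_division hdata m) hD)/=.
  by ring.
- exact: past_setI.
- exact: past_setT.
- exact: past_measurable.
- by move=> A; exact: past_independent.
- exact: mD.
- by apply: sub_sigma_algebra; exact: past_W.
- exact: bI.
Qed.

End Past.

(** * The error of the random batch method *)

Section BoundedVectors.
Variables (R : realType) (d : nat) (disp : measure_display) (T : measurableType disp).
Variable W : set T.
Implicit Types f g : T -> 'rV[R]_d.

Definition bounded_vec f : Prop :=
  measurable_fun W f /\ exists c : R, forall w, W w -> enorm (f w) <= c.

Lemma bounded_vecD f g : bounded_vec f -> bounded_vec g -> bounded_vec (fun w => f w + g w).
Proof.
move=> [mf [a ha]] [mg [b hb]]; split; first exact: measurable_addv.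
by exists (a + b) => w Ww; rewrite (le_trans (enormD _ _))// lerD ?ha ?hb.
Qed.

Lemma bounded_vecB f g : bounded_vec f -> bounded_vec g -> bounded_vec (fun w => f w - g w).
Proof.
move=> [mf [a ha]] [mg [b hb]]; split; first exact: measurable_subv.
by exists (a + b) => w Ww; rewrite (le_trans (enormB _ _))// lerD ?ha ?hb.
Qed.

Lemma bounded_vecZ (a : T -> R) f : bounded_rv W a -> bounded_vec f ->
  bounded_vec (fun w => a w *: f w).
Proof.
move=> [ma [b hb]] [mf [c hc]]; split; first exact: measurable_scalev.
by exists (b * c) => w Ww; rewrite enormZ ler_pM ?enorm_ge0 ?hb ?hc.
Qed.

Lemma bounded_vec_sum (I : Type) (s : seq I) (F : I -> T -> 'rV[R]_d) :
  (forall i, bounded_vec (F i)) -> bounded_vec (fun w => \sum_(i <- s) F i w).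
Proof.
move=> hF; elim: s => [|i s IH].
  under eq_fun do rewrite big_nil; split; first exact: measurable_cst.
  by exists 0 => w _; rewrite enorm0.
by under eq_fun do rewrite big_cons; exact: bounded_vecD.
Qed.

Lemma bounded_rv_dotv f g : bounded_vec f -> bounded_vec g ->
  bounded_rv W (fun w => dotv (f w) (g w)).
Proof.
move=> [mf [a ha]] [mg [b hb]]; split; first exact: measurable_dotv.
exists (a * b) => w Ww; rewrite (le_trans (dotv_norm_le _ _))//.
by rewrite ler_pM ?enorm_ge0 ?ha ?hb.
Qed.

Lemma bounded_rv_enorm f : bounded_vec f -> bounded_rv W (fun w => enorm (f w)).
Proof.
move=> [mf [a ha]]; split; first exact: measurable_enorm.
by exists a => w Ww; rewrite ger0_norm ?enorm_ge0// ha.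
Qed.

Lemma bounded_rv_sqr (f : T -> R) : bounded_rv W f -> bounded_rv W (fun w => f w ^+ 2).
Proof. by move=> hf; under eq_fun do rewrite expr2; exact: bounded_rvM. Qed.

End BoundedVectors.

(** The cap 1 gives [eps ^+ 2 <= eps], so [(L + 4 * eps) * (1 + eps)] is at most
    [L + eps * (L + 8)], and the second bound turns this into [r - L]. *)
Definition young_parameter (R : realType) (r L : R) : R :=
  Num.min 1 ((r - 2 * L) / (L + 8)).

(** At the level [error_constant * (tau / (p - 1) + tau ^+ 2)] the part [r - 2 * L] of the
    contraction dominates the source terms. These are the displacement [2 * M * tau] of the error
    within a step, the variance of the batch error, and the Young remainder of the Lipschitz
    terms. *)
Definition error_constant (R : realType) (r L M : R) : R :=
  let eps := young_parameter r L in
  ((L + 4 * eps) * (1 + eps^-1) * (4 * M ^+ 2) + 4 * M ^+ 2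
   + 4 * eps^-1 * (L * M) ^+ 2) / (r - 2 * L).

Lemma young_parameter_gt0 (R : realType) (r L : R) : 0 <= L -> 2 * L < r ->
  0 < young_parameter r L.
Proof.
by move=> L0 hrL; rewrite lt_min ltr01 divr_gt0 ?subr_gt0// ltr_wpDl.
Qed.

Lemma young_parameter_le (R : realType) (r L : R) : 0 <= L -> 2 * L < r ->
  (L + 4 * young_parameter r L) * (1 + young_parameter r L) <= r - L.
Proof.
move=> L0 hrL; have e0 := young_parameter_gt0 L0 hrL.
have e1 : young_parameter r L <= 1 by rewrite ge_min lexx.
have e2 : young_parameter r L * (L + 8) <= r - 2 * L.
  by rewrite -ler_pdivlMr ?ltr_wpDl// ge_min lexx orbT.
move: (young_parameter r L) e0 e1 e2 => e e0 e1 e2.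
have e3 : e * e <= e by rewrite ler_piMr// ltW.
by nra.
Qed.

Lemma error_constant_ge0 (R : realType) (r L M : R) : 0 <= L -> 2 * L < r ->
  0 <= error_constant r L M.
Proof.
move=> L0 hrL; have e0 := ltW (young_parameter_gt0 L0 hrL).
rewrite divr_ge0 ?subr_ge0 ?(ltW hrL)//.
move: (M ^+ 2) (sqr_ge0 M) ((L * M) ^+ 2) (sqr_ge0 (L * M)) => m2 m20 lm lm0.
by rewrite !addr_ge0// !mulr_ge0 ?addr_ge0 ?invr_ge0// mulr_ge0.
Qed.

Section BatchError.
Variables (R : realType) (d : nat) (V : 'rV[R]_d -> R) (K : 'rV[R]_d -> 'rV[R]_d).
Variables (r L M : R).
Hypothesis hV : potential_assumption V r.
Hypothesis L0 : 0 <= L.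
Hypothesis KL : forall x y, enorm (K x - K y) <= L * enorm (x - y).
Hypothesis KM : forall x, enorm (K x) <= M.
Hypothesis cK : continuous K.
Variables (n p : nat) (tau sigma : R).
Hypothesis n_gt0 : (0 < n)%N.
Hypothesis p_gt1 : (1 < p)%N.
Hypothesis tau_gt0 : 0 < tau.
Variables (disp : measure_display) (T : measurableType disp) (P : probability T R).
Variable nu : probability 'rV[R]_d R.
Local Notation N := (n * p)%N.
Variables (X0 : 'I_N -> {RV P >-> 'rV[R]_d}) (B : 'I_N -> R -> {RV P >-> 'rV[R]_d}).
Variable xi : nat -> T -> {set {set 'I_N}}.
Variables X Y : 'I_N -> R -> {RV P >-> 'rV[R]_d}.
Hypothesis hdata : random_data nu X0 B xi.
Variable W : set T.
Hypothesis mW : measurable W.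
Hypothesis PW : P W = 1%E.
Hypothesis W_division : forall w m, W w -> is_division (xi m w).
Hypothesis B_cont : forall w i, W w -> {within `[0, +oo[, continuous (fun t : R => B i t w)}.
Hypothesis X_cont : forall w i, W w -> {within `[0, +oo[, continuous (fun t : R => X i t w)}.
Hypothesis Y_cont : forall w i, W w -> {within `[0, +oo[, continuous (fun t : R => Y i t w)}.
Hypothesis X_init : forall w i, W w -> X i 0 w = X0 i w.
Hypothesis Y_init : forall w i, W w -> Y i 0 w = X0 i w.
Hypothesis X_sde : forall w i, W w -> solves_sde sigma 0 `[0, +oo[
  (fun s => ips_drift V K (fun j => X j s w) i) (fun t => X i t w) (fun t => B i t w).
Hypothesis Y_sde : forall w i m, W w ->
  solves_sde sigma (m%:R * tau) `[m%:R * tau, m.+1%:R * tau[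
  (fun s => rbm_drift V K (xi m w) (fun j => Y j s w) i) (fun t => Y i t w) (fun t => B i t w).

Local Notation S m := (g_sigma_algebraType (past X0 B xi W m)).
Local Notation adapted m f := (@measurable_fun _ _ (S m) _ W f).
Local Notation E f := (mean P W f).
Local Notation tm m := (m%:R * tau).

Definition fullK i t w := \sum_j full_weight R i j *: K (X i t w - X j t w).
Definition batchK m i t w := \sum_j batch_weight R (xi m w) i j *: K (Y i t w - Y j t w).
Definition err i t w := Y i t w - X i t w.

Let p_gt0 : (0 < p)%N. Proof. exact: ltnW. Qed.

Let tm_ge0 m : 0 <= tm m. Proof. by rewrite mulr_ge0// ltW. Qed.

Let tm_le m : tm m <= tm m.+1. Proof. by rewrite ler_wpM2r ?ler_nat// ltW. Qed.

Let tmS m : tm m.+1 = tm m + tau.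
Proof. by rewrite -natr1 mulrDl mul1r. Qed.

Let M0 : 0 <= M. Proof. exact: le_trans (enorm_ge0 _) (KM 0). Qed.

Lemma X_increments w i t1 : W w -> uniform_increments sigma 0 t1
  (fun s => - grad V (X i s w) + fullK i s w) (fun s => X i s w) (fun s => B i s w).
Proof.
move=> Ww; apply: (sde_uniform_increments hV cK (x := fun i s => X i s w)
    (beta := fun i s => B i s w)) => //.
- by move=> j; exact: X_cont.
- by move=> j; exact: B_cont.
have := X_sde i Ww.
rewrite (_ : (fun s => ips_drift V K _ i) =
  (fun s => - grad V (X i s w) + \sum_j full_weight R i j *: K (X i s w - X j s w))).
  by move=> h t; rewrite /= in_itv/= => /andP[t0 _]; apply: h; rewrite /= in_itv/= t0.
by apply/funext => s; rewrite ips_driftE.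
Qed.

Lemma Y_increments w i m : W w -> uniform_increments sigma (tm m) (tm m.+1)
  (fun s => - grad V (Y i s w) + batchK m i s w) (fun s => Y i s w) (fun s => B i s w).
Proof.
move=> Ww; apply: (sde_uniform_increments hV cK (x := fun i s => Y i s w)
    (beta := fun i s => B i s w)) => //.
- by move=> j; exact: Y_cont.
- by move=> j; exact: B_cont.
have := Y_sde (m := m) i Ww.
rewrite (_ : (fun s => rbm_drift V K (xi m w) _ i) =
  (fun s => - grad V (Y i s w) + \sum_j batch_weight R (xi m w) i j *: K (Y i s w - Y j s w)))//.
by apply/funext => s; rewrite rbm_driftE.
Qed.

(** For each sample point the solution is the limit of Euler schemes built from the weights, the
    noise and the value at [t0], all of them measurable for [past m]. The weights may be random, as
    they are for the batches of an earlier step. *)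
Lemma adapted_solution m (x : 'I_N -> R -> T -> 'rV[R]_d) (kap : T -> 'I_N -> 'I_N -> R)
    (t0 t1 t : R) :
  0 <= t0 -> t0 <= t <= t1 ->
  (forall i j, adapted m (fun w => kap w i j)) ->
  (forall w i j, W w -> 0 <= kap w i j) ->
  (forall w i, W w -> \sum_j kap w i j <= 1) ->
  (forall w i, W w -> {within `[0, +oo[, continuous (fun s => x i s w)}) ->
  (forall w i, W w -> uniform_increments sigma t0 t1
     (fun s => - grad V (x i s w) + \sum_j kap w i j *: K (x i s w - x j s w))
     (fun s => x i s w) (fun s => B i s w)) ->
  (forall i, adapted m (x i t0)) -> forall i, adapted m (x i t).
Proof.
move=> t00 ttt mkap kap0 kap1 xc xinc mx0 i.
apply: (@measurable_rV_cvg _ _ _ (S m) W (fun n w => euler V ((t - t0) / n%:R)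
   (fun _ u i => \sum_j kap w i j *: K (u i - u j))
   (fun k i => sigma *: (B i (grid t0 t n k.+1) w - B i (grid t0 t n k) w))
   (fun i => x i t0 w) n i)).
  move=> k; apply: measurable_euler => //.
  - exact: (grad_continuous hV).
  - move=> _ u mu i'; apply: measurable_sumv => j; apply: measurable_scalev => //.
    by apply: measurable_continuousv => //; exact: measurable_subv.
  - move=> k' i'; apply: measurable_scalev; first exact: measurable_cst.
    have grid_ge0 q : 0 <= grid t0 t k q.
      by rewrite addr_ge0// mulr_ge0// divr_ge0// subr_ge0; case/andP: ttt.
    by apply: measurable_subv; apply: past_noise.
move=> w j Ww.
have [rho hrho] := path_bounded t1 (fun i => xc w i Ww).
have := @euler_interacting_cvg R d V r hV 'I_N (kap w) K L sigma t0 t1 rho t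
  (fun i s => x i s w) (fun i s => B i s w) i j L0 KL; apply => //.
- by move=> *; exact: kap0.
- by move=> *; exact: kap1.
- by move=> i'; exact: xinc.
- by move=> i' s /andP[s0 s1]; apply: hrho; rewrite (le_trans t00)// s1.
Qed.

Lemma adapted_X m i t : 0 <= t -> adapted m (X i t).
Proof.
move=> t0.
apply: (@adapted_solution m X (fun _ => full_weight R) 0 t t); rewrite ?lexx ?t0//.
- by move=> *; exact: full_weight_ge0.
- by move=> w i' _; rewrite sum_full_weight.
- by move=> w i' Ww; exact: X_increments.
- move=> i'; apply: (@eq_measurable_fun _ _ (S m) _ W (X0 i')).
    by move=> w; rewrite inE => Ww; rewrite X_init.
  exact: past_initial.
Qed.

(** Step [m'] involves [xi m'] alone, which belongs to [past m] for [m' < m]. The bound [m' <= m]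
    includes the start of step [m], where [xi m] has not acted yet. *)
Lemma adapted_Y m m' i : (m' <= m)%N -> adapted m (Y i (tm m')).
Proof.
elim: m' i => [|m' IH] i mm.
  rewrite mul0r; apply: (@eq_measurable_fun _ _ (S m) _ W (X0 i)).
    by move=> w; rewrite inE => Ww; rewrite Y_init.
  exact: past_initial.
apply: (@adapted_solution m Y (fun w => batch_weight R (xi m' w)) (tm m') (tm m'.+1)) => //.
- by rewrite tm_le lexx.
- move=> i' j.
  apply: (@past_division _ _ _ _ _ _ _ X0 B xi W m m' _ _ (fun D => batch_weight R D i' j)).
  by rewrite neq_ltn mm.
- by move=> *; exact: batch_weight_ge0.
- by move=> w i' Ww; rewrite sum_batch_weight//; exact: W_division.
- by move=> w i' Ww; exact: Y_increments.
- by move=> i'; apply: IH; exact: ltnW.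
Qed.

Lemma weighted_K_le (kap : 'I_N -> R) (x : 'I_N -> 'rV[R]_d) :
  (forall j, 0 <= kap j) -> \sum_j kap j = 1 -> enorm (\sum_j kap j *: K (x j)) <= M.
Proof.
move=> k0 k1; rewrite (le_trans (enorm_sum _ _ _))//.
rewrite -[leRHS]mul1r -k1 mulr_suml; apply: ler_sum => j _.
by rewrite enormZ ger0_norm// ler_wpM2l.
Qed.

Lemma drift_gap_le m i s w : W w -> enorm (batchK m i s w - fullK i s w) <= 2 * M.
Proof.
move=> Ww; rewrite (le_trans (enormB _ _))// mulr_natl mulr2n lerD//.
  apply: weighted_K_le => [j|]; first exact: batch_weight_ge0.
  by rewrite sum_batch_weight//; exact: W_division.
apply: weighted_K_le => [j|]; first exact: full_weight_ge0.
exact: sum_full_weight.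
Qed.

Lemma paths_bounded w t1 : W w -> exists rho : R, forall i s, 0 <= s <= t1 ->
  enorm (X i s w) <= rho /\ enorm (Y i s w) <= rho.
Proof.
move=> Ww.
have [a ha] := path_bounded t1 (fun i => @X_cont w i Ww).
have [b hb] := path_bounded t1 (fun i => @Y_cont w i Ww).
exists (Num.max a b) => i s hs.
by rewrite !le_max ha//= hb// orbT.
Qed.

Lemma err_growth m i w s s' : W w -> tm m <= s -> s <= s' -> s' <= tm m.+1 ->
  enorm (err i s' w) <= enorm (err i s w) + 2 * M * (s' - s).
Proof.
move=> Ww ms ss' sm'.
have s0 : 0 <= s by exact: le_trans ms.
have [rho hrho] := paths_bounded (tm m.+1) Ww.
have in0 u : s <= u <= tm m.+1 -> 0 <= u <= tm m.+1.
  by move=> /andP[su ->]; rewrite (le_trans s0 su).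
apply: (coupled_distance hV (sigma := sigma) (t1 := tm m.+1) (rho := rho)
  (x := fun s => X i s w) (y := fun s => Y i s w) (beta := fun s => B i s w)
  (fx := fun s => fullK i s w) (fy := fun s => batchK m i s w)); last by rewrite ss'.
- by apply: (uniform_increments_sub s0 (lexx _)); exact: X_increments.
- by apply: (uniform_increments_sub ms (lexx _)); exact: Y_increments.
- by move=> u hu; exact: (hrho i u (in0 u hu)).2.
- by move=> u _; exact: drift_gap_le.
Qed.

(** This bound grows with time. Its purpose is to make the error variables bounded, hence integrable
    and fit for dominated convergence. *)
Lemma err_le m i w s : W w -> tm m <= s <= tm m.+1 -> enorm (err i s w) <= 2 * M * s.
Proof.
move=> Ww; elim: m s => [|m IH] s /andP[ms sm].
  rewrite mul0r in ms; have := @err_growth 0 i w 0 s Ww.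
  by rewrite mul0r lexx {2}/err X_init// Y_init// subrr enorm0 add0r subr0; apply.
have := @err_growth m.+1 i w (tm m.+1) s Ww (lexx _) ms sm.
have := IH (tm m.+1); rewrite lexx tm_le => /(_ isT) h1 h2.
by rewrite (le_trans h2)// mulrBr -lerBrDr opprB addrCA subrr addr0.
Qed.

Lemma exists_step t : 0 <= t -> exists m, tm m <= t <= tm m.+1.
Proof.
move=> t0; exists (Num.truncn (t / tau)).
have /andP[h1 h2] : ((Num.truncn (t / tau))%:R <= t / tau < (Num.truncn (t / tau)).+1%:R).
  by apply: truncn_itv; rewrite divr_ge0// ltW.
by rewrite -ler_pdivlMr// h1 -ler_pdivrMr// ltW.
Qed.

Let mX i t : measurable_fun W (X i t : T -> 'rV[R]_d).
Proof. by apply: measurable_funTS; exact: measurable_funPT. Qed.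

Let mY i t : measurable_fun W (Y i t : T -> 'rV[R]_d).
Proof. by apply: measurable_funTS; exact: measurable_funPT. Qed.

Lemma bounded_err i t : 0 <= t -> bounded_vec W (err i t).
Proof.
move=> /exists_step[m hm]; split; first exact: measurable_subv.
by exists (2 * M * t) => w Ww; exact: err_le hm.
Qed.

Lemma bounded_KX i j t : bounded_vec W (fun w => K (X i t w - X j t w)).
Proof.
split; last by exists M => w _.
by apply: measurable_continuousv => //; exact: measurable_subv.
Qed.

Lemma bounded_KY i j t : bounded_vec W (fun w => K (Y i t w - Y j t w)).
Proof.
split; last by exists M => w _.
by apply: measurable_continuousv => //; exact: measurable_subv.
Qed.

Lemma bounded_batch_weight m i j : bounded_rv W (fun w => batch_weight R (xi m w) i j).
Proof.
split.
  exact: (@measurable_of_division _ _ _ _ _ _ _ _ X0 B xi hdata W mW m _ _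
    (fun D => batch_weight R D i j)).
exists (p.-1%:R)^-1 => w _; rewrite ger0_norm ?batch_weight_ge0//.
by rewrite ler_piMl ?invr_ge0// lern1 leq_b1.
Qed.

Definition gap m i t w := batchK m i t w - fullK i t w.

Definition chi m i t w :=
  \sum_j (batch_weight R (xi m w) i j - full_weight R i j) *: K (X i t w - X j t w).

Lemma bounded_gap m i t : bounded_vec W (gap m i t).
Proof.
apply: bounded_vecB; apply: bounded_vec_sum => j; apply: bounded_vecZ.
- exact: bounded_batch_weight.
- exact: bounded_KY.
- exact: bounded_rv_cst.
- exact: bounded_KX.
Qed.

Lemma bounded_chi m i t : bounded_vec W (chi m i t).
Proof.
apply: bounded_vec_sum => j; apply: bounded_vecZ; last exact: bounded_KX.
by apply: bounded_rvB; [exact: bounded_batch_weight|exact: bounded_rv_cst].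
Qed.

Lemma chi_le m i t w : W w -> enorm (chi m i t w) <= 2 * M.
Proof.
move=> Ww; rewrite /chi.
under eq_bigr do rewrite scalerBl.
rewrite sumrB (le_trans (enormB _ _))// mulr_natl mulr2n lerD//.
  apply: weighted_K_le => [j|]; first exact: batch_weight_ge0.
  by rewrite sum_batch_weight//; exact: W_division.
apply: weighted_K_le => [j|]; first exact: full_weight_ge0.
exact: sum_full_weight.
Qed.

Lemma gap_chi_le m i t w : W w ->
  enorm (gap m i t w - chi m i t w)
  <= L * (enorm (err i t w) + \sum_j batch_weight R (xi m w) i j * enorm (err j t w)).
Proof.
move=> Ww.
have -> : gap m i t w - chi m i t w = \sum_j batch_weight R (xi m w) i j *:
    (K (Y i t w - Y j t w) - K (X i t w - X j t w)).
  rewrite /gap /batchK /fullK /chi -!sumrB; apply: eq_bigr => j _.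
  by apply/rowP => c; rewrite !mxE; ring.
have -> : enorm (err i t w) = \sum_j batch_weight R (xi m w) i j * enorm (err i t w).
  by rewrite -mulr_suml sum_batch_weight ?mul1r//; exact: W_division.
rewrite -big_split mulr_sumr (le_trans (enorm_sum _ _ _))//.
apply: ler_sum => j _; rewrite enormZ ger0_norm ?batch_weight_ge0//= -mulrDr mulrCA.
rewrite ler_wpM2l ?batch_weight_ge0// (le_trans (KL _ _))// ler_wpM2l//.
rewrite (_ : _ - _ - _ = err i t w - err j t w) ?enormB//.
by apply/rowP => c; rewrite !mxE; ring.
Qed.

Lemma adapted_KX m i j t : 0 <= t -> adapted m (fun w => K (X i t w - X j t w)).
Proof.
move=> t0; apply: measurable_continuousv => //.
by apply: measurable_subv; exact: adapted_X.
Qed.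

(* [X] does not depend on the divisions, and [chi] averages to zero over the
   division of step [m]: no moment of [X] is needed. *)
Lemma chi_orthogonal m i t (A : T -> 'rV[R]_d) (c : R) : 0 <= t -> adapted m A ->
  (forall w, W w -> enorm (A w) <= c) -> E (fun w => dotv (A w) (chi m i t w)) = 0.
Proof.
move=> t0 mA Ac.
have bA : bounded_vec W A by split; [exact: (adapted_measurable hdata mW mA)|exists c].
transitivity (E (fun w => \sum_j dotv (A w) (K (X i t w - X j t w)) *
    (batch_weight R (xi m w) i j - full_weight R i j))).
  by apply: eq_mean => w _; rewrite dotv_sumr; apply: eq_bigr => j _; rewrite dotvZr mulrC.
have bAK j : bounded_rv W (fun w => dotv (A w) (K (X i t w - X j t w))).
  by apply: bounded_rv_dotv => //; exact: bounded_KX.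
have bD j : bounded_rv W (fun w => batch_weight R (xi m w) i j - full_weight R i j).
  by apply: bounded_rvB; [exact: bounded_batch_weight|exact: bounded_rv_cst].
rewrite mean_sum//; last by move=> j; exact: (bounded_rvM (bAK j) (bD j)).
rewrite big1// => j _.
rewrite (mean_division hdata mW PW W_division (m := m)
  (f := fun w => dotv (A w) (K (X i t w - X j t w)))
  (fun D => batch_weight R D i j - full_weight R i j)).
- by rewrite division_meanB mean_batch_weight// division_mean_cst// subrr mulr0.
- by apply: measurable_dotv => //; exact: adapted_KX.
- exact: (bAK j).2.
Qed.

(** In the expanded square the inner products of kernels are adapted and at most [M ^+ 2] in
    absolute value; averaging over the division leaves the covariances of the weights, whose
    absolute values have total at most [2 / (p - 1)]. *)
Lemma mean_chi_sqr m i t : 0 <= t ->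
  E (fun w => enorm (chi m i t w) ^+ 2) <= 2 * M ^+ 2 / p.-1%:R.
Proof.
move=> t0.
pose k j w := K (X i t w - X j t w).
pose b j (D : {set {set 'I_N}}) := batch_weight R D i j - full_weight R i j.
have bk j j' : bounded_rv W (fun w => dotv (k j w) (k j' w)).
  by apply: bounded_rv_dotv; exact: bounded_KX.
have bb j : bounded_rv W (fun w => b j (xi m w)).
  by apply: bounded_rvB; [exact: bounded_batch_weight|exact: bounded_rv_cst].
have -> : E (fun w => enorm (chi m i t w) ^+ 2) =
    E (fun w => \sum_j \sum_j' dotv (k j w) (k j' w) * (b j (xi m w) * b j' (xi m w))).
  apply: eq_mean => w _; rewrite -dotvv /chi dotv_suml; apply: eq_bigr => j _.
  rewrite dotv_sumr; apply: eq_bigr => j' _; rewrite dotvZl dotvZr /b /k.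
  by rewrite mulrA mulrC.
rewrite mean_sum//; last first.
  by move=> j; apply: bounded_rv_sum => j'; apply: bounded_rvM => //; exact: bounded_rvM.
apply: (@le_trans _ _ (\sum_j \sum_j' M ^+ 2 * `|batch_cov R i j j'|)).
  apply: ler_sum => j _; rewrite mean_sum//; last first.
    by move=> j'; apply: bounded_rvM => //; exact: bounded_rvM.
  apply: ler_sum => j' _.
  rewrite (mean_division hdata mW PW W_division (m := m)
    (f := fun w => dotv (k j w) (k j' w)) (fun D => b j D * b j' D)).
  - rewrite (le_trans (ler_norm _))// normrM ler_wpM2r//.
    apply: norm_mean_le => // w Ww.
    rewrite (le_trans (dotv_norm_le _ _))// expr2.
    by apply: ler_pM; rewrite ?enorm_ge0//; exact: KM.
  - by apply: measurable_dotv; exact: adapted_KX.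
  - exact: (bk j j').2.
have -> : \sum_j \sum_j' M ^+ 2 * `|batch_cov R i j j'| =
    M ^+ 2 * \sum_j \sum_j' `|batch_cov R i j j'|.
  by rewrite mulr_sumr; apply: eq_bigr => j _; rewrite mulr_sumr.
have -> : 2 * M ^+ 2 / p.-1%:R = M ^+ 2 * (2 / p.-1%:R) by ring.
rewrite ler_wpM2l ?sqr_ge0//; exact: sum2_norm_batch_cov.
Qed.

(** * Estimates within one step *)

Section OneStep.
Variables (m : nat) (eps S0 : R).
Hypothesis eps_gt0 : 0 < eps.
Hypothesis start_le : forall j, E (fun w => enorm (err j (tm m) w) ^+ 2) <= S0.

(** [Q] comes from [(a + b) ^+ 2 <= (1 + eps) * a ^+ 2 + (1 + eps^-1) * b ^+ 2], with [a] the error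
    at the start of the step and [b = 2 * M * tau] a bound on its displacement. *)
Local Notation Q := ((1 + eps) * S0 + (1 + eps^-1) * (2 * M * tau) ^+ 2).

Let young (a b : R) : 2 * (a * b) <= eps * a ^+ 2 + eps^-1 * b ^+ 2.
Proof.
have h : 0 <= eps^-1 * (eps * a - b) ^+ 2 by rewrite mulr_ge0 ?sqr_ge0// invr_ge0 ltW.
rewrite -subr_ge0 (_ : _ - _ = eps^-1 * (eps * a - b) ^+ 2)//.
by field; rewrite gt_eqF.
Qed.

Let in_step_ge0 s : tm m <= s <= tm m.+1 -> 0 <= s.
Proof. by move=> /andP[ms _]; exact: le_trans ms. Qed.

Let err_sqr_step j s w : W w -> tm m <= s <= tm m.+1 ->
  enorm (err j s w) ^+ 2
  <= (1 + eps) * enorm (err j (tm m) w) ^+ 2 + (1 + eps^-1) * (2 * M * tau) ^+ 2.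
Proof.
move=> Ww /andP[ms sm].
have h := err_growth j Ww (lexx _) ms sm.
have hs : 2 * M * (s - tm m) <= 2 * M * tau.
  by rewrite ler_wpM2l ?mulr_ge0// lerBlDl -tmS.
have {}h := le_trans h (lerD (lexx _) hs).
have b0 : 0 <= 2 * M * tau by rewrite !mulr_ge0// ltW.
apply: (@le_trans _ _ ((enorm (err j (tm m) w) + 2 * M * tau) ^+ 2)).
  by rewrite lerXn2r ?nnegrE ?enorm_ge0// addr_ge0 ?enorm_ge0.
have := young (enorm (err j (tm m) w)) (2 * M * tau).
by move: (enorm _) (2 * M * tau) => a b hab; lra.
Qed.

Let bounded_err_sqr j s : tm m <= s <= tm m.+1 ->
  bounded_rv W (fun w => enorm (err j s w) ^+ 2).
Proof.
by move=> hs; apply/bounded_rv_sqr/bounded_rv_enorm/bounded_err; exact: in_step_ge0 hs.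
Qed.

Let tm_in : tm m <= tm m <= tm m.+1. Proof. by rewrite lexx tm_le. Qed.

Lemma mean_err_sqr_step j s : tm m <= s <= tm m.+1 ->
  E (fun w => enorm (err j s w) ^+ 2) <= Q.
Proof.
move=> hs.
have b1 := bounded_rvZ (1 + eps) (bounded_err_sqr j tm_in).
have b2 := @bounded_rv_cst R _ T W ((1 + eps^-1) * (2 * M * tau) ^+ 2).
apply: (@le_trans _ _ (E (fun w => (1 + eps) * enorm (err j (tm m) w) ^+ 2
    + (1 + eps^-1) * (2 * M * tau) ^+ 2))).
  apply: le_mean => //; [exact: bounded_err_sqr|exact: bounded_rvD|].
  by move=> w Ww; exact: err_sqr_step.
rewrite meanD// mean_cst// meanZ//; last exact: bounded_err_sqr.
by rewrite lerD2r ler_wpM2l// addr_ge0// ltW.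
Qed.

Let bounded_batch_err_sqr i s : tm m <= s <= tm m.+1 -> bounded_rv W
  (fun w => \sum_j batch_weight R (xi m w) i j * enorm (err j s w) ^+ 2).
Proof.
move=> hs; apply: bounded_rv_sum => j.
by apply: bounded_rvM; [exact: bounded_batch_weight|exact: bounded_err_sqr].
Qed.

(** At time [s] the errors depend on the batches and the mean does not factor. Going back to the
    start of the step restores independence; the weights then average to the full weights, and
    [start_le] is used for every particle. *)
Lemma mean_batch_err_sqr_step i s : tm m <= s <= tm m.+1 ->
  E (fun w => \sum_j batch_weight R (xi m w) i j * enorm (err j s w) ^+ 2) <= Q.
Proof.
move=> hs.
have b1 := bounded_rvZ (1 + eps) (bounded_batch_err_sqr i tm_in).
have b2 := @bounded_rv_cst R _ T W ((1 + eps^-1) * (2 * M * tau) ^+ 2).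
apply: (@le_trans _ _ (E (fun w => (1 + eps) *
    (\sum_j batch_weight R (xi m w) i j * enorm (err j (tm m) w) ^+ 2)
    + (1 + eps^-1) * (2 * M * tau) ^+ 2))).
  apply: le_mean => //; [exact: bounded_batch_err_sqr|exact: bounded_rvD|].
  move=> w Ww.
  have sbw := sum_batch_weight R p_gt1 i (W_division m Ww).
  have bwC c : \sum_j batch_weight R (xi m w) i j * c = c by rewrite -mulr_suml sbw mul1r.
  rewrite -[X in _ <= _ + X]bwC mulr_sumr -big_split/=.
  apply: ler_sum => j _.
  have := ler_wpM2l (batch_weight_ge0 R (xi m w) i j) (err_sqr_step j Ww hs).
  by move=> /le_trans; apply; rewrite le_eqVlt; apply/orP; left; apply/eqP; ring.
rewrite meanD// mean_cst// meanZ//; last exact: bounded_batch_err_sqr.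
rewrite lerD2r ler_wpM2l ?addr_ge0 ?(ltW eps_gt0)//.
rewrite mean_sum//; last first.
  by move=> j; apply: bounded_rvM; [exact: bounded_batch_weight|exact: bounded_err_sqr].
have fwC : \sum_j full_weight R i j * S0 = S0.
  by rewrite -mulr_suml sum_full_weight// mul1r.
rewrite -[leRHS]fwC.
apply: ler_sum => j _.
have bj := bounded_err_sqr j tm_in.
have mj : adapted m (fun w => enorm (err j (tm m) w) ^+ 2).
  under eq_fun do rewrite -dotvv.
  by apply: measurable_dotv; apply: measurable_subv; [exact: adapted_Y|exact: adapted_X
    |exact: adapted_Y|exact: adapted_X].
have -> : E (fun w => batch_weight R (xi m w) i j * enorm (err j (tm m) w) ^+ 2) =
    E (fun w => enorm (err j (tm m) w) ^+ 2 * batch_weight R (xi m w) i j).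
  by apply: eq_mean => w _; rewrite mulrC.
rewrite (mean_division hdata mW PW W_division (m := m) (fun D => batch_weight R D i j) mj bj.2).
by rewrite mean_batch_weight// mulrC ler_wpM2l ?full_weight_ge0.
Qed.

(** [Q'] is the cost of the correlation that the division of the step creates between the error and
    [chi] during a time [tau]. *)
Local Notation Q' := (2 * eps * Q + 2 * M ^+ 2 * (tau / p.-1%:R)
  + 2 * eps^-1 * (L * M * tau) ^+ 2).

(** [gap] is split into [chi] and two Lipschitz terms. The product of the two values of [chi] is
    left to their second moments; in the other products [chi] is bounded by [2 * M], and Young's
    inequality leaves one [eps^-1 * (L * M * tau) ^+ 2] for each. *)
Lemma gap_chi_product i s s' w : W w ->
  tau * (enorm (gap m i s' w) * enorm (chi m i s w)) <=
  tau / 2 * (enorm (chi m i s' w) ^+ 2 + enorm (chi m i s w) ^+ 2)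
  + eps * enorm (err i s' w) ^+ 2
  + eps * (\sum_j batch_weight R (xi m w) i j * enorm (err j s' w) ^+ 2)
  + 2 * eps^-1 * (L * M * tau) ^+ 2.
Proof.
move=> Ww.
set c := enorm (chi m i s w); set c' := enorm (chi m i s' w).
have c0 : 0 <= c by exact: enorm_ge0.
have cM : c <= 2 * M by exact: chi_le.
have tau0 := ltW tau_gt0.
have ltm0 : 0 <= L * M * tau by rewrite !mulr_ge0.
have ltc : L * tau * c <= 2 * (L * M * tau).
  have -> : 2 * (L * M * tau) = L * tau * (2 * M) by ring.
  by rewrite ler_wpM2l// mulr_ge0.
have key (z : R) : 0 <= z -> tau * (L * z) * c <= eps * z ^+ 2 + eps^-1 * (L * M * tau) ^+ 2.
  move=> z0; apply: le_trans (young z (L * M * tau)).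
  have -> : tau * (L * z) * c = z * (L * tau * c) by ring.
  by rewrite [leRHS]mulrCA ler_wpM2l.
have g_le : enorm (gap m i s' w) <= c' + L * enorm (err i s' w)
    + L * \sum_j batch_weight R (xi m w) i j * enorm (err j s' w).
  have -> : gap m i s' w = chi m i s' w + (gap m i s' w - chi m i s' w).
    by rewrite addrC subrK.
  apply: (le_trans (enormD _ _)); rewrite -[leRHS]addrA -mulrDr.
  by apply: lerD; [exact: lexx|exact: gap_chi_le].
have h1 : tau * (enorm (gap m i s' w) * c) <= tau * ((c' + L * enorm (err i s' w)
    + L * \sum_j batch_weight R (xi m w) i j * enorm (err j s' w)) * c).
  by rewrite ler_wpM2l// ler_wpM2r.
apply: (le_trans h1).
have h2 : tau * (c' * c) <= tau / 2 * (c' ^+ 2 + c ^+ 2).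
  rewrite -subr_ge0 (_ : _ - _ = tau / 2 * (c' - c) ^+ 2); last by field.
  by rewrite mulr_ge0 ?sqr_ge0// divr_ge0.
have h3 := key _ (enorm_ge0 (err i s' w)).
have h4 : tau * (L * \sum_j batch_weight R (xi m w) i j * enorm (err j s' w)) * c
    <= eps * (\sum_j batch_weight R (xi m w) i j * enorm (err j s' w) ^+ 2)
     + eps^-1 * (L * M * tau) ^+ 2.
  have sbw := sum_batch_weight R p_gt1 i (W_division m Ww).
  have bwC a : \sum_j batch_weight R (xi m w) i j * a = a by rewrite -mulr_suml sbw mul1r.
  rewrite -[X in _ <= _ + X]bwC !mulr_sumr mulr_suml -big_split/=.
  apply: ler_sum => j _.
  set b := batch_weight R (xi m w) i j; set z := enorm (err j s' w).
  have kj := ler_wpM2l (batch_weight_ge0 R (xi m w) i j : 0 <= b) (key z (enorm_ge0 _)).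
  have -> : tau * (L * (b * z)) * c = b * (tau * (L * z) * c) by ring.
  by apply: (le_trans kj); rewrite mulrDr [b * (eps * _)]mulrCA.
move: h2 h3 h4.
rewrite mulrDl mulrDl !mulrDr.
move: (tau * (c' * c)) => a1.
rewrite [tau * (L * enorm (err i s' w) * c)]mulrA.
rewrite [tau * (L * _ * c)]mulrA.
by lra.
Qed.

Lemma mean_gap_chi i s s' : tm m <= s <= tm m.+1 -> tm m <= s' <= tm m.+1 ->
  tau * E (fun w => enorm (gap m i s' w) * enorm (chi m i s w)) <= Q'.
Proof.
move=> hs hs'.
have b1 : bounded_rv W (fun w => enorm (gap m i s' w) * enorm (chi m i s w)).
  by apply: bounded_rvM; apply: bounded_rv_enorm; [exact: bounded_gap|exact: bounded_chi].
have bc t : bounded_rv W (fun w => enorm (chi m i t w) ^+ 2).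
  by apply/bounded_rv_sqr/bounded_rv_enorm/bounded_chi.
have be := bounded_err_sqr i hs'.
have bb := bounded_batch_err_sqr i hs'.
rewrite -meanZ//.
have bR1 := bounded_rvD (bc s') (bc s).
have bR2 := bounded_rvZ (tau / 2) bR1.
have bR3 := bounded_rvZ eps be.
have bR4 := bounded_rvZ eps bb.
have bR5 := @bounded_rv_cst R _ T W (2 * eps^-1 * (L * M * tau) ^+ 2).
apply: le_trans.
  apply: (le_mean P mW (bounded_rvZ tau b1)
    (bounded_rvD (bounded_rvD (bounded_rvD bR2 bR3) bR4) bR5)).
  by move=> w Ww; exact: gap_chi_product.
rewrite (meanD P mW (bounded_rvD (bounded_rvD bR2 bR3) bR4) bR5).
rewrite (meanD P mW (bounded_rvD bR2 bR3) bR4) (meanD P mW bR2 bR3).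
rewrite mean_cst// !meanZ// (meanD P mW (bc s') (bc s)).
rewrite lerD2r.
have h1 := mean_chi_sqr m i (in_step_ge0 hs'); have h2 := mean_chi_sqr m i (in_step_ge0 hs).
have h3 := mean_err_sqr_step i hs'; have h4 := mean_batch_err_sqr_step i hs'.
have h5 := ler_wpM2l (ltW eps_gt0) h3; have h6 := ler_wpM2l (ltW eps_gt0) h4.
have t2 : 0 <= tau / 2 by rewrite divr_ge0// ltW.
have h7 := ler_wpM2l t2 (lerD h1 h2).
apply: (le_trans (lerD (lerD h7 h5) h6)).
rewrite le_eqVlt; apply/orP; left; apply/eqP; field.
by rewrite pnatr_eq0 -lt0n -subn1 subn_gt0 p_gt1 gt_eqF.
Qed.

(* Comparing [Y] with the scheme driven by the full interaction evaluated
   along [X], which does not see the division of step [m]. *)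
Lemma mean_err_chi i s : tm m <= s <= tm m.+1 ->
  E (fun w => dotv (err i s w) (chi m i s w)) <= Q'.
Proof.
move=> hs; have /andP[ms sm] := hs.
have s0 := in_step_ge0 hs.
pose h k := (s - tm m) / k%:R.
have h_ge0 k : 0 <= h k by rewrite divr_ge0// subr_ge0.
have grid_in k q : (q <= k)%N -> tm m <= grid (tm m) s k q <= tm m.+1.
  move=> qk; have /andP[g1 g2] : tm m <= grid (tm m) s k q <= s.
    by apply: (@grid_itv R (tm m) s s) => //; rewrite ms lexx.
  by rewrite g1 (le_trans g2).
pose u k w := euler V (h k) (fun q _ (_ : unit) => fullK i (grid (tm m) s k q) w)
  (fun q _ => sigma *: (B i (grid (tm m) s k q.+1) w - B i (grid (tm m) s k q) w))
  (fun=> Y i (tm m) w) k tt.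
have mu k : adapted m (u k).
  apply: (@measurable_euler R d _ (S m) W V unit (h k)
    (fun w q _ _ => fullK i (grid (tm m) s k q) w)
    (fun w q _ => sigma *: (B i (grid (tm m) s k q.+1) w - B i (grid (tm m) s k q) w))
    (fun w _ => Y i (tm m) w)).
  - exact: (grad_continuous hV).
  - move=> q _ _ _; apply: measurable_sumv => j; apply: measurable_scalev => //.
    apply: adapted_KX; rewrite addr_ge0// mulr_ge0//; exact: h_ge0.
  - have grid_ge0 q : 0 <= grid (tm m) s k q by rewrite addr_ge0// mulr_ge0//; exact: h_ge0.
    move=> q _; apply: measurable_scalev => //.
    by apply: measurable_subv; apply: past_noise.
  - by move=> _; exact: adapted_Y.
pose c := 2 * M * s.
pose rho := c + 2 * M * (s - tm m) + 1.
pose A k w := u k w - X i s w.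
have mA k : adapted m (A k) by apply: measurable_subv => //; exact: adapted_X.
(* No deterministic bound is known for the Euler scheme. Truncating by an adapted indicator makes
   [A k] bounded and keeps it orthogonal to [chi]. *)
pose theta k w : R := (enorm (A k w) <= rho)%R%:R.
have mtheta k : adapted m (theta k).
  have mb : @measurable_fun _ _ (S m) _ W (fun w => enorm (A k w) <= rho).
    by apply: measurable_fun_ler => //; exact: measurable_enorm.
  by apply: (measurableT_comp (f := fun b : bool => b%:R : R)).
have rho0 : 0 <= rho by rewrite !addr_ge0 ?mulr_ge0// subr_ge0.
have mthA k : adapted m (fun w => theta k w *: A k w) by exact: measurable_scalev.
have thA_le k w : W w -> enorm (theta k w *: A k w) <= rho.
  move=> _; rewrite enormZ /theta normr_nat.
  by case: (leP (enorm (A k w)) rho) => [le|_]; rewrite /= ?mulr1n ?mulr0n ?mul1r ?mul0r.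
have bthA k : bounded_vec W (fun w => theta k w *: A k w).
  by split; [exact: (adapted_measurable hdata mW (mthA k))|exists rho; exact: thA_le].
have berr := bounded_err i s0.
have bchi := bounded_chi m i s.
have bec := bounded_rv_dotv berr bchi.
have btc k := bounded_rv_dotv (bthA k) bchi.
have bgc q : bounded_rv W (fun w => enorm (gap m i q w) * enorm (chi m i s w)).
  by apply: bounded_rvM; apply: bounded_rv_enorm; [exact: bounded_gap|exact: bounded_chi].
pose f k w := dotv (err i s w) (chi m i s w) - dotv (theta k w *: A k w) (chi m i s w)
  - h k * \sum_(q < k) enorm (gap m i (grid (tm m) s k q) w) * enorm (chi m i s w).
have bf k : bounded_rv W (f k).
  apply: bounded_rvB; first exact: bounded_rvB.
  by apply: bounded_rvZ; apply: bounded_rv_sum => q.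
have Q'0 : 0 <= Q'.
  have /= := mean_gap_chi i hs hs; apply: le_trans.
  by rewrite mulr_ge0 ?(ltW tau_gt0)// mean_ge0// => w _; rewrite mulr_ge0 ?enorm_ge0.
(* The middle term of [f k] has mean zero by orthogonality, and each of the [k] terms of the sum
   costs at most [Q' / k]. *)
have Ef k : (0 < k)%N -> E (fun w => dotv (err i s w) (chi m i s w)) - Q' <= E (f k).
  move=> k0; have k0' : 0 < k%:R :> R by rewrite ltr0n.
  rewrite /f meanB//; last 2 first.
  - exact: bounded_rvB.
  - by apply: bounded_rvZ; apply: bounded_rv_sum => q.
  rewrite meanB// (chi_orthogonal i s0 (mthA k) (thA_le k)) subr0.
  rewrite meanZ//; last by apply: bounded_rv_sum => q.
  rewrite lerD2l lerN2 mean_sum// mulr_sumr.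
  apply: (@le_trans _ _ (\sum_(q < k) Q' / k%:R)).
    apply: ler_sum => q _.
    have hk : h k <= tau / k%:R.
      by rewrite ler_pM2r ?invr_gt0// lerBlDl -tmS.
    have E0 : 0 <= E (fun w => enorm (gap m i (grid (tm m) s k q) w) * enorm (chi m i s w)).
      by apply: mean_ge0 => w _; rewrite mulr_ge0 ?enorm_ge0.
    rewrite (le_trans (ler_wpM2r E0 hk))// mulrAC ler_pM2r ?invr_gt0//.
    by apply: mean_gap_chi => //; apply: grid_in; exact: ltnW.
  by rewrite sumr_const card_ord -[_ *+ _]mulr_natr divfK// gt_eqF.
(* Comparison with the scheme bounds [f k] only from above in the limit, so convergence to 0 is
   claimed for its positive part. *)
pose fp k w := Num.max (f k w) 0.
have bd k w : W w -> `|fp k w| <= c * (2 * M) + rho * (2 * M).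
  move=> Ww.
  have C0 : 0 <= c * (2 * M) + rho * (2 * M).
    by rewrite addr_ge0// mulr_ge0// ?mulr_ge0.
  rewrite ger0_norm; last by rewrite le_max lexx orbT.
  rewrite ge_max C0 andbT /f.
  have sum0 : 0 <= h k * \sum_(q < k) enorm (gap m i (grid (tm m) s k q) w) * enorm (chi m i s w).
    by rewrite mulr_ge0 ?h_ge0// sumr_ge0// => q _; rewrite mulr_ge0 ?enorm_ge0.
  have h1 : dotv (err i s w) (chi m i s w) <= c * (2 * M).
    rewrite (le_trans (dotv_le _ _))//; apply: ler_pM; rewrite ?enorm_ge0//.
      exact: err_le hs.
    exact: chi_le.
  have h2 : - (rho * (2 * M)) <= dotv (theta k w *: A k w) (chi m i s w).
    rewrite lerNl -dotvNl (le_trans (dotv_le _ _))// enormN.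
    by apply: ler_pM; rewrite ?enorm_ge0//; [exact: thA_le|exact: chi_le].
  rewrite lerBlDr; apply: (@le_trans _ _ (c * (2 * M) + rho * (2 * M))); last by rewrite lerDl.
  by rewrite lerD// lerNl.
have cvg0 w : W w -> fp k w @[k --> \oo] --> 0.
  move=> Ww.
  have [rho' hrho'] := paths_bounded (tm m.+1) Ww.
  have FE (e : R) : 0 < e -> \forall k \near \oo, enorm (Y i s w - u k w)
      <= h k * (\sum_(q < k) enorm (gap m i (grid (tm m) s k q) w)) + e.
    move=> e0.
    apply: (frozen_euler hV (t1 := tm m.+1) (rho := rho') (G := 2 * M)
      (y := fun s => Y i s w) (beta := fun s => B i s w) (fy := fun s => batchK m i s w)
      (f := fun s => fullK i s w)) => //.
    - exact: Y_increments.
    - move=> v /andP[mv vm]; apply: (hrho' i v _).2.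
      by rewrite vm andbT; exact: le_trans mv.
    - by move=> v _; exact: drift_gap_le.
  have gap_sum k : (0 < k)%N -> h k * (\sum_(q < k) enorm (gap m i (grid (tm m) s k q) w))
      <= 2 * M * (s - tm m).
    move=> k0.
    have -> : 2 * M * (s - tm m) = h k * \sum_(q < k) (2 * M).
      rewrite sumr_const card_ord -[(2 * M) *+ k]mulr_natr [RHS]mulrCA /h.
      by rewrite divfK// pnatr_eq0 -lt0n.
    by rewrite ler_wpM2l ?h_ge0//; apply: ler_sum => q _; exact: drift_gap_le.
  apply/cvgrPdist_le => e e0.
  pose e1 := Num.min 1 (e / (2 * M + 1)).
  have M1 : 0 < 2 * M + 1 by rewrite ltr_wpDl// mulr_ge0.
  have e1_gt0 : 0 < e1 by rewrite lt_min ltr01 divr_gt0.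
  have e1_le1 : e1 <= 1 by rewrite ge_min lexx.
  have e1_le : e1 * (2 * M) <= e.
    have : e1 * (2 * M + 1) <= e by rewrite -ler_pdivlMr// ge_min lexx orbT.
    by apply: le_trans; rewrite ler_wpM2l ?(ltW e1_gt0)// lerDl.
  near=> k.
  have k0 : (0 < k)%N by near: k; exact: nbhs_infty_gt.
  have Yu : enorm (Y i s w - u k w)
      <= h k * (\sum_(q < k) enorm (gap m i (grid (tm m) s k q) w)) + e1.
    by near: k; exact: FE.
  have A_rho : enorm (A k w) <= rho.
    have -> : A k w = err i s w - (Y i s w - u k w).
      by rewrite /A /err; apply/rowP => j; rewrite !mxE; ring.
    rewrite (le_trans (enormB _ _))// /rho -addrA; apply: lerD; first exact: err_le hs.
    by apply: (le_trans Yu); apply: lerD => //; exact: gap_sum.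
  rewrite sub0r normrN ger0_norm; last by rewrite le_max lexx orbT.
  rewrite ge_max (ltW e0) andbT /f /theta A_rho scale1r -dotvBl.
  have -> : err i s w - A k w = Y i s w - u k w.
    by rewrite /A /err; apply/rowP => j; rewrite !mxE; ring.
  rewrite -mulr_suml mulrA lerBlDr (le_trans (dotv_le _ _))//.
  rewrite (le_trans (ler_wpM2r (enorm_ge0 _) Yu))// mulrDl addrC lerD2r.
  rewrite (le_trans _ e1_le)// ler_wpM2l ?(ltW e1_gt0)//; exact: chi_le.
have mfp k : measurable_fun W (fp k).
  by apply: measurable_maxr; [exact: (bf k).1|exact: measurable_cst].
have := mean_bounded_cvg0 P mW mfp bd cvg0.
move=> lim; rewrite -subr_le0; apply: (cvgr_to_ge lim).
near=> k.
have k0 : (0 < k)%N by near: k; exact: nbhs_infty_gt.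
apply: (le_trans (Ef k k0)); apply: le_mean => //.
- by split => //; exists (c * (2 * M) + rho * (2 * M)); exact: bd.
- by move=> w _; rewrite le_max lexx.
Unshelve. all: by end_near.
Qed.

End OneStep.

(** * Propagation of the mean squared error *)

Lemma bounded_err_gap m i s : 0 <= s -> bounded_rv W (fun w => dotv (err i s w) (gap m i s w)).
Proof.
by move=> s0; apply: bounded_rv_dotv; [exact: bounded_err|exact: bounded_gap].
Qed.

Lemma bounded_sqr_err i s : 0 <= s -> bounded_rv W (fun w => enorm (err i s w) ^+ 2).
Proof. by move=> s0; apply/bounded_rv_sqr/bounded_rv_enorm/bounded_err. Qed.

(** Above the level [S0] the drift of the mean squared error is nonpositive. On a grid this becomes
    a discrete contraction up to defects, whose sum is bounded on [W] and tends to 0 pathwise, hence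
    in mean. *)
Lemma energy_invariant m i (a S0 : R) : 0 <= a ->
  (forall s, tm m <= s <= tm m.+1 ->
     2 * E (fun w => dotv (err i s w) (gap m i s w))
     - 2 * r * E (fun w => enorm (err i s w) ^+ 2)
     <= - (a * (E (fun w => enorm (err i s w) ^+ 2) - S0))) ->
  E (fun w => enorm (err i (tm m) w) ^+ 2) <= S0 ->
  forall s, tm m <= s <= tm m.+1 -> E (fun w => enorm (err i s w) ^+ 2) <= S0.
Proof.
move=> a0 hdiss hstart s hs; have /andP[ms sm] := hs.
have r0 := ltW (r_gt0 hV).
pose h k : R := (s - tm m) / k%:R.
have h_ge0 k : 0 <= h k by rewrite divr_ge0// subr_ge0.
pose g k q := grid (tm m) s k q.
have g_in k q : (q <= k)%N -> tm m <= g k q <= tm m.+1.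
  move=> qk; have /andP[g1 g2] : tm m <= g k q <= s.
    by apply: (@grid_itv R (tm m) s s) => //; rewrite ms lexx.
  by rewrite g1 (le_trans g2).
have g_ge0 k q : 0 <= g k q by rewrite addr_ge0// mulr_ge0//; exact: h_ge0.
pose v k q := E (fun w => enorm (err i (g k q) w) ^+ 2).
pose D k q w := 2 * dotv (err i (g k q) w) (gap m i (g k q) w)
  - 2 * r * enorm (err i (g k q) w) ^+ 2.
(* This is the defect of the energy expansion on one grid cell. For a fixed sample point in [W],
   [energy_step] bounds its positive part by an arbitrarily small multiple of [h k], uniformly in
   [q]. *)
pose F k q w := enorm (err i (g k q.+1) w) ^+ 2 - enorm (err i (g k q) w) ^+ 2
  - h k * D k q w.
pose Fp k q w := Num.max (F k q w) 0.
have bD k q : bounded_rv W (D k q).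
  by apply: bounded_rvB; apply: bounded_rvZ; [exact: bounded_err_gap|exact: bounded_sqr_err].
have bF k q : bounded_rv W (F k q).
  by apply: bounded_rvB; [apply: bounded_rvB; exact: bounded_sqr_err|exact: bounded_rvZ].
pose c := 2 * M * tm m.+1.
have c0 : 0 <= c by rewrite mulr_ge0 ?tm_ge0// mulr_ge0.
(* The first two terms bound the growth of the squared error over a cell, the last two bound [- D];
   all are divided by [h k]. *)
pose C := 4 * M * c + 4 * M ^+ 2 * tau + 4 * M * c + 2 * r * c ^+ 2.
have C0 : 0 <= C by rewrite !addr_ge0 ?mulr_ge0 ?sqr_ge0 ?(ltW tau_gt0).
have F_le k q w : (0 < k)%N -> (q < k)%N -> W w -> F k q w <= h k * C.
  move=> k0 qk Ww.
  have /andP[mg gm] := g_in k q (ltnW qk).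
  have /andP[mg' gm'] := g_in k q.+1 qk.
  have gg : g k q.+1 - g k q = h k by rewrite /g gridS addrC addKr.
  have gle : g k q <= g k q.+1 by rewrite -subr_ge0 gg.
  have gr := err_growth i Ww mg gle gm'; rewrite gg in gr.
  have ec : enorm (err i (g k q) w) <= c.
    rewrite (le_trans (err_le i Ww (g_in k q (ltnW qk))))// ler_wpM2l ?mulr_ge0//.
  have htau : h k <= tau.
    rewrite ler_pdivrMr ?ltr0n// (@le_trans _ _ tau)//; first by rewrite lerBlDl -tmS.
    by rewrite ler_peMr ?(ltW tau_gt0)// ler1n.
  set e := enorm (err i (g k q) w) in gr ec *.
  have e0 : 0 <= e by exact: enorm_ge0.
  have sq : enorm (err i (g k q.+1) w) ^+ 2 <= (e + 2 * M * h k) ^+ 2.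
    rewrite lerXn2r ?nnegrE ?enorm_ge0//; apply: addr_ge0 => //.
    by apply: mulr_ge0 => //; rewrite mulr_ge0.
  have hM : 0 <= h k * (4 * M) by apply: mulr_ge0 => //; rewrite mulr_ge0.
  have t1 := ler_wpM2l hM ec.
  have t2 : h k * (4 * M ^+ 2) * h k <= h k * (4 * M ^+ 2) * tau.
    by rewrite ler_wpM2l//; apply: mulr_ge0 => //; rewrite mulr_ge0 ?sqr_ge0.
  have t3 : h k * - (2 * dotv (err i (g k q) w) (gap m i (g k q) w)) <= h k * (4 * M * c).
    rewrite ler_wpM2l// -mulrN -dotvNl.
    have -> : 4 * M * c = 2 * (c * (2 * M)) by ring.
    rewrite ler_wpM2l// (le_trans (dotv_le _ _))// enormN.
    by apply: ler_pM; rewrite ?enorm_ge0//; exact: drift_gap_le.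
  have t4 : h k * (2 * r * e ^+ 2) <= h k * (2 * r * c ^+ 2).
    rewrite ler_wpM2l// ler_wpM2l ?mulr_ge0//.
    by rewrite lerXn2r ?nnegrE.
  rewrite /F /D -/e /C; move: sq t1 t2 t3 t4; clear gr ec e0.
  move: (dotv _ _) (enorm (err i (g k q.+1) w)) (h k) e => x1 x2 x3 x5.
  by rewrite sqrrD exprMn; lra.
have Fp_ge0 k q w : 0 <= Fp k q w by rewrite le_max lexx orbT.
have Fp_le k q w : (0 < k)%N -> (q < k)%N -> W w -> Fp k q w <= h k * C.
  by move=> k0 qk Ww; rewrite ge_max F_le//= mulr_ge0.
have mFp k q : measurable_fun W (Fp k q).
  by apply: measurable_maxr; [exact: (bF k q).1|exact: measurable_cst].
have hk_sum k (z : R) : (0 < k)%N -> \sum_(q < k) h k * z = (s - tm m) * z.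
  move=> k0; rewrite sumr_const card_ord -[(h k * z) *+ k]mulr_natr mulrAC /h divfK//.
  by rewrite pnatr_eq0 -lt0n.
(* The bound on the defects needs a nonempty grid; the value at [k = 0] is set to 0 so that
   domination holds at every index. *)
pose G k w := if (0 < k)%N then \sum_(q < k) Fp k q w else 0.
have mG k : measurable_fun W (G k).
  rewrite /G; case: (0 < k)%N; last exact: measurable_cst.
  by apply: measurable_sum => q; exact: mFp.
have G_ge0 k w : 0 <= G k w by rewrite /G; case: ifP => // _; rewrite sumr_ge0.
have bG k w : W w -> `|G k w| <= (s - tm m) * C.
  move=> Ww; rewrite ger0_norm// /G; case: ifPn => k0; last by rewrite mulr_ge0// subr_ge0.
  by rewrite -(hk_sum k)//; apply: ler_sum => q _; exact: Fp_le.
have cG w : W w -> G k w @[k --> \oo] --> 0.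
  move=> Ww.
  have [rho hrho] := paths_bounded (tm m.+1) Ww.
  have in0 u : tm m <= u <= tm m.+1 -> 0 <= u <= tm m.+1.
    by move=> /andP[mu ->]; rewrite (le_trans (tm_ge0 m) mu).
  apply/cvgrPdist_le => e e0.
  pose e1 := e / (s - tm m + 1).
  have e1_gt0 : 0 < e1 by rewrite divr_gt0// ltr_wpDl// subr_ge0.
  have H := energy_step hV (sigma := sigma) (t0 := tm m) (t1 := tm m.+1) (rho := rho)
    (G := 2 * M) (x := fun s => X i s w) (y := fun s => Y i s w)
    (beta := fun s => B i s w) (fx := fun s => fullK i s w) (fy := fun s => batchK m i s w)
    (uniform_increments_sub (tm_ge0 m) (lexx _) (X_increments i (tm m.+1) Ww))
    (Y_increments i m Ww) (fun u hu => (hrho i u (in0 u hu)).1)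
    (fun u hu => (hrho i u (in0 u hu)).2) (fun u _ => drift_gap_le m i u Ww) hs e1_gt0.
  near=> k.
  have Hk : forall q, (q < k)%N -> enorm (err i (g k q.+1) w) ^+ 2 <=
     enorm (err i (g k q) w) ^+ 2 + h k * (D k q w + e1).
    by near: k; exact: H.
  rewrite sub0r normrN ger0_norm// /G; case: ifPn => k0; last exact: ltW.
  apply: (@le_trans _ _ (\sum_(q < k) h k * e1)).
    apply: ler_sum => q _; rewrite ge_max mulr_ge0 ?(ltW e1_gt0)// andbT /F.
    by have := Hk q (ltn_ord q); rewrite mulrDr; lra.
  rewrite hk_sum// /e1 mulrA ler_pdivrMr ?ltr_wpDl ?subr_ge0//.
  by rewrite mulrC ler_wpM2l ?(ltW e0)// lerDl.
have lim := mean_bounded_cvg0 P mW mG bG cG.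
rewrite -subr_le0; apply: (cvgr_to_ge lim).
near=> k.
have k0 : (0 < k)%N by near: k; exact: nbhs_infty_gt.
have ha1 : 0 <= h k * a <= 1.
  rewrite mulr_ge0//= /h mulrAC ler_pdivrMr ?ltr0n// mul1r.
  by near: k; exact: nbhs_infty_ger.
have bFp q : (q < k)%N -> bounded_rv W (Fp k q).
  move=> qk; split => //; exists (h k * C) => w Ww.
  by rewrite ger0_norm ?Fp_ge0// Fp_le.
pose ee q := if (q < k)%N then E (Fp k q) else 0.
have ee0 q : 0 <= ee q by rewrite /ee; case: ifP => // _; apply: mean_ge0.
have v0 : v k 0%N <= S0 by rewrite /v /g grid0.
have step q : (q < k)%N -> v k q.+1 <= v k q - (h k * a) * (v k q - S0) + ee q.
  move=> qk.
  have bv q' : bounded_rv W (fun w => enorm (err i (g k q') w) ^+ 2) by exact: bounded_sqr_err.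
  have EF : E (F k q) <= ee q.
    rewrite /ee qk; apply: le_mean => //; first exact: bFp.
    by move=> w _; rewrite le_max lexx.
  have EFE : E (F k q) = v k q.+1 - v k q - h k * E (D k q).
    rewrite (meanB P mW (bounded_rvB (bv q.+1) (bv q)) (bounded_rvZ (h k) (bD k q))).
    by rewrite meanB ?meanZ.
  have EDE : E (D k q) = 2 * E (fun w => dotv (err i (g k q) w) (gap m i (g k q) w))
      - 2 * r * v k q.
    rewrite /D meanB ?meanZ//; first exact: bounded_err_gap.
      by apply: bounded_rvZ; exact: bounded_err_gap.
    by apply: bounded_rvZ.
  have := ler_wpM2l (h_ge0 k) (hdiss _ (g_in k q (ltnW qk))).
  rewrite -/(v k q) -EDE => hD.
  move: EF hD; rewrite EFE; move: (v k q.+1) (v k q) (E (D k q)) (ee q) => x1 x2 x3 x4.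
  rewrite mulrN mulrA => h1 h2.
  rewrite -lerBlDl (le_trans _ h1)// opprB addrA addrAC lerD2l lerNr.
  by rewrite (le_trans h2).
have := contraction_invariant ha1 ee0 v0 step.
rewrite /v /g gridn// => main.
rewrite lerBlDl (le_trans main)// lerD2l /G k0.
rewrite mean_sum//; last first.
  move=> q; exact: (bFp q (ltn_ord q)).
by rewrite le_eqVlt; apply/orP; left; apply/eqP; apply: eq_bigr => q _; rewrite /ee ltn_ord.
Unshelve. all: by end_near.
Qed.

(** The gap is at most [2 * M], so [4 * M * e <= r * e ^+ 2 + r * (2 * M / r) ^+ 2] spends half of
    the contraction [2 * r] and leaves the rate [r]. The level does not involve [tau], which is what
    large time steps require. *)
Lemma mean_err_uniform m i s : tm m <= s <= tm m.+1 ->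
  E (fun w => enorm (err i s w) ^+ 2) <= (2 * M / r) ^+ 2.
Proof.
have r0 := r_gt0 hV.
have diss m' s' : tm m' <= s' <= tm m'.+1 ->
    2 * E (fun w => dotv (err i s' w) (gap m' i s' w))
     - 2 * r * E (fun w => enorm (err i s' w) ^+ 2)
     <= - (r * (E (fun w => enorm (err i s' w) ^+ 2) - (2 * M / r) ^+ 2)).
  move=> /andP[ms _]; have s'0 : 0 <= s' by exact: le_trans ms.
  have b1 := bounded_sqr_err i s'0.
  have b2 := @bounded_rv_cst R _ T W (r * (2 * M / r) ^+ 2).
  have : E (fun w => 2 * dotv (err i s' w) (gap m' i s' w))
      <= E (fun w => r * enorm (err i s' w) ^+ 2 + r * (2 * M / r) ^+ 2).
    apply: le_mean => //.
    - by apply: bounded_rvZ; exact: bounded_err_gap.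
    - by apply: bounded_rvD => //; exact: bounded_rvZ.
    move=> w Ww; set e := enorm (err i s' w).
    have h1 : dotv (err i s' w) (gap m' i s' w) <= e * (2 * M).
      rewrite (le_trans (dotv_le _ _))// ler_wpM2l ?enorm_ge0//.
      exact: drift_gap_le.
    have h2 : 0 <= r * (e - 2 * M / r) ^+ 2 by rewrite mulr_ge0 ?sqr_ge0// ltW.
    have h3 : r * (e - 2 * M / r) ^+ 2 = r * e ^+ 2 + r * (2 * M / r) ^+ 2 - 2 * (e * (2 * M)).
      by field; rewrite gt_eqF.
    by move: h1 h2; rewrite h3; move: (dotv _ _) => x; lra.
  rewrite meanZ//; last exact: bounded_err_gap.
  rewrite (meanD P mW (bounded_rvZ r b1) b2) meanZ// mean_cst//.
  by move: (E _) (E _) => x1 x2; lra.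
have start : forall m', E (fun w => enorm (err i (tm m') w) ^+ 2) <= (2 * M / r) ^+ 2.
  elim=> [|m' IH].
    rewrite (_ : E _ = 0) ?sqr_ge0//.
    rewrite -[RHS](mean_cst mW PW 0); apply: eq_mean => w Ww.
    by rewrite mul0r /err X_init// Y_init// subrr enorm0 expr0n.
  by apply: (energy_invariant (ltW r0) (diss m') IH); rewrite tm_le lexx.
exact: (energy_invariant (ltW r0) (diss m) (start m)).
Qed.

(* Over a step the interaction gap is [chi] plus a term controlled by the
   errors of the batch, so the drift loses at most [3 L] of the contraction
   rate [2 r]; the choice of the Young parameter leaves a positive rate. *)
Lemma mean_err_bound m i s : 2 * L < r -> tm m <= s <= tm m.+1 ->
  E (fun w => enorm (err i s w) ^+ 2)
  <= error_constant r L M * (tau / p.-1%:R + tau ^+ 2).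
Proof.
move=> hrL.
pose eps := young_parameter r L.
have eps0 : 0 < eps by exact: young_parameter_gt0.
set S0 := error_constant r L M * _.
have p1 : 0 < p.-1%:R :> R by rewrite ltr0n -subn1 subn_gt0.
have S00 : 0 <= S0.
  by rewrite mulr_ge0 ?error_constant_ge0// addr_ge0 ?sqr_ge0// divr_ge0// ltW.
have step m' : (forall j, E (fun w => enorm (err j (tm m') w) ^+ 2) <= S0) ->
    forall j s', tm m' <= s' <= tm m'.+1 -> E (fun w => enorm (err j s' w) ^+ 2) <= S0.
  have a0 : 0 <= 2 * r - 3 * L by move: L0 hrL; lra.
  move=> start j; apply: (energy_invariant a0) => //.
  move=> s' hs'; have s'0 : 0 <= s' by case/andP: hs' => + _; exact: le_trans.
  have b1 := bounded_sqr_err j s'0.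
  pose be w := \sum_k batch_weight R (xi m' w) j k * enorm (err k s' w) ^+ 2.
  have b2 : bounded_rv W be.
    apply: bounded_rv_sum => k.
    by apply: bounded_rvM; [exact: bounded_batch_weight|exact: bounded_sqr_err].
  have b3 : bounded_rv W (fun w => dotv (err j s' w) (chi m' j s' w)).
    by apply: bounded_rv_dotv; [exact: bounded_err|exact: bounded_chi].
  have Q1 := mean_batch_err_sqr_step eps0 start j hs'.
  have Q2 := mean_err_chi eps0 start j hs'.
  have young_sum w : W w -> 2 * dotv (err j s' w) (gap m' j s' w) <=
      2 * dotv (err j s' w) (chi m' j s' w) + (3 * L * enorm (err j s' w) ^+ 2 + L * be w).
    move=> Ww; set e := enorm (err j s' w).
    have -> : gap m' j s' w = chi m' j s' w + (gap m' j s' w - chi m' j s' w).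
      by rewrite addrC subrK.
    rewrite dotvDr mulrDr lerD2l.
    have sbw := sum_batch_weight R p_gt1 j (W_division m' Ww).
    (* Young's inequality inside the batch, where the weights have sum 1. With the term
       [L * e ^+ 2], doubling gives [3 * L] on the particle and [L] on the batch average. *)
    have h1 : e * (\sum_k batch_weight R (xi m' w) j k * enorm (err k s' w))
        <= 2^-1 * e ^+ 2 + 2^-1 * be w.
      rewrite -[2^-1 * e ^+ 2]mul1r -[X in X * (_ * _)]sbw mulr_suml !mulr_sumr -big_split/=.
      apply: ler_sum => k _; set z := enorm (err k s' w).
      have b0 := batch_weight_ge0 R (xi m' w) j k.
      move: (batch_weight _ _ _ _) b0 => b b0.
      rewrite -subr_ge0 (_ : _ - _ = b * (2^-1 * (e - z) ^+ 2)); last by field.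
      by apply: mulr_ge0 => //; apply: mulr_ge0; rewrite ?invr_ge0 ?sqr_ge0.
    have h2 : dotv (err j s' w) (gap m' j s' w - chi m' j s' w)
        <= e * (L * (e + \sum_k batch_weight R (xi m' w) j k * enorm (err k s' w))).
      rewrite (le_trans (dotv_le _ _))// ler_wpM2l ?enorm_ge0//.
      exact: gap_chi_le.
    have := ler_wpM2l L0 h1.
    by move: h2; clear h1; move: (dotv _ _) (\sum_k _) (be w) e => x1 x2 x3 x4; lra.
  have := le_mean P mW (bounded_rvZ 2 (bounded_err_gap m' j s'0))
    (bounded_rvD (bounded_rvZ 2 b3) (bounded_rvD (bounded_rvZ (3 * L) b1) (bounded_rvZ L b2)))
    young_sum.
  rewrite meanZ//; last exact: bounded_err_gap.
  rewrite (meanD P mW (bounded_rvZ 2 b3) (bounded_rvD (bounded_rvZ (3 * L) b1) (bounded_rvZ L b2))).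
  rewrite (meanD P mW (bounded_rvZ (3 * L) b1) (bounded_rvZ L b2)) !meanZ//.
  move=> main.
  have LQ := ler_wpM2l L0 Q1.
  (* In [L * Q + 2 * Q'] the terms carrying [S0] are at most [(r - L) * S0] and the others at most
     [(r - 2 * L) * S0]; together they give [(2 * r - 3 * L) * S0], as the invariance requires. *)
  have ye := ler_wpM2r S00 (young_parameter_le L0 hrL).
  have S0E : (r - 2 * L) * S0 = ((L + 4 * eps) * (1 + eps^-1) * (4 * M ^+ 2) + 4 * M ^+ 2
       + 4 * eps^-1 * (L * M) ^+ 2) * (tau / p.-1%:R + tau ^+ 2).
    rewrite /S0 /error_constant -/eps mulrA [X in X * _]mulrC divfK//.
    by rewrite gt_eqF// subr_gt0.
  have c1 : 0 <= ((L + 4 * eps) * (1 + eps^-1) * (4 * M ^+ 2)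
       + 4 * eps^-1 * (L * M) ^+ 2) * (tau / p.-1%:R).
    rewrite mulr_ge0 ?divr_ge0 ?(ltW tau_gt0) ?(ltW p1)// addr_ge0// !mulr_ge0 ?sqr_ge0//.
    - by rewrite addr_ge0// mulr_ge0// ltW.
    - by rewrite addr_ge0// invr_ge0 ltW.
    - by rewrite invr_ge0 ltW.
  have c2 : 0 <= 4 * M ^+ 2 * tau ^+ 2.
    by apply: mulr_ge0; [apply: mulr_ge0 => //; exact: sqr_ge0 | exact: sqr_ge0].
  move: main Q2 LQ ye S0E c1 c2; rewrite -/eps.
  move: (E _) (E _) (E _) (E _) (tau / _) => x1 x2 x3 x4 x5.
  move=> main Q2 LQ ye S0E c1 c2.
  by lra.
move: m i s; suff start m' : forall j, E (fun w => enorm (err j (tm m') w) ^+ 2) <= S0.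
  by move=> m i s hs; exact: (step m).
elim: m' => [|m' IH] j; last by apply: (step m') => //; rewrite tm_le lexx.
rewrite (_ : E _ = 0)//.
rewrite -[RHS](mean_cst mW PW 0); apply: eq_mean => w Ww.
by rewrite mul0r /err X_init// Y_init// subrr enorm0 expr0n.
Qed.

End BatchError.

(** * Transport cost and conclusion *)

Section Transport.
Variables (R : realType) (d : nat) (disp : measure_display) (T : measurableType disp).
Variable P : probability T R.

Lemma ae_full_set (Q : T -> Prop) : {ae P, forall w, Q w} ->
  exists W : set T, [/\ measurable W, P W = 1%E & W `<=` Q].
Proof.
move=> [A [mA PA QA]]; exists (~` A); split; first exact: measurableC.
  by rewrite probability_setC// PA sube0.
by move=> w nAw; apply: contrapT => nQ; apply/nAw/QA.
Qed.

Lemma l2norm_le (W : set T) (v : T -> 'rV[R]_d) (c : R) : measurable W -> P W = 1%E ->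
  measurable_fun setT v -> bounded_vec W v -> 0 <= c ->
  mean P W (fun w => enorm (v w) ^+ 2) <= c ^+ 2 -> (l2norm P v <= c%:E)%E.
Proof.
move=> mW PW mv bv c0 vc.
have bv2 : bounded_rv W (fun w => enorm (v w) ^+ 2).
  by apply/bounded_rv_sqr/bounded_rv_enorm.
have PWC : P (~` W) = 0%E by rewrite probability_setC// PW subee.
have -> : l2norm P v = ((mean P W (fun w => enorm (v w) ^+ 2))%:E `^ 2^-1)%E.
  rewrite /l2norm (ge0_negligible_integral (N := ~` W))//; last 3 first.
  - exact: measurableC.
  - by apply/measurable_EFinP; apply: measurable_funX; exact: measurable_enorm.
  - by move=> w _; rewrite lee_fin sqr_ge0.
  rewrite setDE setCK setTI; congr poweR.
  rewrite /mean /Rintegral fineK//.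
  exact: (integrable_fin_num mW (bounded_rv_integrable P mW bv2)).
rewrite poweR_EFin lee_fin powR12_sqrt; last by apply: mean_ge0 => w _; exact: sqr_ge0.
by rewrite -[c]ger0_norm// -sqrtr_sqr ler_wsqrtr.
Qed.

Section PairCoupling.
Variables X Y : {RV P >-> 'rV[R]_d}.

Definition paired (w : T) : 'rV[R]_d * 'rV[R]_d := (X w, Y w).

Let measurable_paired : measurable_fun setT paired.
Proof. by apply: measurable_fun_pair; exact: measurable_funPT. Qed.

HB.instance Definition _ := isMeasurableFun.Build _ _ _ _ paired measurable_paired.

(** Synchronous coupling: the joint law of the two variables on their common probability space is
    one competitor in the infimum. *)
Lemma W2_le_l2norm : (W2 (distribution P X) (distribution P Y)
  <= l2norm P (fun w => Y w - X w)%R)%E.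
Proof.
have int0 (Q : probability ('rV[R]_d * 'rV[R]_d)%type R) :
    (0 <= \int[Q]_z (enorm (z.1 - z.2)%R ^+ 2)%:E)%E.
  by apply: integral_ge0 => z _; rewrite lee_fin sqr_ge0.
have le_int : (ereal_inf [set \int[gamma]_z (enorm (z.1 - z.2)%R ^+ 2)%:E
    | gamma in couplings (distribution P X) (distribution P Y)]
    <= \int[P]_w (enorm (Y w - X w)%R ^+ 2)%:E)%E.
  apply: ereal_inf_lbound; exists (distribution P paired).
    by move=> A mA; split; congr (P _); apply/seteqP; split => w //= [].
  have mf : measurable_fun setT
      (fun z : 'rV[R]_d * 'rV[R]_d => (enorm (z.1 - z.2)%R ^+ 2)%:E).
    apply/measurable_EFinP; apply: measurable_funX; apply: measurable_enorm.
    exact: measurable_subv.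
  transitivity (\int[P]_w (enorm (X w - Y w)%R ^+ 2)%:E)%E.
    apply: (ge0_integral_distribution (paired : {RV P >-> _}) mf) => z.
    by rewrite lee_fin sqr_ge0.
  by apply: eq_integral => w _; rewrite enormBC.
apply: gt0_ler_poweR => //.
- rewrite in_itv/= leey andbT; apply: le_ereal_inf_tmp => _ [gamma _ <-]; exact: int0.
- by rewrite in_itv/= leey andbT integral_ge0// => w _; rewrite lee_fin sqr_ge0.
Qed.

End PairCoupling.
End Transport.

Section ErrorBounds.
Variables (R : realType) (d : nat) (V : 'rV[R]_d -> R) (K : 'rV[R]_d -> 'rV[R]_d).
Variables (r L M : R) (n p : nat) (tau sigma : R).
Variables (disp : measure_display) (T : measurableType disp) (P : probability T R).
Variable nu : probability 'rV[R]_d R.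
Local Notation N := (n * p)%N.
Variables (X0 : 'I_N -> {RV P >-> 'rV[R]_d}) (B : 'I_N -> R -> {RV P >-> 'rV[R]_d}).
Variable xi : nat -> T -> {set {set 'I_N}}.
Variables X Y : 'I_N -> R -> {RV P >-> 'rV[R]_d}.

(** The almost sure properties concern finitely many particles and countably many steps, so one set
    of full measure carries them all. Of the two bounds, the first gives the rate and the second
    serves [tau > 1]. *)
Lemma l2norm_error_le : potential_assumption V r -> 0 <= L -> 2 * L < r ->
  (forall x y, enorm (K x - K y) <= L * enorm (x - y)) ->
  (forall x, enorm (K x) <= M) -> continuous K ->
  (0 < n)%N -> (1 < p)%N -> 0 < tau ->
  random_data nu X0 B xi -> is_ips V K sigma X0 B X ->
  is_rbm1 V K sigma tau X0 B xi Y ->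
  forall i t, 0 <= t ->
    (l2norm P (fun w => Y i t w - X i t w)%R
       <= (Num.sqrt (error_constant r L M) * Num.sqrt (tau / p.-1%:R + tau ^+ 2))%:E)%E
    /\ (l2norm P (fun w => Y i t w - X i t w)%R <= (2 * M / r)%:E)%E.
Proof.
move=> hV L0 hrL KL KM cK n_gt0 p_gt1 tau_gt0 hdata hX hY i t t0.
have B_ae : {ae P, forall w, forall i, {within `[0, +oo[, continuous (fun t => B i t w)}}.
  by apply: filter_forall => j; exact: (brownian_continuous (data_brownian hdata j)).
have D_ae : {ae P, forall w, forall m, is_division (xi m w)}.
  apply: ae_foralln => m.
  exists (~` (xi m @^-1` [set D | is_division D])); split => //.
    by apply: measurableC; exact: (measurable_division hdata).
  have /= -> := probability_setC P (measurable_division hdata (fun D => is_division D) m).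
  by rewrite (division_full hdata (ltnW p_gt1)) subee.
have [W [mW PW Wgood]] : exists W : set T, [/\ measurable W, P W = 1%E & W `<=` _] :=
  ae_full_set (filterI (filterI B_ae D_ae) (filterI hX hY)).
have W_division w m : W w -> is_division (xi m w) by move=> /Wgood[[_ +] _]; exact.
have B_cont w j : W w -> {within `[0, +oo[, continuous (fun t => B j t w)}.
  by move=> /Wgood[[+ _] _]; exact.
have X_cont w j : W w -> {within `[0, +oo[, continuous (fun t => X j t w)}.
  by move=> /Wgood[_ [/(_ j)[+ _ _] _]].
have Y_cont w j : W w -> {within `[0, +oo[, continuous (fun t => Y j t w)}.
  by move=> /Wgood[_ [_ /(_ j)[+ _ _]]].
have X_init w j : W w -> X j 0 w = X0 j w by move=> /Wgood[_ [/(_ j)[_ + _] _]].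
have Y_init w j : W w -> Y j 0 w = X0 j w by move=> /Wgood[_ [_ /(_ j)[_ + _]]].
have X_sde w j (Ww : W w) := let: And3 _ _ h := (Wgood w Ww).2.1 j in h.
have Y_sde w j m (Ww : W w) := let: And3 _ _ h := (Wgood w Ww).2.2 j in h m.
have [m hm] := exists_step tau_gt0 t0.
have mE : measurable_fun setT (fun w => Y i t w - X i t w).
  by apply: measurable_subv; exact: measurable_funPT.
have bE : bounded_vec W (fun w => Y i t w - X i t w).
  exact: (bounded_err hV KM cK n_gt0 p_gt1 tau_gt0 W_division B_cont X_cont Y_cont X_init
    Y_init X_sde Y_sde i t0).
have C0 : 0 <= error_constant r L M by exact: error_constant_ge0.
have r0 := r_gt0 hV.
have M0 : 0 <= M by exact: le_trans (enorm_ge0 _) (KM 0).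
have rate0 : 0 <= tau / p.-1%:R + tau ^+ 2.
  by rewrite addr_ge0 ?sqr_ge0// divr_ge0// ltW.
split; apply: (l2norm_le mW PW mE bE).
- by rewrite mulr_ge0 ?sqrtr_ge0.
- rewrite -sqrtrM// (sqr_sqrtr (mulr_ge0 C0 rate0)).
  exact: (mean_err_bound hV L0 KL KM cK n_gt0 p_gt1 tau_gt0 hdata mW PW W_division B_cont
    X_cont Y_cont X_init Y_init X_sde Y_sde i hrL hm).
- by rewrite divr_ge0 ?mulr_ge0// ltW.
- exact: (mean_err_uniform hV KM cK n_gt0 p_gt1 tau_gt0 hdata mW PW W_division B_cont
    X_cont Y_cont X_init Y_init X_sde Y_sde i hm).
Qed.

End ErrorBounds.

Theorem theorem3p1 (R : realType) (d : nat) (V : 'rV[R]_d -> R)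
    (K : 'rV[R]_d -> 'rV[R]_d) (r L sigma : R) (nu : probability 'rV[R]_d R)
    (hV : potential_assumption V r) (hK : kernel_assumption K L)
    (hrL : 2 * L < r) (hsigma : 0 <= sigma) :
  exists C C' : R,
    forall (n p : nat) (tau : R) (hn : (1 <= n)%N) (hp : (2 <= p)%N)
      (htau : 0 < tau)
      (disp : measure_display) (T : measurableType disp) (P : probability T R)
      (X0 : 'I_(n * p) -> {RV P >-> 'rV[R]_d})
      (B : 'I_(n * p) -> R -> {RV P >-> 'rV[R]_d})
      (xi : nat -> T -> {set {set 'I_(n * p)}})
      (X Y : 'I_(n * p) -> R -> {RV P >-> 'rV[R]_d})
      (hdata : random_data nu X0 B xi)
      (hX : is_ips V K sigma X0 B X)
      (hY : is_rbm1 V K sigma tau X0 B xi Y)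
      (i1 : 'I_(n * p)) (hi1 : i1 = 0%N :> nat),
    let rate := Num.sqrt (tau / p.-1%:R + tau ^+ 2) in
    let errZ := ereal_sup [set l2norm P (fun w => Y i1 t w - X i1 t w)
                          | t in [set t : R | 0 <= t]] in
    let errW2 := ereal_sup [set W2 (distribution P (X i1 t))
                                   (distribution P (Y i1 t))
                           | t in [set t : R | 0 <= t]] in
    [/\ (errZ <= (C * rate)%:E)%E,
        (errW2 <= (C * rate)%:E)%E,
        (errW2 <= (C' * Num.sqrt tau)%:E)%E
      & tau <= 1 -> C * rate <= C' * Num.sqrt tau].
Proof.
have r0 := r_gt0 hV.
(* In dimension 0 the constant [L] may be negative; as [0 < r], its positive part still satisfies
   the strict inequality. *)
pose L' := Num.max L 0.
have L'0 : 0 <= L' by rewrite le_max lexx orbT.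
have hrL' : 2 * L' < r by rewrite /L' maxEle; case: ifP => // _; rewrite mulr0.
have [M KM] := K_bounded hK.
have M0 : 0 <= M by exact: le_trans (enorm_ge0 _) (KM 0).
have KL x y : enorm (K x - K y) <= L' * enorm (x - y).
  by rewrite (le_trans (K_lipschitz hK x y))// ler_wpM2r ?enorm_ge0// le_max lexx.
have cK : continuous K by move=> x; exact: differentiable_continuous (K_differentiable hK x).
pose C := Num.sqrt (error_constant r L' M).
have C0 : 0 <= C by exact: sqrtr_ge0.
(* For [tau <= 1] the rate is at most [sqrt (2 * tau)], whence the first term of [C']; for [tau > 1]
   the uniform bound [2 * M / r] is at most its product with [sqrt tau]. *)
exists C, (Num.sqrt 2 * C + 2 * M / r).
move=> n p tau hn hp htau disp T P X0 B xi X Y hdata hX hY i1 _ rate errZ errW2.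
have bounds := l2norm_error_le hV L'0 hrL' KL KM cK hn hp htau hdata hX hY i1.
have stau0 : 0 <= Num.sqrt tau by exact: sqrtr_ge0.
have Mr0 : 0 <= 2 * M / r by rewrite divr_ge0 ?mulr_ge0// ltW.
have rate_le : tau <= 1 -> C * rate <= (Num.sqrt 2 * C + 2 * M / r) * Num.sqrt tau.
  move=> tau1.
  have rate2 : rate <= Num.sqrt 2 * Num.sqrt tau.
    rewrite -sqrtrM// ler_wsqrtr// mulr2n mulrDl mul1r lerD//.
      by rewrite ler_piMr ?(ltW htau)// invf_le1 ?ltr0n ?ler1n -?subn1 ?subn_gt0.
    by rewrite expr2 ler_piMr// ltW.
  rewrite mulrDl (le_trans (ler_wpM2l C0 rate2))// mulrA [C * _]mulrC lerDl.
  by rewrite mulr_ge0.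
have W2_rate : (errW2 <= (C * rate)%:E)%E.
  apply: ge_ereal_sup => _ [t t0 <-].
  by rewrite (le_trans (W2_le_l2norm _ _))//; exact: (bounds t t0).1.
split => //.
  by apply: ge_ereal_sup => _ [t t0 <-]; exact: (bounds t t0).1.
have [tau1|tau1] := leP tau 1; first by rewrite (le_trans W2_rate)// lee_fin rate_le.
apply: ge_ereal_sup => _ [t t0 <-].
rewrite (le_trans (W2_le_l2norm _ _))// (le_trans (bounds t t0).2)//.
have tau_ge1 : 1 <= Num.sqrt tau by rewrite -[leLHS]sqrtr1 ler_wsqrtr// ltW.
rewrite lee_fin.
rewrite [leRHS]mulrDl (le_trans (ler_peMr Mr0 tau_ge1))// lerDr.
by rewrite !mulr_ge0// sqrtr_ge0.
Qed.
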